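(* Let $X$ be a complex Banach space and let $f:\mathbb{R}_+\to X$ be bounded, continuous and Lipschitz continuous, with $\sup_{t\ge0}\left\|\int_0^t f(s)\,\mathrm{d}s\right\|<\infty$. Suppose that $\widehat{f}$ admits a boundary function $F\in L^1_{\mathrm{loc}}(\mathbb{R}\setminus\{0\};X)$, i.e. $$\lim_{\alpha\to0+}\int_\mathbb{R}\widehat{f}(\alpha+\mathrm{i}s)\psi(s)\,\mathrm{d}s=\int_\mathbb{R}F(s)\psi(s)\,\mathrm{d}s\quad\text{for all }\psi\in C_\mathrm{c}(\mathbb{R}\setminus\{0\}).$$ Then $f\in C_0(\mathbb{R}_+;X)$. Moreover, let $m:(0,1]\to[1,\infty)$ be continuous non-increasing and $M:[1,\infty)\to[1,\infty)$ continuous non-decreasing. Then: (a) If $k\ge1$ is an integer, $F\in C^k(\mathbb{R}\setminus\{0\};X)$ and there is $C>0$ with $\|F^{(j)}(s)\|\le C|s|^{k-j}m(|s|)^{k+1}$ for $0<|s|\le1$, $0\le j\le k$, and $\|F^{(j)}(s)\|\le CM(|s|)^{j+1}$ for $|s|\ge1$, $0\le j\le k$, then for every $c>0$, $$\|f(t)\|=O\left(m_k^{-1}(ct)+\frac{1}{M_k^{-1}(ct)}\right),\quad t\to\infty.$$ (b) If $F\in C^\infty(\mathbb{R}\setminus\{0\};X)$ and there is $C>0$ with $\|F^{(j)}(s)\|\le C\,j!\,|s|\,m(|s|)^{j+1}$ for $0<|s|\le1$, $j\ge0$, and $\|F^{(j)}(s)\|\le C\,j!\,M(|s|)^{j+1}$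 for $|s|\ge1$, $j\ge0$, then for every $c\in(0,1/2)$, $$\|f(t)\|=O\left(m_{\log}^{-1}(ct)+\frac{1}{M_{\log}^{-1}(ct)}+\frac1t\right),\quad t\to\infty.$$ Here $m_k(r)=m(r)\left(\frac{m(r)}{r}\right)^{1/k}$ and $m_{\log}(r)=m(r)\log\left(1+\frac{m(r)}{r}\right)$ for $0<r\le1$, $M_k(R)=M(R)\big((1+R)^2M(R)\big)^{1/k}$ and $M_{\log}(R)=M(R)\big(\log(1+R)+\log M(R)\big)$ for $R\ge1$, and $m_k^{-1},m_{\log}^{-1},M_k^{-1},M_{\log}^{-1}$ denote their respective inverse functions.
   Context: The Laplace transform is $\widehat{f}(\lambda)=\int_0^\infty \mathrm{e}^{-\lambda t}f(t)\,\mathrm{d}t$ for $\operatorname{Re}\lambda>0$. The functions $m_k,m_{\log}$ are strictly decreasing and $M_k,M_{\log}$ strictly increasing; their inverses are defined on their ranges, which contain $ct$ for all sufficiently large $t$. *)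

(* Defs.v *)
From HB Require Import structures.
From mathcomp Require Import all_boot all_order all_algebra.
From mathcomp Require Import all_classical all_reals all_analysis.
From mathcomp Require Import complex.
Set Implicit Arguments.
Unset Strict Implicit.
Unset Printing Implicit Defensive.
Import Order.TTheory GRing.Theory Num.Theory.
Import numFieldNormedType.Exports.
Local Open Scope classical_set_scope.
Local Open Scope ring_scope.

Section Defs.
Context {R : realType} {X : normedModType R[i]}.
Local Notation C := (R[i] : numFieldType).
Local Notation mu := (@lebesgue_measure R).

Definition nrm (x : X) : R := complex.Re `|x|.

Definition rscale (r : R) (x : X) : X := (r%:C)%C *: x.

Definition cexp (z : R[i]) : R[i] :=
  Complex (expR (complex.Re z) * cos (complex.Im z))
          (expR (complex.Re z) * sin (complex.Im z)).

Definition simple_seq (n : nat -> nat) (A : nat -> nat -> set R)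
  (x : nat -> nat -> X) (k : nat) (t : R) : X :=
  \sum_(i < n k) rscale (\1_(A k i) t) (x k i).

Definition bochner_integral (D : set R) (F : R -> X) (v : X) : Prop :=
  exists (n : nat -> nat) (A : nat -> nat -> set R) (x : nat -> nat -> X),
    [/\ (forall k i, measurable (A k i) /\ (mu (A k i) < +oo)%E),
        (exists N, mu.-negligible N /\
           forall t, D t -> ~ N t ->
             simple_seq n A x k t @[k --> \oo] --> F t),
        (forall e : R, 0 < e -> exists N : nat, forall k l, (N <= k)%N -> (N <= l)%N ->
           (\int[mu]_(t in D) (nrm (simple_seq n A x k t - simple_seq n A x l t))%:E
             <= e%:E)%E) &
        (\sum_(i < n k) rscale (fine (mu (D `&` A k i))) (x k i)) @[k --> \oo] --> v].

Definition bochner_integrable (D : set R) (F : R -> X) : Prop :=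
  exists v, bochner_integral D F v.

(* the integral (0 if F is not integrable on D) *)
Definition bintegral (D : set R) (F : R -> X) : X :=
  xget 0 [set v | bochner_integral D F v].

Definition laplace (f : R -> X) (lam : R[i]) : X :=
  bintegral [set t | 0 <= t] (fun t => cexp (- ((t%:C)%C * lam)) *: f t).

Definition L1loc_punct (F : R -> X) : Prop :=
  forall K : set R, compact K -> K `<=` ~` [set 0] -> bochner_integrable K F.

Definition Cc_punct (psi : R -> C) : Prop :=
  {within ~` [set 0], continuous psi} /\
  exists K : set R, [/\ compact K, K `<=` ~` [set 0] &
                        forall s, ~ K s -> psi s = 0].

Definition boundary_function (f : R -> X) (F : R -> X) : Prop :=
  forall psi, Cc_punct psi ->
    bintegral setT (fun s => psi s *: laplace f (Complex a s)) @[a --> 0^'+]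
      --> bintegral setT (fun s => psi s *: F s).

Definition Ck_derivs (k : nat) (F : R -> X) (G : nat -> R -> X) : Prop :=
  [/\ (forall s, s != 0 -> G 0%N s = F s),
      (forall j s, (j < k)%N -> s != 0 ->
         (fun h : R => ((h^-1)%:C)%C *: (G j (s + h) - G j s)) @ 0^' --> G j.+1 s) &
      (forall j, (j <= k)%N -> {within ~` [set 0], continuous (G j)})].

Definition Cinf_derivs (F : R -> X) (G : nat -> R -> X) : Prop :=
  [/\ (forall s, s != 0 -> G 0%N s = F s),
      (forall j s, s != 0 ->
         (fun h : R => ((h^-1)%:C)%C *: (G j (s + h) - G j s)) @ 0^' --> G j.+1 s) &
      (forall j, {within ~` [set 0], continuous (G j)})].

End Defs.

Section Growth.
Context {R : realType}.
Definition m_k (m : R -> R) (k : nat) (r : R) : R :=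
  m r * (m r / r) `^ (k%:R)^-1.
Definition m_log (m : R -> R) (r : R) : R := m r * ln (1 + m r / r).
Definition M_k (M : R -> R) (k : nat) (x : R) : R :=
  M x * ((1 + x) ^+ 2 * M x) `^ (k%:R)^-1.
Definition M_log (M : R -> R) (x : R) : R := M x * (ln (1 + x) + ln (M x)).
End Growth.

(* Main.v *)
Require Import Defs.
From HB Require Import structures.
From mathcomp Require Import all_boot all_order all_algebra.
From mathcomp Require Import all_classical all_reals all_analysis.
From mathcomp Require Import complex.
From mathcomp Require Import measurable_realfun.
From mathcomp Require Import ring lra.
Import Order.TTheory GRing.Theory Num.Theory.
Import numFieldNormedType.Exports.
Local Open Scope classical_set_scope.
Local Open Scope ring_scope.

(* Let [l] be a norming real functional, [h] a cutoff equal to [1] for [2 r <= |s| <= R / 2] and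
   supported in [r <= |s| <= R].  Up to an error [O(r + 1/R)], coming from the Lipschitz bound
   on [f] at high frequencies and the bounded primitive at low ones, [l (f t)] is the convolution
   of [l o f] with the Fourier transform of [h].  Damping by [exp (- alpha t)], Fubini and
   [alpha -> 0] turn this convolution into [l] of the integral of [h s * exp (i s t) * F s].
   For fixed [r], [R] that integral tends to [0] (Riemann-Lebesgue), so [f] vanishes at infinity.
   If [F] is smooth, integrate by parts [k] times: in case (a) [r] and [R] are balanced so that
   the remainder is [O(r + 1/R)]; in case (b), after replacing [r] by [max (r, 1/t)], one takes
   [k = floor (t / m r)] for [|s| <= 1] and [k = floor (t / M R)] for [|s| >= 1], and [k! / y^k]
   is exponentially small in [y] for [k = floor y], which beats the powers of [y] produced by the
   cutoff. *)

(** * Real functionals *)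

Section Nrm.
Context {R : realType} {X : normedModType R[i]}.
Implicit Types (x y : X) (a : R).

(** Real functionals of norm at most 1 turn Fubini, dominated convergence and integration by parts
    into scalar statements, with bounds uniform in [l].

    The cutoff is piecewise polynomial, flat to order [n] at its knots. A smooth compactly supported
    cutoff has derivatives outgrowing every [A^i i!], too much for case (b), where the number of
    integrations by parts grows with [t]. A polynomial has boundedly many nonzero derivatives, at
    the price of jumps at the knots. [n >= 2] gives the kernels cubic decay, so they stay integrable
    against [|u|]; in case (a) [n >= k - 1] removes the jumps. In case (b) [n = 2] is fixed and the
    jumps carry powers of [1 / (r t)] and [1 / (R t)], so [r] must not fall below [1 / t]. A further
    [1 / t] arises at frequency 1, where different numbers of integrations meet.

    The condition [c < 1/2] comes from high frequencies: the band length [R] and the target [1 / R]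
    ask for [R^2 M(R)] times the exponential to be bounded, while the logarithm in [M_log] contains
    one power of [1 + R]. So [exp (- 2 c y)] is spent, and [2 c < 1] leaves a margin for the powers
    of [y]. *)

Lemma normE x : `|x| = ((nrm x)%:C)%C.
Proof.
rewrite /nrm; have := normr_ge0 x; case: (`|x|) => re im.
by rewrite lecE /= => /andP[/eqP -> _].
Qed.

Lemma nrm_ge0 x : 0 <= nrm x.
Proof. by have := normr_ge0 x; rewrite normE lecR. Qed.

Lemma nrmD x y : nrm (x + y) <= nrm x + nrm y.
Proof. by have := ler_normD x y; rewrite !normE -rmorphD /= lecR. Qed.

Lemma nrmN x : nrm (- x) = nrm x.
Proof. by rewrite /nrm normrN. Qed.

Lemma nrm0 : nrm (0 : X) = 0.
Proof. by rewrite /nrm normr0. Qed.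

Lemma nrmB x y : nrm (x - y) = nrm (y - x).
Proof. by rewrite -nrmN opprB. Qed.

Lemma nrm_tri x y z : nrm (x - z) <= nrm (x - y) + nrm (y - z).
Proof. by apply: le_trans (nrmD _ _); rewrite addrA subrK. Qed.

Lemma nrm0_eq0 x : nrm x = 0 -> x = 0.
Proof. by move=> h; apply/normr0_eq0; rewrite normE h. Qed.

Lemma nrmZ (c : R[i]) x : nrm (c *: x) = Normc.normc c * nrm x.
Proof.
have := normrZ c x; rewrite !normE normc_def.
case: c => u v /=; rewrite -rmorphM /= => /eqP.
by rewrite eq_complex /= => /andP[/eqP->].
Qed.

Lemma nrm_rscale a x : nrm (rscale a x) = `|a| * nrm x.
Proof. by rewrite /rscale nrmZ /Normc.normc /= expr0n /= addr0 sqrtr_sqr. Qed.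

Lemma rscaleDl a b x : rscale (a + b) x = rscale a x + rscale b x.
Proof. by rewrite /rscale rmorphD /= scalerDl. Qed.
Lemma rscaleDr a x y : rscale a (x + y) = rscale a x + rscale a y.
Proof. by rewrite /rscale scalerDr. Qed.
Lemma rscaleA a b x : rscale a (rscale b x) = rscale (a * b) x.
Proof. by rewrite /rscale rmorphM /= scalerA. Qed.
Lemma rscale1 x : rscale 1 x = x.
Proof. by rewrite /rscale scale1r. Qed.
Lemma rscale0 x : rscale 0 x = 0.
Proof. by rewrite /rscale scale0r. Qed.
Lemma rscaleN a x : rscale (- a) x = - rscale a x.
Proof. by rewrite /rscale rmorphN /= scaleNr. Qed.
Lemma rscaleBr a x y : rscale a (x - y) = rscale a x - rscale a y.
Proof. by rewrite /rscale scalerBr. Qed.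

(** Balls of [X] have radii in [R[i]], whose positive elements are exactly the positive reals; hence
    a test with real radii suffices. *)
Lemma cvg_nrmP {T : Type} (G : set_system T) {FG : Filter G} (f : T -> X) (l : X) :
  f @ G --> l <-> forall e : R, 0 < e -> \forall t \near G, nrm (l - f t) < e.
Proof.
split.
  move=> /cvgrPdist_lt h e e0.
  have /h : (0 < e%:C)%C by rewrite ltcR.
  by apply: filterS => t; rewrite normE ltcR.
move=> h; apply/cvgrPdist_lt => -[u v].
rewrite ltcE /= => /andP[/eqP -> /h].
by apply: filterS => t; rewrite normE ltcR.
Qed.

End Nrm.

(* Only the real-linear structure of the complex space is used: the imaginary
   part of a functional is recovered by evaluating it at ['i *: x]. *)
Section RealFunctional.
Context {R : realType} {X : normedModType R[i]}.

Definition rfunctional (B : R) (l : X -> R) :=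
  [/\ forall x y, l (x + y) = l x + l y,
      forall a x, l (rscale a x) = a * l x &
      forall x, `|l x| <= B * nrm x].

(** The objects for Zorn's lemma. Values of [pval] off [pdom] carry no meaning. The one-sided bound
    is enough: applied to [- x] it bounds the absolute value. *)
Record rpart := RPart {
  pdom : set X;
  pval : X -> R;
  pdomD : forall x y, pdom x -> pdom y -> pdom (x + y);
  pdomZ : forall a x, pdom x -> pdom (rscale a x);
  pvalD : forall x y, pdom x -> pdom y -> pval (x + y) = pval x + pval y;
  pvalZ : forall a x, pdom x -> pval (rscale a x) = a * pval x;
  pvalB : forall x, pdom x -> pval x <= nrm x }.

Definition rpart_le (p q : rpart) : bool :=
  `[< pdom p `<=` pdom q /\ forall x, pdom p x -> pval p x = pval q x >].

(** The union of the chain works because any two points of it already lie in the domain of a single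
    member, where linearity and the bound can be read off. *)
Lemma rpart_chain (A : set rpart) (p0 : rpart) : A p0 -> total_on A rpart_le ->
  exists t, forall s, A s -> rpart_le s t.
Proof.
move=> Ap0 tot.
pose D := [set x | exists2 p, A p & pdom p x].
pose v x := xget 0 [set r | exists p, [/\ A p, pdom p x & r = pval p x]].
have vE p x : A p -> pdom p x -> v x = pval p x.
  move=> Ap px; rewrite /v; apply: xget_unique; first by exists p.
  move=> r [q [Aq qx ->]].
  by have [/asboolP[_ ->//]|/asboolP[_ ->]] := tot _ _ Ap Aq.
have two x y : D x -> D y -> exists p, [/\ A p, pdom p x & pdom p y].
  move=> [p Ap px] [q Aq qy]; have [/asboolP[le _]|/asboolP[le _]] := tot _ _ Ap Aq.
    by exists q; split => //; exact: le.
  by exists p; split => //; exact: le.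
have DD x y : D x -> D y -> D (x + y).
  by move=> Dx /(two _ _ Dx)[p [Ap px py]]; exists p => //; exact: pdomD.
have DZ a x : D x -> D (rscale a x).
  by move=> [p Ap px]; exists p => //; exact: pdomZ.
have vD x y : D x -> D y -> v (x + y) = v x + v y.
  move=> Dx /(two _ _ Dx)[p [Ap px py]].
  by rewrite !(vE p)// ?pvalD//; exact: pdomD.
have vZ a x : D x -> v (rscale a x) = a * v x.
  by move=> [p Ap px]; rewrite !(vE p)// ?pvalZ//; exact: pdomZ.
have vB x : D x -> v x <= nrm x.
  by move=> [p Ap px]; rewrite (vE p)//; exact: pvalB.
exists (RPart _ _ DD DZ vD vZ vB) => p Ap; apply/asboolP; split => /=.
  by move=> x px; exists p.
by move=> x px; rewrite (vE p).
Qed.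

(* Any [c] between [sup (pval y - nrm (y - z))] and [inf (nrm (y + z) - pval y)]
   is an admissible value at the new vector [z]. *)
Lemma rpart_extend (p : rpart) (z : X) : ~ pdom p z -> (exists x, pdom p x) ->
  exists q, rpart_le p q /\ pdom q z.
Proof.
move=> npz [x0 px0].
have p0 : pdom p 0 by rewrite -(rscale0 x0); exact: pdomZ.
have pN y : pdom p y -> pdom p (- y).
  by move=> py; rewrite -[y]rscale1 -rscaleN; exact: pdomZ.
pose S := [set pval p y - nrm (y - z) | y in pdom p].
have S0 : S !=set0 by exists (pval p 0 - nrm (0 - z)); exists 0.
have Sub y : pdom p y -> ubound S (nrm (y + z) - pval p y).
  move=> py _ [w pw <-].
  rewrite lerBlDr addrAC lerBrDr -pvalD//.
  apply: le_trans (pvalB p _ (pdomD p _ _ pw py)) _.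
  by rewrite -[w + y](_ : (y + z) + (w - z) = _) ?nrmD// addrACA subrr addr0 addrC.
pose c := sup S.
have cle y : pdom p y -> c <= nrm (y + z) - pval p y.
  by move=> py; apply: ge_sup => //; exact: Sub.
have cge y : pdom p y -> pval p y - nrm (y - z) <= c.
  by move=> py; apply: ub_le_sup; [exists (nrm (0 + z) - pval p 0); exact: Sub|exists y].
pose D := [set x | exists y a, pdom p y /\ x = y + rscale a z].
pose v x := xget 0 [set r | exists y a, [/\ pdom p y, x = y + rscale a z & r = pval p y + a * c]].
have uniq y a y' a' : pdom p y -> pdom p y' -> y + rscale a z = y' + rscale a' z -> y = y' /\ a = a'.
  move=> py py' e.
  have e2 : rscale (a' - a) z = y - y'.
    rewrite rscaleDl rscaleN; apply/eqP; rewrite subr_eq -addrA [- y' + _]addrC addrA e.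
    by rewrite [y' + _]addrC addrK.
  have aa : a = a'.
    apply/eqP/negPn/negP => ne; apply: npz.
    have -> : z = rscale ((a' - a)^-1) (y - y').
      by rewrite -e2 rscaleA mulVf ?rscale1// subr_eq0 eq_sym.
    by apply: pdomZ; apply: pdomD => //; exact: pN.
  by split=> //; move: e; rewrite aa => /addIr.
have vE y a : pdom p y -> v (y + rscale a z) = pval p y + a * c.
  move=> py; rewrite /v; apply: xget_unique; first by exists y, a.
  by move=> _ [y' [a' [py' /uniq[]// <- <- ->]]].
have vB x : D x -> v x <= nrm x.
  move=> [y [a [py ->]]]; rewrite vE//.
  (* Dividing by [|a|] reduces to the coefficients -1 and 1 of [z], which are the two inequalities
     [cge] and [cle] that define an admissible [c]. *)
  have [a0|a0|->] := ltrgtP a 0.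
  - have py' : pdom p (rscale (- a)^-1 y) by exact: pdomZ.
    have := cge _ py'; rewrite pvalZ// => h.
    have na : 0 < - a by rewrite oppr_gt0.
    have e : nrm (y + rscale a z) = - a * nrm (rscale (- a)^-1 y - z).
      rewrite -[X in X * _]gtr0_norm// -nrm_rscale rscaleBr rscaleA mulfV ?gt_eqF//.
      by rewrite rscale1 rscaleN opprK.
    rewrite e; move: h; rewrite -(ler_pM2l na) => h.
    rewrite mulrBr mulrA mulfV ?gt_eqF// mul1r in h.
    lra.
  - have py' : pdom p (rscale a^-1 y) by exact: pdomZ.
    have := cle _ py'; rewrite pvalZ// => h.
    have e : nrm (y + rscale a z) = a * nrm (rscale a^-1 y + z).
      rewrite -[X in X * _]gtr0_norm// -nrm_rscale rscaleDr rscaleA mulfV ?gt_eqF//.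
      by rewrite rscale1.
    rewrite e; move: h; rewrite -(ler_pM2l a0) => h.
    rewrite mulrBr mulrA mulfV ?gt_eqF// mul1r in h.
    lra.
  - by rewrite rscale0 addr0 mul0r addr0; exact: pvalB.
have comb y a y' a' : y + rscale a z + (y' + rscale a' z) = (y + y') + rscale (a + a') z.
  by rewrite addrACA rscaleDl.
have combZ b y a : rscale b (y + rscale a z) = rscale b y + rscale (b * a) z.
  by rewrite rscaleDr rscaleA.
have DD x y : D x -> D y -> D (x + y).
  move=> [u [a [pu ->]]] [u' [a' [pu' ->]]]; exists (u + u'), (a + a').
  by split; [exact: pdomD|exact: comb].
have DZ a x : D x -> D (rscale a x).
  move=> [u [b [pu ->]]]; exists (rscale a u), (a * b).
  by split; [exact: pdomZ|exact: combZ].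
have vD x y : D x -> D y -> v (x + y) = v x + v y.
  move=> [u [a [pu ->]]] [u' [a' [pu' ->]]]; rewrite comb !vE//; last exact: pdomD.
  by rewrite pvalD// mulrDl addrACA.
have vZ a x : D x -> v (rscale a x) = a * v x.
  move=> [u [b [pu ->]]]; rewrite combZ !vE//; last exact: pdomZ.
  by rewrite pvalZ// mulrDr mulrA.
exists (RPart _ _ DD DZ vD vZ vB); split.
  apply/asboolP; split => /= [y py|y py].
    by exists y, 0; rewrite rscale0 addr0.
  by rewrite -[in RHS](addr0 y) -(rscale0 z) vE// mul0r addr0.
by exists 0, 1; rewrite rscale1 add0r.
Qed.

(** Extend [a x -> a * nrm x] from the real line through [x]; by [rpart_extend] a maximal extension
    is defined everywhere. *)
Theorem hahn_banach_norming (x : X) :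
  exists l, rfunctional 1 l /\ l x = nrm x.
Proof.
have [->|x0] := eqVneq x 0.
  exists (fun=> 0); split; last by rewrite nrm0.
  by split => *; rewrite ?addr0 ?mulr0// normr0 mul1r nrm_ge0.
pose D := [set y | exists a, y = rscale a x].
pose v y := xget 0 [set r | exists a, y = rscale a x /\ r = a * nrm x].
have nx : nrm x != 0 by apply/eqP => /nrm0_eq0/eqP; apply/negP.
have inj a b : rscale a x = rscale b x -> a = b.
  move=> e; apply/eqP; rewrite -subr_eq0 -normr_eq0; apply/eqP.
  apply: (mulIf nx); rewrite mul0r -nrm_rscale rscaleDl rscaleN e subrr.
  exact: nrm0.
have vE a : v (rscale a x) = a * nrm x.
  rewrite /v; apply: xget_unique; first by exists a.
  by move=> _ [b [/inj <- ->]].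
have DD y z : D y -> D z -> D (y + z).
  by move=> [a ->] [b ->]; exists (a + b); rewrite rscaleDl.
have DZ a y : D y -> D (rscale a y).
  by move=> [b ->]; exists (a * b); rewrite rscaleA.
have vD y z : D y -> D z -> v (y + z) = v y + v z.
  by move=> [a ->] [b ->]; rewrite -rscaleDl !vE mulrDl.
have vZ a y : D y -> v (rscale a y) = a * v y.
  by move=> [b ->]; rewrite rscaleA !vE mulrA.
have vB y : D y -> v y <= nrm y.
  move=> [a ->]; rewrite vE nrm_rscale ler_wpM2r ?nrm_ge0//; exact: ler_norm.
pose p0 := RPart _ _ DD DZ vD vZ vB.
have rpart_le_refl (p : rpart) : rpart_le p p by apply/asboolP; split; [exact: subset_refl|].
have rpart_le_trans (p q r : rpart) : rpart_le p q -> rpart_le q r -> rpart_le p r.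
  move=> /asboolP[a b] /asboolP[c d]; apply/asboolP; split; first exact: subset_trans c.
  by move=> y py; rewrite b// d//; exact: a.
have [t [p0t tmax]] : exists t, rpart_le p0 t /\ forall s, rpart_le t s -> rpart_le s t.
  (* Zorn's lemma is applied to the extensions of [p0] only, so the maximal one still norms [x].
     Extension is merely a preorder, since two elements may differ off their domains. *)
  have := @ZL_preorder {p : rpart | rpart_le p0 p} (exist _ p0 (rpart_le_refl p0))
     (fun a b => rpart_le (proj1_sig a) (proj1_sig b)).
  case.
  - by move=> r; exact: rpart_le_refl.
  - by move=> a b c; exact: rpart_le_trans.
  - move=> A tot.
    have [[a Aa]|nA] := pselect (exists a, A a); last first.
      by exists (exist _ p0 (rpart_le_refl p0)) => s As; exfalso; apply: nA; exists s.
    have [||t ht] := rpart_chain [set proj1_sig s | s in A] (proj1_sig a).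
    + by exists a.
    + by move=> _ _ [u Au <-] [w Aw <-]; exact: tot.
    have p0t : rpart_le p0 t.
      by apply: (rpart_le_trans _ _ _ (proj2_sig a)); apply: ht; exists a.
    by exists (exist _ t p0t) => s As /=; apply: ht; exists s.
  move=> [t p0t] /= ht; exists t; split => // s ts.
  exact: (ht (exist _ s (rpart_le_trans _ _ _ p0t ts)) ts).
have tx : pdom t x by have /asboolP[h _] := p0t; apply: h; exists 1; rewrite rscale1.
have full y : pdom t y.
  apply: contrapT => nty.
  have [q [tq qy]] := rpart_extend t y nty (ex_intro _ x tx).
  by have /asboolP[h _] := tmax _ tq; apply: nty; exact: h.
exists (pval t); split; last first.
  have /asboolP[_ h] := p0t; rewrite -h/=; last by exists 1; rewrite rscale1.
  by rewrite -[in LHS](rscale1 x) vE mul1r.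
split=> [y z|a y|y].
- exact: pvalD.
- exact: pvalZ.
- rewrite mul1r ler_norml pvalB// andbT.
  by have := pvalB t _ (full (rscale (-1) y)); rewrite pvalZ// mulN1r rscaleN rscale1 nrmN lerNl.
Qed.

End RealFunctional.

(** * Bochner integrals *)

Section Bochner.
Context {R : realType} {X : normedModType R[i]}.
Local Notation mu := (@lebesgue_measure R).

(** A simple function is a list of possibly overlapping blocks, so that addition is concatenation
    and proofs go by induction on the list. *)
Record block := Block {
  bset : set (measurableTypeR R);
  bvec : X;
  bset_meas : measurable bset;
  bset_fin : (mu bset < +oo)%E }.

Definition sfn (s : seq block) (t : R) : X :=
  \sum_(p <- s) rscale (\1_(bset p) t) (bvec p).

Definition sint (D : set R) (s : seq block) : X :=
  \sum_(p <- s) rscale (fine (mu (D `&` bset p))) (bvec p).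

(** The measurable majorant [w] replaces [nrm (G t)], which may fail to be measurable; integrals of
    majorants can be added. *)
Definition majorizes (D : set R) (G : R -> X) (w : R -> \bar R) (e : R) :=
  [/\ measurable_fun D w,
      forall t, D t -> ((nrm (G t))%:E <= w t)%E &
      (\int[mu]_(t in D) w t <= e%:E)%E].

(* Equivalent to [bochner_integral], but without almost everywhere convergence, which makes it
   easy to restrict, add and multiply. *)
Definition bint (D : set R) (G : R -> X) (v : X) := forall e, 0 < e ->
  exists s w, majorizes D (fun t => G t - sfn s t) w e /\ nrm (v - sint D s) <= e.

Definition bapprox (D : set R) (G : R -> X) := forall e, 0 < e ->
  exists s w, majorizes D (fun t => G t - sfn s t) w e.

Lemma bint_approx D G v : bint D G v -> bapprox D G.
Proof. by move=> h e /h[s [w [? _]]]; exists s, w. Qed.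

Lemma majorizes_ge0 D G w e t : majorizes D G w e -> D t -> (0 <= w t)%E.
Proof. by move=> [_ h _] /h; apply: le_trans; rewrite lee_fin nrm_ge0. Qed.

Lemma majorizesD D G G' w w' e e' : measurable D -> majorizes D G w e -> majorizes D G' w' e' ->
  majorizes D (fun t => G t + G' t) (fun t => w t + w' t)%E (e + e').
Proof.
move=> mD h h'; have [mw b i] := h; have [mw' b' i'] := h'; split.
- exact: emeasurable_funD.
- move=> t Dt; apply: le_trans (leeD (b _ Dt) (b' _ Dt)).
  by rewrite -EFinD lee_fin nrmD.
- rewrite ge0_integralD//; first by rewrite EFinD leeD.
  by move=> t; exact: majorizes_ge0 h.
  by move=> t; exact: majorizes_ge0 h'.
Qed.

Lemma majorizesN D G w e : majorizes D G w e -> majorizes D (fun t => - G t) w e.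
Proof. by move=> [mw b i]; split => // t /b; rewrite nrmN. Qed.

Lemma eq_majorizes D G G' w e : (forall t, D t -> G t = G' t) ->
  majorizes D G w e -> majorizes D G' w e.
Proof. by move=> h [mw b i]; split => // t Dt; rewrite -h//; exact: b. Qed.

Lemma rfunB B (l : X -> R) x y : rfunctional B l -> l (x - y) = l x - l y.
Proof.
move=> [lD lZ _]; rewrite lD; congr (_ + _).
by rewrite -[- y](_ : rscale (-1) y = _) ?lZ ?mulN1r// rscaleN rscale1.
Qed.

Lemma integrable_block (D : set R) (p : block) (a : R) : measurable D ->
  mu.-integrable D (EFin \o (fun t => \1_(bset p) t * a)).
Proof.
move=> mD; have : mu.-integrable D (fun t => (\1_(bset p) t)%:E).
  apply/integrableP; split.
    by apply/measurable_EFinP; apply: measurable_indic; exact: bset_meas.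
  under eq_integral do rewrite /= ger0_norm//.
  rewrite integral_indic//; last exact: bset_meas.
  apply: le_lt_trans (bset_fin p); apply: le_measure; rewrite ?inE//.
    by apply: measurableI => //; exact: bset_meas.
  exact: bset_meas.
by move=> h; rewrite /comp; under eq_fun do rewrite EFinM; exact: integrableZr.
Qed.

Lemma rfun_sfn B (l : X -> R) (D : set R) s : measurable D -> rfunctional B l ->
  mu.-integrable D (EFin \o (l \o sfn s)) /\
  \int[mu]_(t in D) l (sfn s t) = l (sint D s).
Proof.
move=> mD hl; elim: s => [|p s [ints eqs]].
  have l0 : l 0 = 0 by case: hl => _ lZ _; rewrite -(rscale0 0) lZ mul0r.
  have e t : l (sfn [::] t) = 0 by rewrite /sfn big_nil.
  split.
    have -> : EFin \o (l \o sfn [::]) = cst 0%E by apply/funext => t /=; rewrite e.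
    apply: integrable0.
  under eq_Rintegral do rewrite e.
  by rewrite /sint big_nil l0 Rintegral_cst// mul0r.
have e t : l (sfn (p :: s) t) = \1_(bset p) t * l (bvec p) + l (sfn s t).
  by case: hl => lD lZ _; rewrite /sfn big_cons lD lZ.
have ip := integrable_block D p (l (bvec p)) mD.
split.
  rewrite /comp; under eq_fun do rewrite e EFinD.
  exact: integrableD.
under eq_Rintegral do rewrite e.
rewrite RintegralD//.
case: (hl) => lD lZ _; rewrite /sint big_cons lD lZ; congr (_ + _) => //.
rewrite RintegralZr//; last first.
  have := integrable_block D p 1 mD; congr (_.-integrable _ _).
  by apply/funext => t /=; rewrite mulr1.
by rewrite /Rintegral (integral_indic mu mD (bset_meas p)) setIC.
Qed.

(** A functional norming the difference of the two integrals reduces the claim to the scalar bound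
    of an integral by the integral of the modulus. *)
Lemma sint_le D s s' w e : measurable D ->
  majorizes D (fun t => sfn s t - sfn s' t) w e -> nrm (sint D s - sint D s') <= e.
Proof.
move=> mD hw; have [mw b i] := hw.
have [l [hl <-]] := hahn_banach_norming (sint D s - sint D s').
have [i1 e1] := rfun_sfn _ _ _ s mD hl.
have [i2 e2] := rfun_sfn _ _ _ s' mD hl.
rewrite (rfunB _ _ _ _ hl) -e1 -e2 -RintegralB//.
have i3 : mu.-integrable D (EFin \o (fun t => l (sfn s t) - l (sfn s' t))).
  by rewrite /comp; under eq_fun do rewrite EFinB; exact: integrableB.
apply: le_trans (ler_norm _) _.
rewrite -lee_fin EFin_normr_Rintegral//.
apply: le_trans (le_abse_integral _ _ _) _ => //; first by case/integrableP: i3.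
apply: le_trans i; apply: ge0_le_integral => //.
- by apply: measurableT_comp => //; case/integrableP: i3.
- move=> t Dt; apply: le_trans (b _ Dt).
  rewrite lee_fin -(rfunB _ _ _ _ hl).
  by case: hl => _ _ /(_ (sfn s t - sfn s' t)); rewrite mul1r.
Qed.

Lemma bint_uniq D G v v' : measurable D -> bint D G v -> bint D G v' -> v = v'.
Proof.
move=> mD h h'; apply/eqP; rewrite -subr_eq0; apply/eqP/nrm0_eq0.
apply/eqP; rewrite eq_le nrm_ge0 andbT; apply/ler_addgt0Pl => e e0; rewrite addr0.
have e40 : 0 < e / 4 by lra.
have [s [w [hw hs]]] := h _ e40; have [s' [w' [hw' hs']]] := h' _ e40.
have hd : nrm (sint D s - sint D s') <= e / 4 + e / 4.
  apply: (sint_le _ _ _ (fun t => w t + w' t)%E) => //.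
  apply: eq_majorizes (majorizesD _ _ _ _ _ _ _ mD (majorizesN _ _ _ _ hw) hw') => t _ /=.
  by rewrite opprB addrA subrK.
rewrite (_ : v - v' = (v - sint D s) + (sint D s - sint D s') + (sint D s' - v')); last first.
  by rewrite !addrA !subrK.
apply: le_trans (nrmD _ _) _.
have := nrmD (v - sint D s) (sint D s - sint D s').
by move: hs'; rewrite nrmB; lra.
Qed.

(* No measurability of the restriction of [l \o G] is automatic, as [G] need only be
   an almost everywhere limit of simple functions. *)
Lemma bint_rfun D G v B l : measurable D -> rfunctional B l ->
  measurable_fun D (l \o G) -> bint D G v ->
  mu.-integrable D (EFin \o (l \o G)) /\ l v = \int[mu]_(t in D) l (G t).
Proof.
move=> mD hl ml hv.
pose B' := Num.max B 1.
have B'0 : 0 < B' by rewrite lt_max ltr01 orbT.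
have lB x : `|l x| <= B' * nrm x.
  case: hl => _ _ /(_ x) /le_trans; apply; apply: ler_wpM2r; first exact: nrm_ge0.
  by rewrite le_max lexx.
have diff s w e : majorizes D (fun t => G t - sfn s t) w e ->
    measurable_fun D (fun t => (l (G t) - l (sfn s t))%:E) /\
    (\int[mu]_(t in D) `|(l (G t) - l (sfn s t))%:E| <= (B' * e)%:E)%E.
  move=> hw; have [mw b i] := hw.
  have [i1 e1] := rfun_sfn _ _ _ s mD hl.
  have m1 : measurable_fun D (fun t => (l (G t) - l (sfn s t))%:E).
    apply/measurable_EFinP; apply: measurable_funB => //.
    by apply/measurable_EFinP; case/integrableP: i1.
  split => //.
  apply: (@le_trans _ _ (\int[mu]_(t in D) (B'%:E * w t))%E).
    apply: ge0_le_integral => //.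
    - by apply: measurableT_comp => //.
    - by apply: measurable_funeM.
    - move=> t Dt; apply: (@le_trans _ _ (B'%:E * (nrm (G t - sfn s t))%:E)%E).
        by rewrite -EFinM lee_fin -(rfunB _ _ _ _ hl).
      by apply: lee_wpmul2l; [rewrite lee_fin ltW|exact: b].
  rewrite ge0_integralZl//; last 2 first.
  - by move=> t; exact: majorizes_ge0 hw.
  - by rewrite lee_fin ltW.
  by rewrite EFinM lee_wpmul2l// lee_fin ltW.
have intG : mu.-integrable D (EFin \o (l \o G)).
  have [s [w [hw _]]] := hv 1 ltr01.
  have [m1 i1] := diff _ _ _ hw.
  have [i2 _] := rfun_sfn _ _ _ s mD hl.
  have -> : EFin \o (l \o G) = (fun t => (l (G t) - l (sfn s t))%:E + (l (sfn s t))%:E)%E.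
    by apply/funext => t /=; rewrite -EFinD subrK.
  apply: integrableD => //.
  apply/integrableP; split => //; apply: le_lt_trans i1 _; exact: ltry.
split=> //; apply/eqP; rewrite -subr_eq0 -normr_eq0 eq_le normr_ge0 andbT.
apply/ler_addgt0Pl => e e0; rewrite addr0.
have e'0 : 0 < e / (2 * B') by rewrite divr_gt0// mulr_gt0.
have [s [w [hw hs]]] := hv _ e'0.
have [m1 i1] := diff _ _ _ hw.
have [i2 e2] := rfun_sfn _ _ _ s mD hl.
rewrite -[l v](subrK (l (sint D s))) -addrA.
apply: le_trans (ler_normD _ _) _.
have -> : e = B' * (e / (2 * B')) + B' * (e / (2 * B')).
  by field; rewrite gt_eqF.
apply: lerD.
  by rewrite -(rfunB _ _ _ _ hl); apply: le_trans (lB _) _; rewrite ler_pM2l.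
rewrite -e2 -normrN opprB -RintegralB// -lee_fin EFin_normr_Rintegral//; last first.
  by rewrite /comp; under eq_fun do rewrite EFinB; exact: integrableB.
by apply: le_trans i1; apply: le_abse_integral.
Qed.

End Bochner.

(** * Simple approximation of bounded and of Lipschitz functions *)

Section BochnerApprox.
Context {R : realType} {X : normedModType R[i]}.
Local Notation mu := (@lebesgue_measure R).
Local Notation block := (@block R X).
Implicit Types (D A K : set R) (G u : R -> X).

Lemma sfn_cat (s s' : seq block) t : sfn (s ++ s') t = sfn s t + sfn s' t.
Proof. by rewrite /sfn big_cat. Qed.

Lemma bapprox_near D G : measurable D ->
  (forall e, 0 < e -> exists G' w, bapprox D G' /\ majorizes D (fun t => G t - G' t) w e) ->
  bapprox D G.
Proof.
move=> mD h e e0; have e20 : 0 < e / 2 by rewrite divr_gt0.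
have [G' [w [h1 h2]]] := h _ e20; have [s [w' h3]] := h1 _ e20.
exists s, (fun t => w t + w' t)%E; rewrite [e]splitr.
apply: eq_majorizes (majorizesD _ _ _ _ _ _ _ mD h2 h3) => t _ /=.
by rewrite addrA subrK.
Qed.

Lemma eq_bapprox D G G' : (forall t, D t -> G t = G' t) -> bapprox D G -> bapprox D G'.
Proof.
move=> eG h e /h[s [w hw]]; exists s, w; apply: eq_majorizes hw => t Dt /=.
by rewrite eG.
Qed.

Lemma bapproxD D G G' : measurable D -> bapprox D G -> bapprox D G' ->
  bapprox D (fun t => G t + G' t).
Proof.
move=> mD h h' e e0; have e20 : 0 < e / 2 by rewrite divr_gt0.
have [s [w hw]] := h _ e20; have [s' [w' hw']] := h' _ e20.
exists (s ++ s'), (fun t => w t + w' t)%E; rewrite [e]splitr.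
apply: eq_majorizes (majorizesD _ _ _ _ _ _ _ mD hw hw') => t _ /=.
by rewrite sfn_cat opprD addrACA.
Qed.

Lemma majorizes0 D e : 0 <= e -> majorizes D (fun=> 0 : X) (cst 0%E) e.
Proof. by move=> e0; split=> [|t _|] //; rewrite ?nrm0// integral0 lee_fin. Qed.

Lemma bapprox_sum D (I : Type) (r : seq I) (F : I -> R -> X) : measurable D ->
  (forall i, bapprox D (F i)) -> bapprox D (fun t => \sum_(i <- r) F i t).
Proof.
move=> mD h; elim: r => [|i r IH].
  move=> e e0; exists [::], (cst 0%E).
  apply: eq_majorizes (majorizes0 D e (ltW e0)) => t _ /=.
  by rewrite /sfn !big_nil subr0.
apply: eq_bapprox (bapproxD _ _ _ mD (h i) IH) => t _.
by rewrite big_cons.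
Qed.

(** The common core of two partitions: [phi] numbers the cells of [A], obtained by slicing the range
    in [bapprox_bounded] and the domain in [bapprox_lip], and [x i] is the constant used on cell
    [i]. *)
Lemma majorizes_cells D A (N : nat) (phi : R -> nat) (x : nat -> X) G e :
  measurable D -> measurable A -> (mu A < +oo)%E ->
  (forall i, measurable (A `&` phi @^-1` [set i])) ->
  (forall t, A t -> (phi t < N)%N) -> 0 <= e ->
  (forall t, D t -> A t -> nrm (G t - x (phi t)) <= e) ->
  (forall t, D t -> ~ A t -> G t = 0) ->
  exists s w, majorizes D (fun t => G t - sfn s t) w (e * fine (mu A)).
Proof.
move=> mD mA fA mphi phiN e0 hA hnA.
have fin i : (mu (A `&` phi @^-1` [set i]) < +oo)%E.
  by apply: le_lt_trans fA; apply: le_measure; rewrite ?inE//; exact: mphi.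
pose b i := Block (A `&` phi @^-1` [set i]) (x i) (mphi i) (fin i).
have sE t : sfn [seq b i | i <- index_iota 0 N] t =
    \sum_(0 <= i < N) rscale (\1_(A `&` phi @^-1` [set i]) t) (x i).
  by rewrite /sfn big_map.
exists [seq b i | i <- index_iota 0 N], (fun t => (e * \1_A t)%:E); split.
- by apply/measurable_EFinP; apply: measurable_funM => //; exact: measurable_indic.
- move=> t Dt; rewrite lee_fin sE; have [At|nAt] := pselect (A t).
    rewrite indicE mem_set// mulr1 (bigD1_seq (phi t)) ?iota_uniq ?mem_index_iota ?phiN//=.
    rewrite big1 ?addr0 => [|i ne]; last first.
      rewrite indicE memNset ?rscale0// => -[_ /= h].
      by move/eqP: ne; rewrite h.
    by rewrite indicE mem_set// rscale1; exact: hA.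
  rewrite hnA// big1 => [|i _]; last by rewrite indicE memNset ?rscale0// => -[].
  by rewrite subr0 nrm0 indicE memNset// mulr0.
- under eq_integral do rewrite EFinM.
  rewrite ge0_integralZl//; last by apply/measurable_EFinP; exact: measurable_indic.
  rewrite (integral_indic mu mD mA) EFinM fineK ?ge0_fin_numE//.
  by apply: lee_wpmul2l => //; apply: le_measure; rewrite ?inE//; exact: measurableI.
Qed.

(** Lebesgue's partition: [phi] records the slice of width [d] of [[- B, B]] that contains [h t]. *)
Lemma bapprox_bounded D A (h : R -> R) (x : X) B :
  measurable D -> measurable A -> (mu A < +oo)%E ->
  measurable_fun A h -> (forall t, A t -> `|h t| <= B) ->
  bapprox D (fun t => rscale (\1_A t * h t) x).
Proof.
move=> mD mA fA mh hB e e0.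
have m0 : 0 <= fine (mu A) by exact: fine_ge0.
have n0 := nrm_ge0 x.
(* The total error is [d * nrm x * mu A]; the added ones keep the denominator positive. *)
pose d := e / ((fine (mu A) + 1) * (nrm x + 1)).
have d0 : 0 < d by rewrite divr_gt0// mulr_gt0//; lra.
pose phi t := Num.truncn ((h t + B) / d).
have hB0 t : A t -> 0 <= h t + B by move=> /hB; rewrite ler_norml; lra.
have phiE t i : A t -> phi t = i <-> i%:R * d - B <= h t < i.+1%:R * d - B.
  move=> At; have := truncn_eq i (divr_ge0 (hB0 t At) (ltW d0)).
  rewrite ler_pdivlMr// ltr_pdivrMr// => h1.
  rewrite (_ : (_ <= h t < _) = (phi t == i)); first by split => [->|/eqP].
  by rewrite h1 lerBlDr ltrBrDr.
have [|||||s [w hw]] := @majorizes_cells D A (Num.truncn (2 * B / d)).+1 phi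
  (fun i => rscale (i%:R * d - B) x) (fun t => rscale (\1_A t * h t) x) (d * nrm x) mD mA fA.
- move=> i.
  rewrite (_ : _ `&` _ = A `&` h @^-1` `[i%:R * d - B, i.+1%:R * d - B[%classic).
    by apply: mh => //; exact: measurable_itv.
  by apply/seteqP; split => t [At] /= hh; split => //; apply/(phiE _ _ At).
- move=> t At; rewrite ltnS; apply: le_truncn; rewrite ler_pM2r ?invr_gt0//.
  by have := hB t At; rewrite ler_norml; lra.
- by rewrite mulr_ge0// ltW.
- move=> t Dt At; rewrite indicE mem_set// mul1r -rscaleN -rscaleDl nrm_rscale.
  apply: ler_wpM2r => //.
  have /andP[h1 h2] := (phiE _ _ At).1 (erefl (phi t)).
  by rewrite -natr1 in h2; rewrite ler_norml; lra.
- by move=> t Dt nAt; rewrite indicE memNset// mul0r rscale0.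
exists s, w; case: hw => h1 h2 h3; split => //.
apply: le_trans h3 _; rewrite lee_fin.
have <- : d * ((fine (mu A) + 1) * (nrm x + 1)) = e.
  by rewrite /d divfK// mulf_neq0// gt_eqF//; lra.
rewrite -mulrA ler_pM2l// mulrC; apply: ler_pM => //; lra.
Qed.

(** Riemann's partition: [u] is sampled at the left ends of intervals of length [d], which costs at
    most [L * d] at each point. *)
Lemma bapprox_lip (a b L : R) u : a <= b ->
  (forall s t, a <= s <= b -> a <= t <= b -> nrm (u t - u s) <= L * `|t - s|) ->
  bapprox `[a, b] u.
Proof.
move=> ab hu e e0.
pose L' := Num.max L 1.
have L'0 : 0 < L' by rewrite lt_max ltr01 orbT.
pose d := e / (L' * (b - a + 1)).
have d0 : 0 < d by rewrite divr_gt0// mulr_gt0//; lra.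
pose phi t := Num.truncn ((t - a) / d).
have phiE t i : a <= t -> phi t = i <-> i%:R * d + a <= t < i.+1%:R * d + a.
  move=> At; have ta : 0 <= t - a by lra.
  have := truncn_eq i (divr_ge0 ta (ltW d0)).
  rewrite ler_pdivlMr// ltr_pdivrMr// => h1.
  rewrite (_ : (_ <= t < _) = (phi t == i)); first by split => [->|/eqP].
  by rewrite h1 lerBrDr ltrBlDr.
have mA : measurable `[a, b] by exact: measurable_itv.
have muA : mu `[a, b] = (b - a)%:E.
  rewrite lebesgue_measure_itv/= lte_fin; case: ltP => // ba.
  by rewrite (_ : b = a) ?subrr//; apply/le_anti; rewrite ab ba.
have [||||||s [w hw]] := @majorizes_cells `[a, b] `[a, b] (Num.truncn ((b - a) / d)).+1 phi
  (fun i => u (i%:R * d + a)) u (L' * d) mA mA.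
- by rewrite muA ltry.
- move=> i.
  rewrite (_ : _ `&` _ = `[a, b] `&` `[i%:R * d + a, i.+1%:R * d + a[%classic).
    by apply: measurableI => //; exact: measurable_itv.
  apply/seteqP; split => t [At] /= hh; split => //;
    by move: (At) => /=; rewrite in_itv/= => /andP[ta _]; apply/(phiE _ _ ta).
- move=> t /=; rewrite in_itv/= => /andP[ta tb].
  by rewrite ltnS; apply: le_truncn; rewrite ler_pM2r ?invr_gt0//; lra.
- by rewrite mulr_ge0 ?ltW.
- move=> t _ /=; rewrite in_itv/= => /andP[ta tb].
  have /andP[h1 h2] := (phiE _ _ ta).1 (erefl (phi t)).
  have p0 : 0 <= (phi t)%:R * d by rewrite mulr_ge0// ltW.
  apply: le_trans (hu _ _ _ _) _; [lra|lra|].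
  apply: (@le_trans _ _ (L' * `|t - ((phi t)%:R * d + a)|)).
    by apply: ler_wpM2r => //; rewrite le_max lexx.
  rewrite ler_pM2l//; rewrite -natr1 in h2; rewrite ler_norml; lra.
- by move=> t.
exists s, w; case: hw => h1 h2 h3; split => //.
apply: le_trans h3 _; rewrite lee_fin muA /=.
have <- : d * (L' * (b - a + 1)) = e.
  by rewrite /d divfK// mulf_neq0// gt_eqF//; lra.
by rewrite mulrAC mulrC ler_pM2l// ler_pM2l//; lra.
Qed.

End BochnerApprox.

(** * Scalar multiples, and equivalence with the sequential definition *)

Section BochnerMul.
Context {R : realType} {X : normedModType R[i]}.
Local Notation mu := (@lebesgue_measure R).
Local Notation block := (@block R X).
Implicit Types (D A K : set R) (G u : R -> X).

Lemma scale_ReIm (c : R[i]) (x : X) :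
  c *: x = rscale (complex.Re c) x + rscale (complex.Im c) ('i%C *: x).
Proof.
rewrite /rscale scalerA -scalerDl; congr (_ *: _); case: c => a b /=.
by simpc.
Qed.

Lemma nrmi (x : X) : nrm ('i%C *: x) = nrm x.
Proof. by rewrite nrmZ /= expr0n /= add0r expr1n sqrtr1 mul1r. Qed.

Lemma nrmZ_le (c : R[i]) (x : X) :
  nrm (c *: x) <= (`|complex.Re c| + `|complex.Im c|) * nrm x.
Proof.
by rewrite scale_ReIm mulrDl; apply: le_trans (nrmD _ _) _; rewrite !nrm_rscale nrmi.
Qed.

Lemma majorizes_mul D K (psi : R -> R[i]) G w B e : measurable D -> measurable K -> K `<=` D ->
  0 <= B -> (forall t, K t -> `|complex.Re (psi t)| <= B /\ `|complex.Im (psi t)| <= B) ->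
  (forall t, D t -> ~ K t -> psi t = 0) ->
  majorizes K G w e ->
  majorizes D (fun t => psi t *: G t) ((fun t => (2 * B)%:E * w t)%E \_ K) (2 * B * e).
Proof.
move=> mD mK KD B0 hB h0 hw; have [mw b i] := hw.
have B20 : (0 <= (2 * B)%:E)%E by rewrite lee_fin mulr_ge0.
split.
- apply/measurable_restrict => //; apply: measurable_funeM.
  by rewrite setIidr.
- move=> t Dt; rewrite patchE; have [Kt|nKt] := pselect (K t).
    rewrite mem_set//; apply: (@le_trans _ _ ((2 * B)%:E * (nrm (G t))%:E)%E); last first.
      by apply: lee_wpmul2l => //; exact: b.
    rewrite -EFinM lee_fin; apply: le_trans (nrmZ_le _ _) _.
    by apply: ler_wpM2r; [exact: nrm_ge0|have [] := hB _ Kt; lra].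
  by rewrite memNset// h0// scale0r nrm0.
- rewrite -integral_mkcondr setIidr// ge0_integralZl//; last first.
    by move=> t; exact: majorizes_ge0 hw.
  by rewrite (EFinM (2 * B)); exact: lee_wpmul2l.
Qed.

(** [psi] times a simple function is no longer simple, but each of its blocks gives two bounded real
    functions on a set of finite measure, with the fixed directions [bvec p] and ['i *: bvec p];
    these fall under [bapprox_bounded]. *)
Lemma bapprox_mul D K (psi : R -> R[i]) G B : measurable D -> measurable K -> K `<=` D ->
  measurable_fun K (fun t => complex.Re (psi t)) ->
  measurable_fun K (fun t => complex.Im (psi t)) ->
  (forall t, K t -> `|complex.Re (psi t)| <= B /\ `|complex.Im (psi t)| <= B) ->
  (forall t, D t -> ~ K t -> psi t = 0) ->
  bapprox K G -> bapprox D (fun t => psi t *: G t).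
Proof.
move=> mD mK KD mre mim hB h0 hG; apply: bapprox_near => // e e0.
pose B' := Num.max B 1.
have B'0 : 0 < B' by rewrite lt_max ltr01 orbT.
have hB' t : K t -> `|complex.Re (psi t)| <= B' /\ `|complex.Im (psi t)| <= B'.
  by move=> /hB[h1 h2]; rewrite !le_max h1 h2.
have [s [w hw]] := hG _ (divr_gt0 e0 (mulr_gt0 (ltr0Sn R 1) B'0)).
pose F (p : block) t := rscale (\1_(K `&` bset p) t * complex.Re (psi t)) (bvec p) +
   rscale (\1_(K `&` bset p) t * complex.Im (psi t)) ('i%C *: bvec p).
have FE t : D t -> \sum_(p <- s) F p t = psi t *: sfn s t.
  move=> Dt; have [Kt|nKt] := pselect (K t); last first.
    rewrite h0// scale0r; apply: big1 => p _.
    by rewrite /F indicE memNset ?mul0r ?rscale0 ?addr0//; case.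
  rewrite /sfn scaler_sumr; apply: eq_bigr => p _.
  rewrite /F scale_ReIm scalerA.
  have -> : \1_(K `&` bset p) t = \1_(bset p) t :> R.
    by rewrite !indicE in_setI mem_set.
  rewrite -!rscaleA; congr (_ + _); rewrite !rscaleA mulrC -!rscaleA //.
  by congr (rscale _ _); rewrite /rscale !scalerA mulrC.
exists (fun t => \sum_(p <- s) F p t), ((fun t => (2 * B')%:E * w t)%E \_ K); split.
  apply: bapprox_sum => // p.
  have mKp : measurable (K `&` bset p) by apply: measurableI => //; exact: bset_meas.
  have fKp : (mu (K `&` bset p) < +oo)%E.
    apply: le_lt_trans (bset_fin p); apply: le_measure; rewrite ?inE//; exact: bset_meas.
  by apply: bapproxD => //; apply: (bapprox_bounded _ _ _ _ B) => //;
    [apply: measurable_funS mre => //; exact: subIsetl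
    |by move=> t [/hB[]]
    |apply: measurable_funS mim => //; exact: subIsetl
    |by move=> t [/hB[]]].
have := majorizes_mul _ _ _ _ _ _ _ mD mK KD (ltW B'0) hB' h0 hw.
rewrite (mulrC (2 * B')) divfK; last by rewrite mulf_neq0// gt_eqF.
by apply: eq_majorizes => t Dt; rewrite FE// scalerBr.
Qed.

(** Only real-valued functions are measured: each block splits the line in two, and the shift [c]
    accumulates the vectors met so far, which is what lets the induction pass. *)
Lemma measurable_sfn_nrm D (s : seq block) (c : X) : measurable D ->
  measurable_fun D (fun t => nrm (c + sfn s t)).
Proof.
move=> mD; elim: s c => [|p s IH] c.
  rewrite (_ : (fun _ => _) = cst (nrm c)); first exact: measurable_cst.
  by apply/funext => t; rewrite /sfn big_nil addr0.
rewrite (_ : (fun _ => _) = (fun t => if t \in bset p then nrm ((c + bvec p) + sfn s t)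
   else nrm (c + sfn s t))); last first.
  apply/funext => t; rewrite /sfn big_cons indicE.
  by case: (t \in bset p); rewrite ?rscale1 ?rscale0 ?addrA ?addr0.
apply: measurable_fun_if => //.
- apply: (@measurable_fun_bool _ _ _ _ true).
  rewrite (_ : _ @^-1` _ = bset p); last by apply/seteqP; split => t /= => [/set_mem|/mem_set].
  by apply: measurableI => //; exact: bset_meas.
- by apply: measurable_funS (IH _) => //; exact: subIsetl.
- by apply: measurable_funS (IH _) => //; exact: subIsetl.
Qed.

Lemma measurable_sfnB_nrm D (s s' : seq block) : measurable D ->
  measurable_fun D (fun t => (nrm (sfn s t - sfn s' t))%:E).
Proof.
move=> mD; apply/measurable_EFinP.
pose s2 := [seq Block (bset p) (- bvec p) (bset_meas p) (bset_fin p) | p <- s'].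
have := measurable_sfn_nrm D (s ++ s2) 0 mD.
congr measurable_fun; apply/funext => t; rewrite add0r sfn_cat; congr (nrm (_ + _)).
rewrite /sfn /s2 big_map -sumrN; apply: eq_bigr => p _ /=.
by rewrite /rscale scalerN.
Qed.

Lemma blocks_of_simple_seq (n : nat) (A : nat -> set R) (x : nat -> X) :
  (forall i, measurable (A i) /\ (mu (A i) < +oo)%E) ->
  exists s : seq block, (forall t, sfn s t = \sum_(i < n) rscale (\1_(A i) t) (x i)) /\
   (forall D, sint D s = \sum_(i < n) rscale (fine (mu (D `&` A i))) (x i)).
Proof.
move=> h; exists [seq Block (A i) (x i) (h i).1 (h i).2 | i <- index_iota 0 n].
by split => u; rewrite ?/sfn ?/sint big_map big_mkord.
Qed.

(** The distance from [G] to the simple function number [N0] is the limit of its distances to the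
    later ones; Fatou's lemma then turns the Cauchy condition into a bound for the integral of a
    majorant. *)
Lemma bochner_bint D G v : measurable D -> bochner_integral D G v -> bint D G v.
Proof.
move=> mD [n [A [x [hA [N [[N' [mN' N'0 NN']] hN]] hC hv]]]] e e0.
have [N1 hN1] := hC e e0.
have /cvg_nrmP /(_ _ e0) [N2 _ hN2] := hv.
pose N0 := maxn N1 N2.
have hN0 l : (N0 <= l)%N -> (\int[mu]_(t in D) (nrm (simple_seq n A x N0 t - simple_seq n A x l t))%:E <= e%:E)%E.
  by move=> h; apply: hN1; [exact: leq_maxl|exact: leq_trans (leq_maxl _ _) h].
pose S k t := simple_seq n A x k t.
have hs k : exists s : seq block, (forall t, sfn s t = S k t) /\
    sint D s = \sum_(i < n k) rscale (fine (mu (D `&` A k i))) (x k i).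
  have [s [h1 h2]] := blocks_of_simple_seq (n k) (A k) (x k) (hA k).
  by exists s; split.
have mS k l : measurable_fun D (fun t => (nrm (S k t - S l t))%:E).
  have [s [hk _]] := hs k; have [s' [hl _]] := hs l.
  by have := measurable_sfnB_nrm D s s' mD; under eq_fun do rewrite hk hl.
have [s [hk hsv]] := hs N0; exists s.
pose f l t := (nrm (S N0 t - S l t))%:E.
(* The limit inferior of [f], written through a limit superior to inherit measurability from
   [measurable_fun_limn_esup]. *)
pose g t := (- limn_esup (fun l => - f l t))%E.
have mg : measurable_fun D g.
  apply: measurableT_comp => //; apply: measurable_fun_limn_esup => l.
  by apply: measurableT_comp => //; exact: mS.
have gE t : g t = limn_einf (f^~ t).
  by rewrite /g -[RHS]oppeK -limn_esupN.
(* The value [+oo] on the exceptional set makes the pointwise bound hold everywhere without changing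
   the integral. *)
pose w t := if t \in N' then +oo%E else g t.
have mw : measurable_fun D w.
  apply: measurable_fun_if => //.
  - apply: (@measurable_fun_bool _ _ _ _ true).
    rewrite (_ : _ @^-1` _ = N'); last by apply/seteqP; split => t /= => [/set_mem|/mem_set].
    exact: measurableI.
  - by apply: measurable_funS mg => //; exact: subIsetl.
exists w; split; last by rewrite hsv ltW//; apply: hN2 => /=; exact: leq_maxr.
split => //.
- move=> t Dt; rewrite /w; case: ifPn => [_|/negP nN]; first exact: leey.
  have nNt : ~ N t by move=> /NN' /mem_set.
  have cv := hN t Dt nNt.
  have cf : f l t @[l --> \oo] --> (nrm (G t - sfn s t))%:E.
    apply: cvg_EFin; first exact: nearW.
    rewrite /f; apply/cvgrPdist_le => eps eps0.
    have /cvg_nrmP /(_ _ eps0) := cv.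
    apply: filterS => l hl; rewrite hk /=.
    have {}hl : nrm (G t - S l t) < eps by [].
    have := nrm_tri (G t) (S l t) (S N0 t); have := nrm_tri (S N0 t) (G t) (S l t).
    rewrite (nrmB (S N0 t) (G t)) (nrmB (S N0 t) (S l t)) ler_norml.
    lra.
  rewrite gE.
  by rewrite (cvg_limn_einf_sup cf).1.
- apply: (@le_trans _ _ (\int[mu]_(t in D) g t)%E).
    rewrite le_eqVlt; apply/orP; left; apply/eqP; apply: ae_eq_integral => //.
    exists N'; split => // t /=; apply: contra_notP => nN Dt.
    by rewrite /w memNset.
  under eq_integral do rewrite gE.
  apply: (@le_trans _ _ (limn_einf (fun l => \int[mu]_(t in D) f l t)%E)).
    apply: (@fatou _ _ _ mu D mD f) => [l|l t _]; first exact: mS.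
    by rewrite lee_fin nrm_ge0.
  rewrite limn_einf_lim; apply: lime_le; first exact: is_cvg_einfs.
  exists N0 => // l /= Nl; apply: (@le_trans _ _ (\int[mu]_(t in D) f l t)%E).
    by apply: ereal_inf_lbound; exists l => /=.
  by rewrite /f; exact: hN0.
Qed.

(* Choosing the [k]-th simple function within [2^-(k+1)] makes the majorants summable,
   whence the almost everywhere convergence required by [bochner_integral]. *)
Lemma bint_bochner D G v : measurable D -> bint D G v -> bochner_integral D G v.
Proof.
move=> mD hG.
pose eps k : R := 1 / (2 ^ k.+1)%:R.
have eps0 k : 0 < eps k by rewrite divr_gt0// ltr0n expn_gt0.
have /choice[s /choice[w hw]] : forall k, exists s, exists w,
    majorizes D (fun t => G t - sfn s t) w (eps k) /\ nrm (v - sint D s) <= eps k.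
  by move=> k; exact: hG.
pose dflt : block := Block set0 0 measurable0 (eq_ind_r (fun z => z < +oo)%E (ltry 0) (measure0 mu)).
have SE k t : simple_seq (fun k => size (s k)) (fun k i => bset (nth dflt (s k) i)) (fun k i => bvec (nth dflt (s k) i)) k t = sfn (s k) t.
  by rewrite /simple_seq /sfn (big_nth dflt) big_mkord.
have eps_lt e : 0 < e -> exists N, forall k, (N <= k)%N -> eps k <= e.
  move=> e0; exists (Num.truncn e^-1) => k Nk.
  rewrite /eps div1r -[e]invrK lef_pV2 ?posrE ?invr_gt0 ?ltr0n ?expn_gt0//.
  apply: (@le_trans _ _ k.+1%:R); last by rewrite ler_nat ltnW// ltn_expl.
  by apply: (le_trans (ltW (truncnS_gt _))); rewrite ler_nat ltnS.
have w0 k t : D t -> (0 <= w k t)%E by apply: majorizes_ge0; exact: (hw k).1.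
exists (fun k => size (s k)), (fun k i => bset (nth dflt (s k) i)), (fun k i => bvec (nth dflt (s k) i)).
split.
- by move=> k i; split; [exact: bset_meas|exact: bset_fin].
- pose W t := (\sum_(k <oo) w k t)%E.
  have mW : measurable_fun D W.
    apply: ge0_emeasurable_sum => [k t Dt _|k _]; [exact: w0|by have [[]] := hw k].
  have iW : mu.-integrable D W.
    apply/integrableP; split => //.
    have -> : (\int[mu]_(t in D) `|W t| = \int[mu]_(t in D) W t)%E.
      apply: eq_integral => t /set_mem Dt; rewrite gee0_abs//.
      by apply: nneseries_ge0 => k _ _; exact: w0.
    rewrite integral_nneseries//; last by move=> k; have [[]] := hw k.
    apply: (@le_lt_trans _ _ (\sum_(k <oo) (eps k)%:E)%E).
      apply: lee_nneseries => [k _ _|k _]; first by apply: integral_ge0 => t; exact: w0.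
      by have [[_ _ i] _] := hw k.
    by apply: le_lt_trans (epsilon_trick0 _ _) (ltry 1).
  exists (~` [set t | D t -> W t \is a fin_num]); split; first exact: integrable_ae iW.
  move=> t Dt /contrapT /(_ Dt) Wt; apply/cvg_nrmP => e e0.
  have : (\sum_(k <oo) w k t < +oo)%E by rewrite -ge0_fin_numE// nneseries_ge0// => k _ _; exact: w0.
  move=> /nneseries_tail_cvg /(_ (fun k _ => w0 k t Dt)).
  move=> /fine_cvgP[h1 /cvgrPdist_lt /(_ e e0) h2].
  near=> k.
  rewrite SE -lte_fin; have [[_ b _] _] := hw k; apply: le_lt_trans (b t Dt) _.
  apply: (@le_lt_trans _ _ (\sum_(k <= j <oo) w j t)%E).
    have := @nneseries_lim_ge _ (fun j => w j t) xpredT k k.+1 (fun j _ _ => w0 j t Dt).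
    by rewrite big_nat1.
  have f1 : (\sum_(k <= j <oo) w j t)%E \is a fin_num by near: k.
  rewrite -(fineK f1) lte_fin.
  have : `|0 - fine (\sum_(k <= j <oo) w j t)%E| < e by near: k.
  by rewrite sub0r normrN; apply: le_lt_trans; exact: ler_norm.
- move=> e e0; have [N hN] := eps_lt _ (divr_gt0 e0 (ltr0Sn R 1)).
  exists N => k l Nk Nl; under eq_integral do rewrite !SE.
  have hkl := majorizesD _ _ _ _ _ _ _ mD (majorizesN _ _ _ _ (hw k).1) (hw l).1.
  have [mw b i] := hkl.
  apply: (@le_trans _ _ (\int[mu]_(t in D) (w k t + w l t))%E).
    apply: ge0_le_integral => //; first by move=> t _; rewrite lee_fin nrm_ge0.
      exact: measurable_sfnB_nrm.
    by move=> t Dt; apply: le_trans (b t Dt); rewrite opprB addrA subrK.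
  by apply: (le_trans i); rewrite lee_fin [leRHS]splitr lerD// hN.
- apply/cvg_nrmP => e e0; have [N hN] := eps_lt _ (divr_gt0 e0 (ltr0Sn R 1)).
  exists N => // k /= Nk.
  have -> : \sum_(i < size (s k)) rscale (fine (mu (D `&` bset (nth dflt (s k) i)))) (bvec (nth dflt (s k) i)) = sint D (s k).
    by rewrite /sint (big_nth dflt) big_mkord.
  apply: le_lt_trans (hw k).2 _; apply: le_lt_trans (hN _ Nk) _.
  by rewrite ltr_pdivrMr// ltr_pMr// ltr1n.
Unshelve. all: by end_near. Qed.

End BochnerMul.

(** * Existence of the integral in a complete space *)

Section BochnerComplete.
Context {R : realType} {X : completeNormedModType R[i]}.
Local Notation mu := (@lebesgue_measure R).
Implicit Types (D : set R) (G : R -> X).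

(** By [sint_le] the integrals of the approximating simple functions form a Cauchy sequence; this is
    where completeness of [X] enters. *)
Lemma bapprox_bint D G : measurable D -> bapprox D G -> exists v, bint D G v.
Proof.
move=> mD hG.
have n0 k : 0 < k.+1%:R^-1 :> R by rewrite invr_gt0 ltr0n.
have /choice[s /choice[w hw]] : forall k, exists s, exists w,
    majorizes D (fun t => G t - sfn s t) w (k.+1%:R^-1).
  by move=> k; exact: hG.
have dist k l : nrm (sint D (s k) - sint D (s l)) <= k.+1%:R^-1 + l.+1%:R^-1.
  apply: sint_le => //.
  apply: eq_majorizes (majorizesD _ _ _ _ _ _ _ mD (majorizesN _ _ _ _ (hw k)) (hw l)) => t _ /=.
  by rewrite opprB addrA subrK.
have small (e : R) : 0 < e -> exists N, forall k, (N <= k)%N -> k.+1%:R^-1 <= e.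
  move=> e0; exists (Num.truncn e^-1) => k Nk.
  rewrite -[e]invrK lef_pV2 ?posrE ?invr_gt0 ?ltr0n//.
  by apply: (le_trans (ltW (truncnS_gt _))); rewrite ler_nat ltnS.
have : cvgn (fun k => sint D (s k)).
  apply/cauchy_cvgP; apply: cauchy_exP => -[e e'].
  rewrite ltcE /= => /andP[/eqP -> e0].
  have [N hN] := small _ (divr_gt0 e0 (ltr0Sn R 2)).
  exists (sint D (s N)); exists N => // k /= Nk.
  rewrite -ball_normE /= normE ltcR; apply: le_lt_trans (dist _ _) _.
  by have := hN _ Nk; have := hN _ (leqnn N); move: (N.+1%:R^-1) (k.+1%:R^-1) => a b; lra.
move=> /cvg_ex[v hv]; exists v => e e0.
have [N hN] := small _ e0.
have /cvg_nrmP /(_ _ e0) [N2 _ hN2] := hv.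
exists (s (maxn N N2)), (w (maxn N N2)); split; last first.
  by rewrite ltW//; apply: hN2 => /=; exact: leq_maxr.
have [mw b i] := hw (maxn N N2); split => //.
by apply: (le_trans i); rewrite lee_fin; apply: hN; exact: leq_maxl.
Qed.

(** The default value of [xget] in [bintegral] is never taken here: a value exists by completeness
    and is unique by [bint_uniq]. *)
Lemma bintegralP D G : measurable D -> bapprox D G -> bint D G (bintegral D G).
Proof.
move=> mD /(bapprox_bint _ _ mD)[v hv].
rewrite /bintegral (@xget_unique _ _ _ v)//=; first exact: bint_bochner.
by move=> v' /= /(bochner_bint _ _ _ mD) hv'; exact: bint_uniq hv' hv.
Qed.

Lemma rfun_bintegral D G B l : measurable D -> bapprox D G -> rfunctional B l ->
  measurable_fun D (l \o G) ->
  mu.-integrable D (EFin \o (l \o G)) /\ l (bintegral D G) = \int[mu]_(t in D) l (G t).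
Proof. by move=> mD /(bintegralP _ _ mD) hG hl ml; exact: bint_rfun hl ml hG. Qed.

End BochnerComplete.

(** * Oscillatory integrals *)

Section Oscillation.
Context {R : realType}.
Local Notation mu := (@lebesgue_measure R).
Implicit Types (a b t : R) (u p q : nat -> R -> R).

Lemma is_derive_continuous_at (f : R -> R) (x d : R) : is_derive x (1 : R) f d -> {for x, continuous f}.
Proof. by case => h _; apply: differentiable_continuous; apply/derivable1_diffP. Qed.


Lemma continuous_at_within (f : R -> R) (A : set R) :
  (forall x, A x -> {for x, continuous f}) -> {within A, continuous f}.
Proof. by move=> h; apply: continuous_in_subspaceT => x /set_mem; exact: h. Qed.

Lemma integrable_within (f : R -> R) a b : {within `[a, b], continuous f} ->
  mu.-integrable `[a, b] (EFin \o f).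
Proof. by move=> h; apply: continuous_compact_integrable => //; exact: segment_compact. Qed.

Lemma integrable_itv (f : R -> R) a b : (forall x, a <= x <= b -> {for x, continuous f}) ->
  mu.-integrable `[a, b] (EFin \o f).
Proof.
move=> h; apply: integrable_within; apply: continuous_at_within => x /=.
by rewrite in_itv; exact: h.
Qed.

Lemma parts (F G f g : R -> R) a b : a <= b ->
  (forall x, a <= x <= b -> is_derive x (1 : R) F (f x)) ->
  (forall x, a <= x <= b -> is_derive x (1 : R) G (g x)) ->
  (forall x, a <= x <= b -> {for x, continuous f}) ->
  (forall x, a <= x <= b -> {for x, continuous g}) ->
  \int[mu]_(x in `[a, b]) (F x * g x) =
  F b * G b - F a * G a - \int[mu]_(x in `[a, b]) (f x * G x).
Proof.
move=> ab dF dG cf cg.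
have [->|/eqP nab] := pselect (a = b).
  by rewrite set_itv1 !Rintegral_set1 !subrr.
have lab : a < b by rewrite lt_neqAle nab.
have der (H h : R -> R) : (forall x, a <= x <= b -> is_derive x (1 : R) H (h x)) ->
    derivable_oo_LRcontinuous H a b /\ {in `]a, b[, derive1 H =1 h}.
  move=> dH; split.
    split.
    - move=> x; rewrite in_itv/= => /andP[ax xb].
      by have [|] := dH x; rewrite ?(ltW ax) ?(ltW xb).
    - apply: cvg_at_right_filter; apply: (is_derive_continuous_at _ _ (h a)).
      by apply: dH; rewrite lexx.
    - apply: cvg_at_left_filter; apply: (is_derive_continuous_at _ _ (h b)).
      by apply: dH; rewrite lexx ab.
  move=> x; rewrite in_itv/= => /andP[ax xb].
  by rewrite derive1E; have [|_ ] := dH x; rewrite ?(ltW ax) ?(ltW xb).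
have [F1 F2] := der _ _ dF; have [G1 G2] := der _ _ dG.
by apply: Rintegration_by_parts => //; apply: continuous_at_within => x /=; rewrite in_itv;
  [exact: cf|exact: cg].
Qed.

(** A chain of successive derivatives up to order [k], given as data; its last member is only
    continuous. *)
Definition dsq a b (k : nat) u := forall x, a <= x <= b ->
  (forall j, (j < k)%N -> is_derive x (1 : R) (u j) (u j.+1 x)) /\
  (forall j, (j <= k)%N -> {for x, continuous (u j)}).

(** Integrating a cosine shifts its phase by a quarter period, so no sine ever has to be written. *)
Definition phase (th : R) (j : nat) : R := th - j%:R * (pi / 2).

(** The boundary contribution of [k] integrations by parts: [u j] meets the [(j + 1)]-st
    antiderivative of the cosine, with alternating sign. *)
Definition bdry (k : nat) u t th x : R :=
  \sum_(j < k) (-1) ^+ j * t ^- j.+1 * u j x * cos (x * t + phase th j.+1).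

Lemma is_derive_phase t th x : t != 0 ->
  is_derive x (1 : R) (fun s => t^-1 * cos (s * t + (th - pi / 2))) (cos (x * t + th)).
Proof.
move=> t0.
have h : is_derive x (1 : R) (fun s : R => s * t + (th - pi / 2)) t.
  have -> : (fun s : R => s * t + (th - pi / 2)) = (t \*: (id : R -> R)) + cst (th - pi / 2).
    by apply/funext => s; rewrite [in LHS]mulrC.
  by apply: is_derive_eq; rewrite addr0 /GRing.scale /= mulr1.
have h2 := @is_derive1_comp R cos (fun s : R => s * t + (th - pi / 2)) x _ _ (is_derive_cos _) h.
have -> : (fun s => t^-1 * cos (s * t + (th - pi / 2))) =
   t^-1 \*: (cos \o (fun s : R => s * t + (th - pi / 2))) by [].
apply: is_derive_eq.
rewrite /GRing.scale /= mulrCA mulVf// mulr1 addrA sinB.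
by rewrite cos_pihalf sin_pihalf mulr0 mulr1 sub0r opprK.
Qed.

Lemma normr_cos_le1 (x : R) : `|cos x| <= 1.
Proof. by rewrite ler_norml cos_geN1 cos_le1. Qed.

Lemma normr_sin_le1 (x : R) : `|sin x| <= 1.
Proof. by rewrite ler_norml sin_geN1 sin_le1. Qed.

Lemma continuous_cos_lin t th x : {for x, continuous (fun s : R => cos (s * t + th))}.
Proof.
apply: continuous_comp; last exact: continuous_cos.
by apply: cvgD; [apply: cvgM; [exact: cvg_id|exact: cvg_cst]|exact: cvg_cst].
Qed.

Lemma osc k u a b t th : a <= b -> 0 < t -> dsq a b k u ->
  \int[mu]_(s in `[a, b]) (u 0%N s * cos (s * t + th)) =
  bdry k u t th b - bdry k u t th a +
  (-1) ^+ k * t ^- k * \int[mu]_(s in `[a, b]) (u k s * cos (s * t + phase th k)).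
Proof.
move=> ab t0; elim: k u th => [|k IH] u th hu.
  rewrite /bdry !big_ord0 subrr add0r expr0 invr1 !mul1r /phase.
  by under [in RHS]eq_Rintegral do rewrite mul0r subr0.
pose G s := t^-1 * cos (s * t + (th - pi / 2)).
have -> : \int[mu]_(s in `[a, b]) (u 0%N s * cos (s * t + th)) =
    u 0%N b * G b - u 0%N a * G a - \int[mu]_(s in `[a, b]) (u 1%N s * G s).
  apply: parts => // x abx.
  - by have [h _] := hu x abx; exact: h.
  - by apply: is_derive_phase; rewrite gt_eqF.
  - by have [_ h] := hu x abx; exact: h.
  - exact: continuous_cos_lin.
rewrite /G.
have hu' : dsq a b k (fun j => u j.+1).
  by move=> x /hu[h1 h2]; split => j jk; [exact: h1|exact: h2].
have e : \int[mu]_(x in `[a, b]) (u 1%N x * (t^-1 * cos (x * t + (th - pi / 2)))) =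
   t^-1 * \int[mu]_(x in `[a, b]) (u 1%N x * cos (x * t + (th - pi / 2))).
  rewrite -RintegralZl//; first by apply: eq_Rintegral => x _; rewrite mulrCA.
  apply: integrable_itv => x abx; apply: cvgM; last exact: continuous_cos_lin.
  by have [_ /(_ 1%N)] := hu x abx; exact.
rewrite e (IH (fun j => u j.+1) _ hu').
have bE y : bdry k.+1 u t th y = t^-1 * (u 0%N y * cos (y * t + (th - pi / 2)) -
   bdry k (fun j => u j.+1) t (th - pi / 2) y).
  rewrite /bdry big_ord_recl /= expr0 mul1r mulrBr; congr (_ + _).
    by rewrite /phase mul1r; ring.
  rewrite mulr_sumr -sumrN; apply: eq_bigr => j _.
  rewrite /bump /= add1n.
  have -> : phase th j.+2 = phase (th - pi / 2) j.+1 by rewrite /phase -(natr1 j.+1); ring.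
  by rewrite exprS (exprS t j.+1) invfM; ring.
rewrite !bE.
have -> : phase th k.+1 = phase (th - pi / 2) k by rewrite /phase -(natr1 k); ring.
by rewrite exprS (exprS t k) invfM; ring.
Qed.

End Oscillation.

(** * Products with a cutoff under repeated integration by parts *)

Section Leibniz.
Context {R : realType}.
Local Notation mu := (@lebesgue_measure R).
Implicit Types (a b t : R) (u p q : nat -> R -> R).

(** The [j]-th derivative of [q 0 * p 0] when [q] and [p] list successive derivatives. *)
Definition leib q p (j : nat) (x : R) : R :=
  \sum_(i < j.+1) 'C(j, i)%:R * q i x * p (j - i)%N x.

(* What is left of the Leibniz sum at a knot where the cutoff [q 0] is flat up to order [n]. *)
Definition jump (n : nat) q p (j : nat) (x : R) : R :=
  \sum_(i < j.+1 | (n < i)%N) 'C(j, i)%:R * `|q i x| * `|p (j - i)%N x|.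

Lemma is_derive_leib q p j (x : R) :
  (forall i, (i <= j)%N -> is_derive x (1 : R) (q i) (q i.+1 x)) ->
  (forall i, (i <= j)%N -> is_derive x (1 : R) (p i) (p i.+1 x)) ->
  is_derive x (1 : R) (leib q p j) (leib q p j.+1 x).
Proof.
move=> dq dp.
have h (i : 'I_j.+1) : is_derive x (1 : R) (fun s => 'C(j, i)%:R * q i s * p (j - i)%N s)
    ('C(j, i)%:R * (q i.+1 x * p (j - i)%N x + q i x * p (j - i).+1 x)).
  have d1 := dq i (leq_ord i); have d2 := dp (j - i)%N (leq_subr i j).
  rewrite (_ : (fun s => _) = ('C(j, i)%:R : R) \*: (q i * p (j - i)%N)); last first.
    by apply/funext => s; rewrite -mulrA.
  apply: is_derive_eq; rewrite /GRing.scale /=; ring.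
rewrite (_ : leib q p j = \sum_(i < j.+1) (fun s => 'C(j, i)%:R * q i s * p (j - i)%N s)); last first.
  by apply/funext => s; rewrite fct_sumE.
apply: is_derive_eq.
(* Pascal's rule splits the sum of order [j + 1] into the two sums produced by the product rule. *)
rewrite /leib [RHS]big_ord_recl /= bin0 mul1r subn0.
under [in RHS]eq_bigr => i _ do rewrite /bump /= add1n binS natrD subSS 2!mulrDl.
rewrite big_split /= addrA.
under [LHS]eq_bigr => i _ do rewrite mulrDr.
rewrite big_split /= addrC; congr (_ + _); last by apply: eq_bigr => i _; rewrite mulrA.
rewrite [LHS]big_ord_recl [in RHS]big_ord_recr /= bin0 mul1r subn0 bin_small// !mul0r addr0.
congr (_ + _); apply: eq_bigr => i _; by rewrite /bump /= add1n mulrA subnSK.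
Qed.

Lemma continuous_at_sum (I : Type) (r : seq I) (F : I -> R -> R) (x : R) :
  (forall i, {for x, continuous (F i)}) -> {for x, continuous (fun s => \sum_(i <- r) F i s)}.
Proof.
move=> h; elim: r => [|i r IH].
  rewrite (_ : (fun s => _) = cst 0); first exact: cvg_cst.
  by apply/funext => s; rewrite big_nil.
rewrite (_ : (fun s => _) = (fun s => F i s + \sum_(j <- r) F j s)).
  by apply: cvgD; [exact: h|exact: IH].
by apply/funext => s; rewrite big_cons.
Qed.

Lemma dsq_leib a b k q p : (forall i (x : R), is_derive x (1 : R) (q i) (q i.+1 x)) ->
  dsq a b k p -> dsq a b k (leib q p).
Proof.
move=> dq hp x /hp[h1 h2]; split => j jk.
  apply: is_derive_leib => i ij //; apply: h1; exact: leq_ltn_trans jk.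
apply: continuous_at_sum => i; apply: cvgM; last first.
  by apply: h2; apply: leq_trans jk; exact: leq_subr.
by apply: cvgM; [exact: cvg_cst|exact: is_derive_continuous_at (dq _ _)].
Qed.

Lemma bdry_le k u t th x : 0 < t -> `|bdry k u t th x| <= \sum_(j < k) t ^- j.+1 * `|u j x|.
Proof.
move=> t0; apply: le_trans (ler_norm_sum _ _ _) _; apply: ler_sum => j _.
rewrite !normrM normrX normrN1 expr1n mul1r (ger0_norm (_ : 0 <= t ^- j.+1)); last first.
  by rewrite invr_ge0 exprn_ge0// ltW.
apply: ler_piMr; first by rewrite mulr_ge0// invr_ge0 exprn_ge0// ltW.
by rewrite ler_norml cos_geN1 cos_le1.
Qed.

Lemma bdryB k u v t th x :
  bdry k u t th x - bdry k v t th x = bdry k (fun j s => u j s - v j s) t th x.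
Proof. by rewrite /bdry -sumrB; apply: eq_bigr => j _; ring. Qed.

Lemma leib_jump0 n q p j x : (forall i, (i <= n)%N -> q i x = 0) ->
  `|leib q p j x| <= jump n q p j x.
Proof.
move=> h; apply: le_trans (ler_norm_sum _ _ _) _.
rewrite /jump [leRHS]big_mkcond; apply: ler_sum => i _.
by case: ltnP => ni; [rewrite !normrM normr_nat|rewrite h// mulr0 mul0r normr0].
Qed.

Lemma leib_jump1 n q p j x : (forall i, (i <= n)%N -> q i x = (i == 0%N)%:R) ->
  `|leib q p j x - p j x| <= jump n q p j x.
Proof.
(* Subtracting the constant 1 from the cutoff alters only its zeroth derivative and makes it flat at
   0, which is the case of [leib_jump0]. *)
move=> h; pose q' i s := q i s - (i == 0%N)%:R.
have -> : leib q p j x - p j x = leib q' p j x.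
  rewrite /leib !big_ord_recl /q' /= bin0 !mul1r subn0 mulrBl mul1r.
  rewrite addrAC; congr (_ + _); apply: eq_bigr => i _.
  by rewrite /bump /= add1n /= subr0.
apply: (@le_trans _ _ (jump n q' p j x)).
  by apply: leib_jump0 => i ni; rewrite /q' h// subrr.
apply: ler_sum => i ni; rewrite /q' (gtn_eqF (leq_ltn_trans _ ni))// subr0 //.
Qed.

Lemma jump_eq0 n q p j x : (j <= n)%N -> jump n q p j x = 0.
Proof.
move=> jn; apply: big1 => i ni; have := leq_trans ni (leq_trans (leq_ord i) jn).
by rewrite ltnn.
Qed.

Lemma osc_rest k (g : R -> R) a b t th (A : R) : a <= b -> 0 < t ->
  (forall s, a <= s <= b -> {for s, continuous g}) ->
  (forall s, a <= s <= b -> `|g s| <= A) ->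
  `|(-1) ^+ k * t ^- k * \int[mu]_(s in `[a, b]) (g s * cos (s * t + th))| <=
    t ^- k * A * (b - a).
Proof.
move=> ab t0 cg gA.
rewrite normrM normrM normrX normrN1 expr1n mul1r (ger0_norm (_ : 0 <= t ^- k)); last first.
  by rewrite invr_ge0 exprn_ge0// ltW.
rewrite -mulrA; apply: ler_wpM2l; first by rewrite invr_ge0 exprn_ge0// ltW.
have ci : forall x, a <= x <= b -> {for x, continuous (fun s => g s * cos (s * t + th))}.
  by move=> x abx; apply: cvgM; [exact: cg|exact: continuous_cos_lin].
apply: le_trans (le_normr_Rintegral _ _) _ => //; first exact: integrable_itv.
have -> : A * (b - a) = \int[mu]_(s in `[a, b]) A.
  rewrite Rintegral_cst//= lebesgue_measure_itv/= lte_fin.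
  by case: ltP => //= ba; rewrite (_ : b = a) ?subrr ?mulr0//; apply/le_anti; rewrite ab ba.
apply: le_Rintegral => //.
- apply: integrable_itv => x abx; apply: (continuous_comp (ci x abx)).
  exact: norm_continuous.
- by apply: integrable_itv => x _; exact: cvg_cst.
- move=> x /=; rewrite in_itv/= => abx; rewrite normrM -[A]mulr1.
  apply: ler_pM => //; first exact: gA.
  by rewrite ler_norml cos_geN1 cos_le1.
Qed.

Lemma osc_flat k p a b t th (A : R) : a <= b -> 0 < t -> dsq a b k p ->
  (forall s, a <= s <= b -> `|p k s| <= A) ->
  `|\int[mu]_(s in `[a, b]) (p 0%N s * cos (s * t + th)) -
    (bdry k p t th b - bdry k p t th a)| <= t ^- k * A * (b - a).
Proof.
move=> ab t0 hp hA; rewrite (osc k)// addrAC subrr add0r.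
by apply: osc_rest => // s /hp[_]; exact.
Qed.

Lemma leib0 q p x : leib q p 0 x = q 0%N x * p 0%N x.
Proof. by rewrite /leib big_ord1 /= bin0 mul1r. Qed.

(** At [a] the product is flat at 0 and at [b] it agrees with [p] to order [n], so apart from the
    jumps only the boundary term of [p] at [b] survives. It is kept explicitly because the
    neighbouring interval cancels it. *)
Lemma osc_rise n k q p a b t th (A : R) : a <= b -> 0 < t -> dsq a b k p ->
  (forall i (x : R), is_derive x (1 : R) (q i) (q i.+1 x)) ->
  (forall i, (i <= n)%N -> q i a = 0) ->
  (forall i, (i <= n)%N -> q i b = (i == 0%N)%:R) ->
  (forall s, a <= s <= b -> `|leib q p k s| <= A) ->
  `|\int[mu]_(s in `[a, b]) (q 0%N s * p 0%N s * cos (s * t + th)) - bdry k p t th b| <=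
    \sum_(j < k) t ^- j.+1 * (jump n q p j a + jump n q p j b) + t ^- k * A * (b - a).
Proof.
move=> ab t0 hp dq qa qb hA.
have hl := dsq_leib _ _ _ _ _ dq hp.
under eq_Rintegral do rewrite -leib0.
rewrite (osc k)//.
have -> (x y z r : R) : x - y + r - z = (x - z) - y + r by ring.
apply: le_trans (ler_normD _ _) _; apply: lerD; last first.
  by apply: osc_rest => // s /hl[_]; exact.
apply: le_trans (ler_normB _ _) _.
rewrite bdryB; under eq_bigr do rewrite mulrDr; rewrite big_split /= addrC; apply: lerD.
  apply: le_trans (bdry_le _ _ _ _ _ t0) _; apply: ler_sum => j _.
  by apply: ler_wpM2l; [rewrite invr_ge0 exprn_ge0// ltW|exact: leib_jump1].
apply: le_trans (bdry_le _ _ _ _ _ t0) _; apply: ler_sum => j _.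
by apply: ler_wpM2l; [rewrite invr_ge0 exprn_ge0// ltW|exact: leib_jump0].
Qed.

Lemma osc_fall n k q p a b t th (A : R) : a <= b -> 0 < t -> dsq a b k p ->
  (forall i (x : R), is_derive x (1 : R) (q i) (q i.+1 x)) ->
  (forall i, (i <= n)%N -> q i a = (i == 0%N)%:R) ->
  (forall i, (i <= n)%N -> q i b = 0) ->
  (forall s, a <= s <= b -> `|leib q p k s| <= A) ->
  `|\int[mu]_(s in `[a, b]) (q 0%N s * p 0%N s * cos (s * t + th)) + bdry k p t th a| <=
    \sum_(j < k) t ^- j.+1 * (jump n q p j a + jump n q p j b) + t ^- k * A * (b - a).
Proof.
move=> ab t0 hp dq qa qb hA.
have hl := dsq_leib _ _ _ _ _ dq hp.
under eq_Rintegral do rewrite -leib0.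
rewrite (osc k)//.
have -> (x y z r : R) : x - y + r + z = x - (y - z) + r by ring.
apply: le_trans (ler_normD _ _) _; apply: lerD; last first.
  by apply: osc_rest => // s /hl[_]; exact.
apply: le_trans (ler_normB _ _) _.
rewrite bdryB; under eq_bigr do rewrite mulrDr; rewrite big_split /= addrC; apply: lerD.
  apply: le_trans (bdry_le _ _ _ _ _ t0) _; apply: ler_sum => j _.
  by apply: ler_wpM2l; [rewrite invr_ge0 exprn_ge0// ltW|exact: leib_jump0].
apply: le_trans (bdry_le _ _ _ _ _ t0) _; apply: ler_sum => j _.
by apply: ler_wpM2l; [rewrite invr_ge0 exprn_ge0// ltW|exact: leib_jump1].
Qed.

End Leibniz.

(** * Cutoffs and their Fourier transforms *)

Section LebesgueLine.
Context {R : realType}.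
Local Notation mu := (@lebesgue_measure R).
Implicit Types (g : R -> R) (t : R).

(** By uniqueness of Lebesgue measure it suffices to test intervals; the preimage of []a, b]] is
    closed at the other end but has the same length. *)
Lemma lebesgue_measure_reflect t (A : set R) : measurable A ->
  pushforward mu ((fun x => t - x) : R -> measurableTypeR R) A = mu A.
Proof.
move=> mA; apply/esym/lebesgue_measure_unique => //=; first exact: measurable_funB.
move=> _ _ [[a b]] _ <-.
rewrite /pushforward/=.
rewrite (_ : _ @^-1` _ = `[t - b, t - a[%classic); last first.
  by apply/seteqP; split => x /=; rewrite !in_itv/=; lra.
rewrite !lebesgue_measure_itv/= !lte_fin ltrD2l ltrN2.
by case: ifP => // _; rewrite -!EFinB; congr (_%:E); ring.
Qed.

Lemma measurable_reflect t :
  measurable_fun setT ((fun x => t - x) : measurableTypeR R -> measurableTypeR R).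
Proof. exact: measurable_funB. Qed.

Lemma integrable_reflect g t : mu.-integrable setT (EFin \o g) ->
  mu.-integrable setT (EFin \o (fun x => g (t - x))).
Proof.
move=> /integrableP[mg ig]; apply/integrableP; split.
  by apply: (measurableT_comp mg); exact: measurable_reflect.
have := @ge0_integral_pushforward _ _ _ _ R _ (measurable_reflect t) mu setT
  (fun x => `|(g x)%:E|%E) measurableT (measurableT_comp _ mg) (fun y _ => abse_ge0 _).
rewrite preimage_setT /comp => <- //.
apply: le_lt_trans ig; rewrite le_eqVlt; apply/orP; left; apply/eqP.
apply: eq_measure_integral; first exact: measurable_reflect.
by move=> mf A mA _; exact: lebesgue_measure_reflect.
Qed.

Lemma Rintegral_reflect g t : mu.-integrable setT (EFin \o g) ->
  \int[mu]_x g (t - x) = \int[mu]_x g x.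
Proof.
move=> ig; rewrite /Rintegral; congr fine.
have ig' := integrable_reflect g t ig; case/integrableP: ig => mg _.
have := @integral_pushforward _ _ _ _ R _ (measurable_reflect t) mu setT
  (EFin \o g) mg.
rewrite preimage_setT => /(_ ig' measurableT) /= <-.
apply: eq_measure_integral; first exact: measurable_reflect.
by move=> mf A mA _; exact: lebesgue_measure_reflect.
Qed.

(** Reflection folds the negative half-line onto the positive one; even integrands then double and
    odd ones cancel. *)
Lemma Rintegral_even g : mu.-integrable setT (EFin \o g) ->
  \int[mu]_x g x = \int[mu]_(x in `[0, +oo[) (g x + g (- x)).
Proof.
move=> ig.
have ig' := integrable_reflect g 0 ig.
have igN : mu.-integrable setT (EFin \o (fun x => g (- x))).
  by move: ig'; congr (_.-integrable _ _); apply/funext => x /=; rewrite sub0r.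
have sub (h : R -> R) A : measurable A -> mu.-integrable setT (EFin \o h) -> mu.-integrable A (EFin \o h).
  by move=> mA; apply: integrableS.
rewrite RintegralD//; [|exact: sub|exact: sub].
have -> : [set: R] = `]-oo, 0[ `|` `[0, +oo[.
  by apply/seteqP; split => x //= _; rewrite !in_itv/= andbT; case: (ltP x 0); [left|right].
rewrite Rintegral_setU//; first last.
- by apply/disj_setPS => x [] /=; rewrite !in_itv/= andbT; lra.
- by apply: sub => //; apply: measurableU.
rewrite addrC; congr (_ + _).
rewrite Rintegral_mkcond.
have i1 : mu.-integrable setT (EFin \o (g \_ `]-oo, 0[)).
  have mI : measurable (`]-oo, 0[%classic : set (measurableTypeR R)) by exact: measurable_itv.
  by have /(integrable_mkcond _ mI) := sub g _ mI ig; rewrite restrict_EFin.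
rewrite -(Rintegral_reflect _ 0 i1).
rewrite -[RHS](Rintegral_itv_obnd_cbnd); last exact: sub.
rewrite [RHS]Rintegral_mkcond; apply: eq_Rintegral => x _.
rewrite !patchE sub0r !mem_setE !in_itv/= andbT oppr_lt0.
by [].
Qed.

Lemma Rintegral_support g (A B : set R) : measurable A -> measurable B -> A `<=` B ->
  (forall x, B x -> ~ A x -> g x = 0) ->
  \int[mu]_(x in B) g x = \int[mu]_(x in A) g x.
Proof.
move=> mA mB AB h; rewrite Rintegral_mkcond [RHS]Rintegral_mkcond.
apply: eq_Rintegral => x _; rewrite !patchE.
have [/set_mem Ax|] := boolP (x \in A); first by rewrite mem_set//; exact: AB.
by move=> /negP nA; case: ifPn => // /set_mem Bx; apply: h => // Ax; apply: nA; exact: mem_set.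
Qed.

Lemma Rintegral_itv_split g a b c : a <= b -> b <= c -> mu.-integrable `[a, c] (EFin \o g) ->
  \int[mu]_(x in `[a, c]) g x = \int[mu]_(x in `[a, b]) g x + \int[mu]_(x in `[b, c]) g x.
Proof.
move=> ab bc ig.
have := @Rintegral_itvB R g (BLeft a) (BRight c) b ig.
rewrite !bnd_simp => /(_ ab bc) h.
rewrite -[X in _ = _ + X]Rintegral_itv_obnd_cbnd -?h; first by rewrite addrC subrK.
by apply: integrableS ig => //; apply: subset_itv; rewrite bnd_simp.
Qed.

(** The derivative of [atan (rho * u)], that is [pi] times a Cauchy density. Its integral over the
    line is [pi] whatever [rho], so bounds by [hump] are uniform in the scale. *)
Definition hump (rho : R) (u : R) : R := rho / (1 + (rho * u) ^+ 2).

Lemma hump_ge0 rho u : 0 <= rho -> 0 <= hump rho u.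
Proof. by move=> r0; rewrite divr_ge0// addr_ge0// sqr_ge0. Qed.

Lemma continuous_hump rho : continuous (hump rho).
Proof.
move=> x; apply: cvgM; first exact: cvg_cst.
apply: cvgV; first by rewrite gt_eqF// ltr_pwDl// sqr_ge0.
apply: cvgD; first exact: cvg_cst.
apply: (@continuous_comp _ _ _ (fun u => rho * u) (fun z : R => z ^+ 2)).
  by apply: cvgM; [exact: cvg_cst|exact: cvg_id].
exact: exprn_continuous.
Qed.

Lemma integral_hump rho : 0 < rho ->
  (\int[mu]_(x in `[0%R, +oo[) (hump rho x)%:E = (pi / 2)%:E)%E.
Proof.
move=> r0.
have dF x : is_derive x (1 : R) (fun u => atan (rho * u)) (hump rho x).
  have h : is_derive x (1 : R) (fun u : R => rho * u) rho.
    have -> : (fun u : R => rho * u) = rho \*: (id : R -> R) by [].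
    by apply: is_derive_eq; rewrite /GRing.scale /= mulr1.
  have := @is_derive1_comp R atan (fun u : R => rho * u) x _ _ (is_derive1_atan _) h.
  by rewrite mulrC.
rewrite (@ge0_continuous_FTC2y R (hump rho) (fun u => atan (rho * u)) 0 (pi / 2)).
- by rewrite mulr0 atan0 sube0.
- by move=> x _; rewrite hump_ge0// ltW.
- by apply: continuous_subspaceT => x; exact: continuous_hump.
- apply: (cvg_comp (fun u => rho * u) atan); last exact: cvgy_atan.
  exact: gt0_cvgMry.
- by move=> x _; have [] := dF x.
- apply: cvg_at_right_filter; exact: is_derive_continuous_at (dF 0).
- by move=> x _; rewrite derive1E; have [] := dF x.
Qed.

Lemma integrable_hump rho : 0 < rho -> mu.-integrable setT (EFin \o hump rho) /\
  \int[mu]_x hump rho x = pi.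
Proof.
move=> r0.
have m1 : measurable_fun setT (hump rho).
  by apply: continuous_measurable_fun; exact: continuous_hump.
have me : measurable_fun setT (fun x => (hump rho x)%:E) by exact/measurable_EFinP.
have h0 x : (0 <= (hump rho x)%:E)%E by rewrite lee_fin hump_ge0// ltW.
have ig : mu.-integrable setT (EFin \o hump rho).
  apply/integrableP; split => //.
  under eq_integral do rewrite (gee0_abs (h0 _)).
  have -> : [set: R] = `]-oo, 0[ `|` `[0, +oo[.
    by apply/seteqP; split => x //= _; rewrite !in_itv/= andbT; case: (ltP x 0) => h; [left|right].
  rewrite ge0_integral_setU//; first last.
  - by apply/disj_setPS => x [] /=; rewrite !in_itv/= andbT; lra.
  - exact: measurable_funTS.
  rewrite integral_hump//.
  apply: (@le_lt_trans _ _ (pi / 2 + pi / 2)%:E); last exact: ltry.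
  rewrite EFinD; apply: leeD => //.
  rewrite -(integral_hump _ r0) (@ge0_integration_by_substitution0 R (EFin \o hump rho))//.
  have -> : (\int[mu]_(r in `]-oo, 0%R]) (EFin \o hump rho) (- r)%R = \int[mu]_(r in `]-oo, 0%R]) (hump rho r)%:E)%E.
    by apply: eq_integral => x _ /=; rewrite /hump mulrN sqrrN.
  apply: ge0_subset_integral => //; first exact: measurable_funTS.
  by apply: subset_itvl; rewrite bnd_simp.
split=> //; rewrite Rintegral_even//.
have -> : \int[mu]_(x in `[0, +oo[) (hump rho x + hump rho (- x)) = \int[mu]_(x in `[0, +oo[) (2 * hump rho x).
  by apply: eq_Rintegral => x _; rewrite /hump mulrN sqrrN; ring.
rewrite RintegralZl//; last exact: integrableS ig.
by rewrite /Rintegral integral_hump//= mulrC divfK.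
Qed.

End LebesgueLine.

(** * Polynomial cutoffs *)

Section Cutoff.
Context {R : realType}.
Local Notation mu := (@lebesgue_measure R).
Implicit Types (P : {poly R}) (rho s t u : R).

Lemma derivn_root_exp (n : nat) P (c : R) i : (('X - c%:P) ^+ n.+1 %| P)%R -> (i <= n)%N ->
  (P^`(i)).[c] = 0.
Proof.
elim: i n P => [|i IH] n P /dvdpP[Q ->].
  by move=> _; rewrite derivn0 exprS !hornerM hornerXsubC subrr mul0r mulr0.
case: n => // n; rewrite ltnS => le; rewrite derivSn; apply: (IH n) => //.
rewrite derivM dvdp_add//; first by apply: dvdp_mull; exact: dvdp_exp2l.
by apply: dvdp_mull; rewrite deriv_exp /= -mulr_natl; do 2 apply: dvdp_mull.
Qed.

(** The profile of a transition from 1 at [1/2] to 0 at [1], flat to order [n] at both ends. Being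
    polynomial, it has no nonzero derivative from order [size P] on. *)
Definition step_poly (n : nat) P := forall i, (i <= n)%N ->
  P^`(i).[1] = 0 /\ P^`(i).[2^-1] = (i == 0%N)%:R.

(* Bezout: [P] is a multiple of [('X - 1)^(n+1)] and [1 - P] one of [('X - 1/2)^(n+1)]. *)
Lemma step_poly_exists n : exists P, step_poly n P.
Proof.
have : coprimep (('X - (1 : R)%:P) ^+ n.+1) (('X - (2^-1 : R)%:P) ^+ n.+1).
  apply/coprimep_expl/coprimep_expr; rewrite coprimep_XsubC root_XsubC.
  by rewrite lt_eqF// invf_lt1// ltr1n.
move=> /Bezout_eq1_coprimepP[[U V] /= e].
exists (U * ('X - 1%:P) ^+ n.+1) => i le; split.
  by apply: (derivn_root_exp n) => //; apply: dvdp_mull.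
have -> : U * ('X - 1%:P) ^+ n.+1 = 1 - V * ('X - (2^-1)%:P) ^+ n.+1 by rewrite -e addrK.
rewrite derivnB hornerD hornerN (derivn_root_exp n (V * _) (2^-1)) ?subr0 ?dvdp_mull//.
by rewrite -polyC1 derivnC; case: (i == 0%N); rewrite hornerC.
Qed.

(** One constant for all derivatives of [P] on [[0, 1]] at once; it is finite because only finitely
    many of them are nonzero. *)
Definition poly_bound P : R := \sum_(i < size P) \sum_(j < size P^`(i)) `|P^`(i)`_j|.

Lemma poly_boundP P i x : 0 <= x <= 1 -> `|P^`(i).[x]| <= poly_bound P.
Proof.
move=> /andP[x0 x1].
have b0 j : 0 <= \sum_(l < size P^`(j)) `|P^`(j)`_l| by apply: sumr_ge0.
case: (ltnP i (size P)) => [lt|ge]; last first.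
  by rewrite derivn_poly0// horner0 normr0; apply: sumr_ge0.
rewrite /poly_bound (bigD1 (Ordinal lt))//= -[leLHS]addr0; apply: lerD; last by apply: sumr_ge0 => j _; exact: b0.
rewrite horner_coef; apply: le_trans (ler_norm_sum _ _ _) _; apply: ler_sum => j _.
by rewrite normrM ler_piMr// normrX exprn_ile1// ger0_norm.
Qed.

Lemma poly_bound_ge0 P : 0 <= poly_bound P.
Proof. by apply: sumr_ge0 => i _; apply: sumr_ge0. Qed.

(** The [i]-th derivatives of the falling transition [P.[s / rho]] on [[rho / 2, rho]] and of its
    complement to 1. *)
Definition qfall P rho (i : nat) s : R := rho ^- i * P^`(i).[s / rho].
Definition qrise P rho (i : nat) s : R := (i == 0%N)%:R - qfall P rho i s.

Lemma is_derive_qfall P rho i s : is_derive s (1 : R) (qfall P rho i) (qfall P rho i.+1 s).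
Proof.
have h : is_derive s (1 : R) (fun u : R => u / rho) rho^-1.
  have -> : (fun u : R => u / rho) = rho^-1 \*: (id : R -> R).
    by apply/funext => u; rewrite mulrC.
  by apply: is_derive_eq; rewrite /GRing.scale /= mulr1.
have h2 := @is_derive1_comp R (horner P^`(i)) (fun u : R => u / rho) s _ _ (is_derive_poly _ _) h.
have -> : qfall P rho i = rho ^- i \*: (horner P^`(i) \o (fun u : R => u / rho)) by [].
apply: is_derive_eq; rewrite /GRing.scale /= /qfall derivnS exprS invfM; ring.
Qed.

Lemma is_derive_qrise P rho i s : is_derive s (1 : R) (qrise P rho i) (qrise P rho i.+1 s).
Proof.
have h := is_derive_qfall P rho i s.
have -> : qrise P rho i = cst ((i == 0%N)%:R) - qfall P rho i by [].
by apply: is_derive_eq; rewrite /qrise /= .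
Qed.

Section Knots.
Variables (n : nat) (P : {poly R}) (rho : R).
Hypotheses (hP : step_poly n P) (rho0 : 0 < rho).

Lemma qfall_top i : (i <= n)%N -> qfall P rho i rho = 0.
Proof. by move=> /hP[h _]; rewrite /qfall divff ?gt_eqF// h mulr0. Qed.

Lemma qfall_half i : (i <= n)%N -> qfall P rho i (rho / 2) = (i == 0%N)%:R.
Proof.
move=> /hP[_ h]; rewrite /qfall (_ : rho / 2 / rho = 2^-1) ?h; last by field; rewrite gt_eqF.
by case: eqP => [->|_]; rewrite ?expr0 ?invr1 ?mulr1// mulr0.
Qed.

Lemma qrise_half i : (i <= n)%N -> qrise P rho i (rho / 2) = 0.
Proof. by move=> le; rewrite /qrise qfall_half// subrr. Qed.

Lemma qrise_top i : (i <= n)%N -> qrise P rho i rho = (i == 0%N)%:R.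
Proof. by move=> le; rewrite /qrise qfall_top// subr0. Qed.

Lemma qfall_le i s : 0 <= s <= rho -> `|qfall P rho i s| <= poly_bound P * rho ^- i.
Proof.
move=> /andP[s0 sr]; rewrite /qfall normrM mulrC (@ger0_norm _ (rho ^- i)); last first.
  by rewrite invr_ge0 exprn_ge0// ltW.
apply: ler_wpM2r; first by rewrite invr_ge0 exprn_ge0// ltW.
by apply: poly_boundP; apply/andP; split; [rewrite divr_ge0// ltW|rewrite ler_pdivrMr// mul1r].
Qed.

Lemma qrise_le i s : 0 <= s <= rho -> `|qrise P rho i s| <= (1 + poly_bound P) * rho ^- i.
Proof.
move=> sr; apply: le_trans (ler_normB _ _) _; rewrite mulrDl mul1r; apply: lerD.
  by case: eqP => [->|_]; rewrite ?expr0 ?invr1 ?normr1// normr0 invr_ge0 exprn_ge0// ltW.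
exact: qfall_le.
Qed.

Lemma qfall_eq0 i s : (size P <= i)%N -> qfall P rho i s = 0.
Proof. by move=> h; rewrite /qfall derivn_poly0// horner0 mulr0. Qed.

Lemma qrise_eq0 i s : (size P <= i)%N -> (0 < i)%N -> qrise P rho i s = 0.
Proof. by move=> h i0; rewrite /qrise qfall_eq0// subr0 gtn_eqF. Qed.

End Knots.

(** Clamping [|s| / rho] to [[1/2, 1]] produces the plateau and the zero set, and exhibits the
    cutoff as a composite of continuous functions. *)
Definition cutoff P rho s : R := P.[Num.min (Num.max (`|s| / rho) 2^-1) 1].

Lemma continuous_cutoff P rho : continuous (cutoff P rho).
Proof.
move=> s.
rewrite (_ : cutoff P rho = horner P \o
  (fun x => (x + 1 - `|x - 1|) / 2) \o (fun x => (x + 2^-1 + `|x - 2^-1|) / 2) \o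
  (fun x => `|x| / rho)); last first.
  by apply/funext => x; rewrite /cutoff /= minr_absE maxr_absE.
have cabs (c x : R) : {for x, continuous (fun y : R => `|y - c|)}.
  apply: (@continuous_comp _ _ _ (fun y : R => y - c) (fun z : R => `|z|)).
    by apply: cvgB; [exact: cvg_id|exact: cvg_cst].
  exact: norm_continuous.
apply: continuous_comp; last apply: continuous_comp; last apply: continuous_comp.
- by apply: cvgM; [exact: norm_continuous|exact: cvg_cst].
- apply: cvgM; last exact: cvg_cst.
  by apply: cvgD; [apply: cvgD; [exact: cvg_id|exact: cvg_cst]|exact: cabs].
- apply: cvgM; last exact: cvg_cst.
  by apply: cvgB; [apply: cvgD; [exact: cvg_id|exact: cvg_cst]|exact: cabs].
- exact: is_derive_continuous_at (is_derive_poly _ _).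
Qed.

Lemma cutoff_le P rho s : `|cutoff P rho s| <= poly_bound P.
Proof.
rewrite /cutoff -[P in P.[_]]derivn0; apply: poly_boundP.
by rewrite le_min ler01 andbT le_max invr_ge0 ler0n orbT /= ge_min lexx orbT.
Qed.

Lemma cutoffN P rho s : cutoff P rho (- s) = cutoff P rho s.
Proof. by rewrite /cutoff normrN. Qed.

Lemma cutoff_flat n P rho s : step_poly n P -> 0 < rho -> `|s| <= rho / 2 -> cutoff P rho s = 1.
Proof.
move=> hP r0 h; rewrite /cutoff max_r; last by rewrite ler_pdivrMr// mulrC.
by rewrite min_l; [have [_] := hP 0%N (leq0n _); rewrite derivn0|lra].
Qed.

Lemma cutoff_out n P rho s : step_poly n P -> 0 < rho -> rho <= `|s| -> cutoff P rho s = 0.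
Proof.
move=> hP r0 h; have h1 : 1 <= `|s| / rho by rewrite ler_pdivlMr// mul1r.
rewrite /cutoff min_r; last by rewrite le_max h1.
by have [] := hP 0%N (leq0n _); rewrite derivn0.
Qed.

Lemma cutoff_fall P rho s : 0 < rho -> rho / 2 <= s <= rho -> cutoff P rho s = qfall P rho 0 s.
Proof.
move=> r0 /andP[h1 h2]; rewrite /cutoff ger0_norm; last by lra.
rewrite max_l; last by rewrite ler_pdivlMr// mulrC.
rewrite min_l; last by rewrite ler_pdivrMr// mul1r.
by rewrite /qfall expr0 invr1 mul1r derivn0.
Qed.

End Cutoff.

(** * Decay of the Fourier transforms of the cutoffs *)

Section Kernel.
Context {R : realType}.
Local Notation mu := (@lebesgue_measure R).
Implicit Types (P : {poly R}) (rho s t u : R).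

Lemma integrable_support (g : R -> R) (A : set R) : compact A -> measurable A ->
  {within A, continuous g} -> (forall x, ~ A x -> g x = 0) ->
  mu.-integrable setT (EFin \o g).
Proof.
move=> cA mA cg g0.
have := continuous_compact_integrable cA cg.
move=> /(integrable_mkcond _ (mA : measurable (A : set (measurableTypeR R)))).
congr (_.-integrable _ _); apply/funext => x /=.
by rewrite patchE; case: ifPn => // /negP h; rewrite g0// => Ax; apply: h; exact: mem_set.
Qed.

Section Fixed.
Variables (n : nat) (P : {poly R}).
Hypotheses (hP : step_poly n P).

Lemma poly_bound_ge1 : 1 <= poly_bound P.
Proof.
have [_ h] := hP 0%N (leq0n _).
have := poly_boundP P 0 (2^-1); rewrite h normr1; apply; lra.
Qed.

Lemma cutoff_out_itv rho s : 0 < rho -> ~ (`[- rho, rho]%classic : set R) s -> cutoff P rho s = 0.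
Proof.
move=> r0 h; apply: (cutoff_out n) => //; rewrite leNgt; apply/negP => lt; apply: h.
by rewrite /= in_itv/= -ler_norml ltW.
Qed.

Lemma integrable_cutoff rho (w : R -> R) : 0 < rho -> continuous w ->
  mu.-integrable setT (EFin \o (fun s => cutoff P rho s * w s)).
Proof.
move=> r0 cw; apply: (integrable_support _ `[- rho, rho]) => //.
- exact: segment_compact.
- apply: continuous_subspaceT => s; apply: cvgM; [exact: continuous_cutoff|exact: cw].
- by move=> x nx; rewrite cutoff_out_itv// mul0r.
Qed.

Lemma Rintegral_cutoff_half rho (w : R -> R) : 0 < rho -> continuous w ->
  \int[mu]_(s in `[0, +oo[) (cutoff P rho s * w s) =
  \int[mu]_(s in `[0, rho / 2]) w s + \int[mu]_(s in `[rho / 2, rho]) (qfall P rho 0 s * w s).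
Proof.
move=> r0 cw; rewrite (Rintegral_support _ `[0, rho])//; last first.
- move=> x /=; rewrite !in_itv/= andbT => x0 /negP; rewrite x0/= -ltNge => lt.
  by rewrite (cutoff_out n) ?mul0r// ger0_norm// ltW.
- by apply: subset_itvl; rewrite bnd_simp.
rewrite (Rintegral_itv_split _ _ (rho / 2)); [|lra|lra|]; last first.
  by apply: integrableS (integrable_cutoff rho w r0 cw).
congr (_ + _); apply: eq_Rintegral => x; rewrite inE/= in_itv/= => /andP[x0 x1].
  by rewrite (cutoff_flat n) ?mul1r// ger0_norm.
by rewrite cutoff_fall// x0.
Qed.

(** Three integrations by parts on either side of [rho / 2]. The boundary terms there cancel, the
    one at 0 vanishes by assumption, [p 3 = 0] removes the integral over the plateau, and [2 <= n]
    removes the jumps. What is left decays like [u ^- 3]. *)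
Lemma half_osc rho u th (p : nat -> R -> R) (A : R) : 0 < rho -> 0 < u -> (2 <= n)%N ->
  (forall j (x : R), is_derive x (1 : R) (p j) (p j.+1 x)) ->
  (forall x, p 3%N x = 0) -> bdry 3 p u th 0 = 0 ->
  (forall s, rho / 2 <= s <= rho -> `|leib (qfall P rho) p 3 s| <= A) ->
  `|\int[mu]_(s in `[0, +oo[) (cutoff P rho s * (p 0%N s * cos (s * u + th)))| <= u ^- 3 * A * (rho / 2).
Proof.
move=> r0 u0 n2 dp p3 b0 hA.
have hp a b : dsq a b 3 p.
  move=> x _; split => j _; first exact: dp.
  exact: is_derive_continuous_at (dp _ _).
rewrite Rintegral_cutoff_half//; last first.
  move=> x; apply: cvgM; last exact: continuous_cos_lin.
  exact: is_derive_continuous_at (dp _ _).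
have l1 : 0 <= rho / 2 by lra.
have l2 : rho / 2 <= rho by lra.
have h1 := osc_flat 3 p 0 (rho / 2) u th 0 l1 u0 (hp _ _).
have h2 := osc_fall n 3 (qfall P rho) p (rho / 2) rho u th A l2 u0 (hp _ _)
  (is_derive_qfall P rho) (qfall_half _ _ _ hP r0) (qfall_top _ _ _ hP r0) hA.
have /h1 {}h1 : forall s, 0 <= s <= rho / 2 -> `|p 3%N s| <= 0.
  by move=> s _; rewrite p3 normr0.
have e2 : \int[mu]_(s in `[rho / 2, rho]) (qfall P rho 0 s * (p 0%N s * cos (s * u + th))) =
   \int[mu]_(s in `[rho / 2, rho]) (qfall P rho 0 s * p 0%N s * cos (s * u + th)).
  by apply: eq_Rintegral => s _; rewrite mulrA.
rewrite e2.
rewrite big1 ?add0r in h2; last first.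
  by move=> j _; rewrite !(jump_eq0 n) ?addr0 ?mulr0//; exact: leq_trans (leq_ord j) n2.
rewrite mulr0 mul0r normr_le0 b0 subr0 subr_eq0 in h1.
rewrite (eqP h1) addrC; apply: le_trans h2 _.
by rewrite le_eqVlt; apply/orP; left; apply/eqP; field; rewrite gt_eqF.
Qed.

(** [ker] is the Fourier transform of the even cutoff; [dker] is its derivative, taken under the
    integral sign. *)
Definition ker rho u : R := \int[mu]_s (cutoff P rho s * cos (s * u)).
Definition dker rho u : R := - \int[mu]_s (cutoff P rho s * (s * sin (s * u))).

Lemma continuous_coslin u : continuous (fun s : R => cos (s * u)).
Proof.
move=> x; have := continuous_cos_lin u 0 x.
by rewrite (_ : (fun s => cos (s * u + 0)) = (fun s => cos (s * u)))//; apply/funext => s; rewrite addr0.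
Qed.

Lemma sin_shift (x : R) : sin x = cos (x + - (pi / 2)).
Proof. by rewrite cosB cos_pihalf sin_pihalf mulr0 mulr1 add0r. Qed.

Lemma continuous_sinlin u : continuous (fun s : R => s * sin (s * u)).
Proof.
move=> x; apply: cvgM; first exact: cvg_id.
under eq_fun do rewrite sin_shift; rewrite sin_shift; exact: continuous_cos_lin.
Qed.

Lemma kerN rho u : ker rho (- u) = ker rho u.
Proof. by apply: eq_Rintegral => s _; rewrite mulrN cosN. Qed.

Lemma dkerN rho u : 0 < rho -> dker rho (- u) = - dker rho u.
Proof.
move=> r0; rewrite /dker; congr (- _).
rewrite -[RHS]mulN1r -RintegralZl//; last first.
  by apply: integrable_cutoff => //; exact: continuous_sinlin.
by apply: eq_Rintegral => s _; rewrite mulrN sinN; ring.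
Qed.

Lemma ker_half rho u : 0 < rho ->
  ker rho u = 2 * \int[mu]_(s in `[0, +oo[) (cutoff P rho s * (1 * cos (s * u + 0))).
Proof.
move=> r0; have ig := integrable_cutoff rho _ r0 (continuous_coslin u).
rewrite /ker Rintegral_even// -RintegralZl//; last first.
  rewrite (_ : (fun s => _) = (fun s => cutoff P rho s * cos (s * u))); first exact: integrableS ig.
  by apply/funext => s; rewrite mul1r addr0.
by apply: eq_Rintegral => s _; rewrite cutoffN mulNr cosN addr0; ring.
Qed.

Lemma dker_half rho u : 0 < rho ->
  dker rho u = - (2 * \int[mu]_(s in `[0, +oo[) (cutoff P rho s * (s * cos (s * u + - (pi / 2))))).
Proof.
move=> r0; have ig := integrable_cutoff rho _ r0 (continuous_sinlin u).
rewrite /dker Rintegral_even// -RintegralZl//; last first.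
  rewrite (_ : (fun s => _) = (fun s => cutoff P rho s * (s * sin (s * u)))); first exact: integrableS ig.
  by apply/funext => s; rewrite -sin_shift.
by congr (- _); apply: eq_Rintegral => s _; rewrite cutoffN -sin_shift !mulNr sinN; ring.
Qed.

(** For [x <= 1] the plain bound is enough; for [x > 1] the cubic one still leaves decay of order
    [x ^- 2] after multiplication by [x]. *)
Lemma hump_dom (a x M : R) : 0 <= a -> 0 <= x -> a <= M -> a * x ^+ 3 <= M ->
  a <= 2 * M / (1 + x ^+ 2) /\ x * a <= 2 * M / (1 + x ^+ 2).
Proof.
move=> a0 x0 h1 h2.
have d0 : 0 < 1 + x ^+ 2 by rewrite ltr_pwDl// sqr_ge0.
have [x1|x1] := leP x 1.
  have xx : x ^+ 2 <= 1 by rewrite exprn_ile1.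
  rewrite !ler_pdivlMr//; split; first by nra.
  have : x * a <= a by rewrite ler_piMl.
  nra.
have x2 : 1 <= x ^+ 2 by rewrite exprn_ege1// ltW.
have e3 : a * x ^+ 3 = (a * x) * x ^+ 2 by ring.
have ax : a <= a * x by rewrite ler_peMr// ltW.
rewrite e3 in h2; rewrite !ler_pdivlMr//; split; nra.
Qed.

Lemma Rintegral_abs_cutoff rho (w : R -> R) B : 0 < rho -> continuous w -> 0 <= B ->
  (forall s, `|s| <= rho -> `|w s| <= B) ->
  `|\int[mu]_s (cutoff P rho s * w s)| <= 2 * rho * poly_bound P * B.
Proof.
move=> r0 cw B0 wB; have ig := integrable_cutoff rho w r0 cw.
rewrite (Rintegral_support _ `[- rho, rho])//; last by move=> x _ nx; rewrite cutoff_out_itv// mul0r.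
have igr : mu.-integrable `[- rho, rho] (EFin \o (fun s => cutoff P rho s * w s)) by exact: integrableS ig.
apply: le_trans (le_normr_Rintegral _ _) _ => //.
have -> : 2 * rho * poly_bound P * B = \int[mu]_(s in `[- rho, rho]) (poly_bound P * B).
  rewrite Rintegral_cst//= lebesgue_measure_itv/= lte_fin ifT; last lra.
  by rewrite /= opprK; ring.
apply: le_Rintegral => //.
- move: (igr) => /integrable_norm.
  by congr (_.-integrable _ _).
- by apply: integrable_itv => x _; exact: cvg_cst.
- move=> s /=; rewrite in_itv/= -ler_norml => sr; rewrite normrM; apply: ler_pM => //.
    exact: cutoff_le.
  exact: wB.
Qed.

(** The bound with the extra weight [rho * |u|] is the one that pairs with the Lipschitz condition
    on [f]; it is the reason for asking cubic decay of the kernel. *)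
Lemma ker_bounds rho u : 0 < rho -> (2 <= n)%N ->
  `|ker rho u| <= 4 * poly_bound P * hump rho u /\
  rho * `|u| * `|ker rho u| <= 4 * poly_bound P * hump rho u.
Proof.
move=> r0 n2; wlog u0 : u / 0 <= u.
  move=> h; case: (leP 0 u) => [|/ltW]; first exact: h.
  rewrite -oppr_ge0 => /h; rewrite kerN normrN /hump mulrN sqrrN //.
have A1 := poly_bound_ge1.
have b1 : `|ker rho u| <= 2 * rho * poly_bound P.
  rewrite -[leRHS]mulr1; apply: Rintegral_abs_cutoff => //; first exact: continuous_coslin.
  by move=> s _; rewrite ler_norml cos_geN1 cos_le1.
have b2 : `|ker rho u| * (rho * u) ^+ 3 <= 2 * rho * poly_bound P.
  have [->|un0] := eqVneq u 0; first by rewrite mulr0 expr0n/= mulr0 mulr_ge0 ?poly_bound_ge0// mulr_ge0// ltW.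
  have up : 0 < u by rewrite lt_neqAle eq_sym un0.
  (* The constant 1 with its derivatives. At 0 its single boundary term carries
     [cos (- (pi / 2)) = 0]. *)
  pose p (j : nat) (s : R) : R := (j == 0%N)%:R.
  have h : `|\int[mu]_(s in `[0, +oo[) (cutoff P rho s * (p 0%N s * cos (s * u + 0)))| <=
      u ^- 3 * (poly_bound P * rho ^- 3) * (rho / 2).
    apply: (half_osc _ _ _ p) => //.
    - rewrite /bdry !big_ord_recl big_ord0 /p /= /phase.
      by rewrite !(mul0r, mulr0, addr0, add0r, sub0r, mul1r) cosN cos_pihalf mulr0.
    - move=> s /andP[s1 s2].
      rewrite /leib !big_ord_recl big_ord0 /p /= !mulr0 !add0r addr0 mulr1.
      rewrite mul1r; apply: qfall_le => //; apply/andP; split => //; lra.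
  rewrite ker_half// normrM ger0_norm//.
  rewrite /p /= in h.
  apply: (@le_trans _ _ (2 * (u ^- 3 * (poly_bound P * rho ^- 3) * (rho / 2)) * (rho * u) ^+ 3)).
    by rewrite ler_pM2r ?exprn_gt0 ?mulr_gt0// ler_pM2l.
  have -> : 2 * (u ^- 3 * (poly_bound P * rho ^- 3) * (rho / 2)) * (rho * u) ^+ 3 = rho * poly_bound P.
    by field; rewrite !gt_eqF.
  by rewrite -mulrA ler_peMl ?ler1n// mulr_ge0//; lra.
have ru : 0 <= rho * u by rewrite mulr_ge0// ltW.
have [h1 h2] := hump_dom _ _ _ (normr_ge0 _) ru b1 b2.
have e : 2 * (2 * rho * poly_bound P) / (1 + (rho * u) ^+ 2) = 4 * poly_bound P * hump rho u.
  by rewrite /hump; field; rewrite gt_eqF// ltr_pwDl// sqr_ge0.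
by rewrite -e (ger0_norm u0).
Qed.

Lemma dker_bound rho u : 0 < rho -> (2 <= n)%N ->
  `|dker rho u| <= 8 * poly_bound P * rho * hump rho u.
Proof.
move=> r0 n2; wlog u0 : u / 0 <= u.
  move=> h; case: (leP 0 u) => [|/ltW]; first exact: h.
  rewrite -oppr_ge0 => /h; rewrite dkerN// normrN /hump mulrN sqrrN //.
have A1 := poly_bound_ge1.
have b1 : `|dker rho u| <= 4 * rho ^+ 2 * poly_bound P.
  apply: (@le_trans _ _ (2 * rho * poly_bound P * rho)).
    rewrite /dker normrN; apply: Rintegral_abs_cutoff; rewrite ?ltW//.
      exact: continuous_sinlin.
    move=> s sr; rewrite normrM -[leRHS]mulr1; apply: ler_pM => //.
    by rewrite ler_norml sin_geN1 sin_le1.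
  by have : 0 <= rho ^+ 2 * poly_bound P; [rewrite mulr_ge0// ?sqr_ge0; lra|nra].
have b2 : `|dker rho u| * (rho * u) ^+ 3 <= 4 * rho ^+ 2 * poly_bound P.
  have [->|un0] := eqVneq u 0.
    by rewrite mulr0 expr0n/= mulr0 mulr_ge0 ?poly_bound_ge0// mulr_ge0// sqr_ge0.
  have up : 0 < u by rewrite lt_neqAle eq_sym un0.
  (* The identity with its derivatives. At 0 the first boundary term vanishes with [s], the second
     carries the cosine of three quarter turns. The constant 4 below is 3 + 1, from ['C(3, 2)] and
     ['C(3, 3)]. *)
  pose p (j : nat) (s : R) : R := if j == 0%N then s else (j == 1%N)%:R.
  have h : `|\int[mu]_(s in `[0, +oo[) (cutoff P rho s * (p 0%N s * cos (s * u + - (pi / 2))))| <=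
      u ^- 3 * (4 * poly_bound P * rho ^- 2) * (rho / 2).
    apply: (half_osc _ _ _ p) => //.
    - move=> [|j] x; rewrite /p /=; first exact: is_derive_id.
      by exact: is_derive_cst.
    - rewrite /bdry !big_ord_recl big_ord0 /p /= /phase /bump /=.
      rewrite !(mul0r, mulr0, addr0, add0r).
      have -> : - (pi / 2) - 2 * (pi / 2) = - (pi / 2 + pi) :> R by field.
      by rewrite cosN cosDpi cos_pihalf oppr0 mulr0.
    - move=> s /andP[s1 s2].
      have sr : 0 <= s <= rho by apply/andP; split => //; lra.
      rewrite /leib !big_ord_recl big_ord0 /p /= !mulr0 !add0r addr0 mulr1.
      rewrite /bump /= /subn /= (_ : 'C(3, 2) = 3%N)// (_ : 'C(3, 3) = 1%N)// mul1r.
      have q2 := qfall_le P rho r0 2 s sr; have q3 := qfall_le P rho r0 3 s sr.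
      have q3s : `|qfall P rho 3 s * s| <= poly_bound P * rho ^- 2.
        rewrite normrM; apply: (@le_trans _ _ (poly_bound P * rho ^- 3 * rho)).
          by apply: ler_pM => //; rewrite ger0_norm; lra.
        by rewrite le_eqVlt; apply/orP; left; apply/eqP; field; rewrite gt_eqF.
      apply: le_trans (ler_normD _ _) _.
      have : `|3 * qfall P rho 2 s| <= 3 * (poly_bound P * rho ^- 2).
        by rewrite normrM ger0_norm// ler_pM2l.
      lra.
  rewrite dker_half// normrN normrM ger0_norm//.
  rewrite /p /= in h.
  apply: (@le_trans _ _ (2 * (u ^- 3 * (4 * poly_bound P * rho ^- 2) * (rho / 2)) * (rho * u) ^+ 3)).
    by rewrite ler_pM2r ?exprn_gt0 ?mulr_gt0// ler_pM2l.
  by rewrite le_eqVlt; apply/orP; left; apply/eqP; field; rewrite !gt_eqF.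
have ru : 0 <= rho * u by rewrite mulr_ge0// ltW.
have [h1 _] := hump_dom _ _ _ (normr_ge0 _) ru b1 b2.
apply: le_trans h1 _; rewrite le_eqVlt; apply/orP; left; apply/eqP; rewrite /hump.
by field; rewrite gt_eqF// ltr_pwDl// sqr_ge0.
Qed.

End Fixed.
End Kernel.

(** * Dominated convergence and Fubini for real integrals *)

Section RealIntegrals.
Context {R : realType}.
Local Notation mu := (@lebesgue_measure R).

Lemma Rintegral_cvg (D : set R) (f_ : nat -> R -> R) (f g : R -> R) : measurable D ->
  (forall n, measurable_fun D (f_ n)) -> measurable_fun D f ->
  mu.-integrable D (EFin \o g) ->
  (forall x, D x -> f_ n x @[n --> \oo] --> f x) ->
  (forall n x, D x -> `|f_ n x| <= g x) ->
  mu.-integrable D (EFin \o f) /\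
  \int[mu]_(x in D) f_ n x @[n --> \oo] --> \int[mu]_(x in D) f x.
Proof.
move=> mD mf_ mf ig fcv fg.
have [|||||i1 _ i3] := @dominated_convergence _ _ R mu D mD (fun n => EFin \o f_ n) (EFin \o f) (EFin \o g).
- by move=> n; apply/measurable_EFinP; exact: mf_.
- exact/measurable_EFinP.
- by apply: aeW => x Dx; apply: cvg_EFin; [exact: nearW|exact: fcv].
- exact: ig.
- by apply: aeW => x n Dx; rewrite lee_fin; exact: fg.
split => //; apply: fine_cvg; rewrite fineK; last exact: integrable_fin_num.
exact: i3.
Qed.

Lemma Rintegral_cvg_itv (g : R -> R) : mu.-integrable `[0, +oo[ (EFin \o g) ->
  \int[mu]_(x in `[0, n%:R]) g x @[n --> \oo] --> \int[mu]_(x in `[0, +oo[) g x.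
Proof.
move=> ig; set D : set R := `[0, +oo[%classic in ig *.
have mg : measurable_fun D g by case/integrableP: ig => /measurable_EFinP.
pose h n := g \_ (`[0, n%:R]%classic : set R).
have mh n : measurable_fun D (h n).
  have mI : measurable (`[0, n%:R]%classic : set R) by exact: measurable_itv.
  have mD : measurable D by exact: measurable_itv.
  by apply: (measurable_restrict g mI mD).1; apply: measurable_funS mg => //; exact: subIsetl.
have hc x : D x -> h n x @[n --> \oo] --> g x.
  rewrite /D /= in_itv/= andbT => x0.
  apply: cvg_near_cst; exists (Num.truncn x).+1 => // n /= xn.
  rewrite /h patchE mem_set//= in_itv/= x0 (ltW (lt_le_trans (truncnS_gt x) _))// ler_nat//.
have hg n x : D x -> `|h n x| <= `|g x|.
  by move=> _; rewrite /h patchE; case: ifP => // _; rewrite normr0.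
have [_] := Rintegral_cvg D h g _ (measurable_itv _) mh mg (integrable_norm ig) hc hg.
rewrite (_ : (fun n => \int[mu]_(x in D) h n x) = (fun n : nat => \int[mu]_(x in `[0, n%:R]) g x))//.
apply/funext => n; rewrite /h -Rintegral_mkcondr; congr (Rintegral _ _ _).
by apply/seteqP; split => x; rewrite /D /= !in_itv/= andbT; [case|move=> /andP[x0 xn]; split => //; rewrite x0].
Qed.

Lemma Rfubini (F G : R -> R) (k : R -> R -> R) :
  mu.-integrable setT (EFin \o F) -> mu.-integrable setT (EFin \o G) ->
  measurable_fun setT (fun z : R * R => k z.1 z.2) -> (forall x y, `|k x y| <= 1) ->
  mu.-integrable setT (EFin \o (fun x => F x * \int[mu]_y (G y * k x y))) /\
  \int[mu]_x (F x * \int[mu]_y (G y * k x y)) = \int[mu]_y (G y * \int[mu]_x (F x * k x y)).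
Proof.
move=> iF iG mk k1.
have [mF iF'] := integrableP _ _ _ iF; have [mG iG'] := integrableP _ _ _ iG.
have mF' : measurable_fun setT F by exact/measurable_EFinP.
have mG' : measurable_fun setT G by exact/measurable_EFinP.
pose f (z : R * R) := (F z.1 * G z.2 * k z.1 z.2)%:E.
have mf : measurable_fun setT f.
  apply/measurable_EFinP; apply: measurable_funM => //; apply: measurable_funM.
    exact: (measurableT_comp mF' measurable_fst).
  exact: (measurableT_comp mG' measurable_snd).
have intf : (mu \x mu)%E.-integrable setT f.
  apply/integrable12ltyP => //.
  apply: (@le_lt_trans _ _ (\int[mu]_x (`|(F x)%:E| * \int[mu]_y `|(G y)%:E|))%E).
    apply: ge0_le_integral => //.
    - by move=> x _; exact: integral_ge0.
    - apply: (@measurable_fun_fubini_tonelli_F _ _ _ _ R mu (abse \o f)).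
        exact: measurableT_comp.
      by move=> z; exact: abse_ge0.
    - by under eq_fun do rewrite muleC; apply: measurable_funeM; exact: measurableT_comp.
    move=> x _; rewrite -ge0_integralZl//; last exact: measurableT_comp.
    apply: ge0_le_integral => //.
    - apply: measurableT_comp => //.
      exact: (measurableT_comp mf (pair1_measurable _)).
    - by apply: measurable_funeM; exact: measurableT_comp.
    move=> y _; rewrite /f /= -EFinM lee_fin !normrM ler_piMr// mulr_ge0//.
  under eq_integral do rewrite muleC.
  rewrite ge0_integralZl//; [|exact: measurableT_comp|exact: integral_ge0].
  apply: lte_mul_pinfty => //; first exact: integral_ge0.
  by rewrite ge0_fin_numE//; exact: integral_ge0.
have key := Fubini intf.
have i1 x : mu.-integrable setT (EFin \o (fun y => G y * k x y)).
  apply: (le_integrable _ _ _ iG) => //.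
    apply/measurable_EFinP; apply: measurable_funM => //.
    exact: (measurableT_comp mk (pair1_measurable x)).
  by move=> y _ /=; rewrite lee_fin normrM ler_piMr.
have i2 y : mu.-integrable setT (EFin \o (fun x => F x * k x y)).
  apply: (le_integrable _ _ _ iF) => //.
    apply/measurable_EFinP; apply: measurable_funM => //.
    exact: (measurableT_comp mk (pair2_measurable y)).
  by move=> x _ /=; rewrite lee_fin normrM ler_piMr.
have eF : (fun x => \int[mu]_y f (x, y))%E = (fun x => (F x * \int[mu]_y (G y * k x y))%:E).
  apply/funext => x; rewrite EFinM fineK; last exact: (integrable_fin_num _ (i1 x)).
  rewrite -integralZl//; last exact: i1.
  by apply: eq_integral => y _; rewrite /f /= -EFinM mulrA.
split; first by have := integrable_fubini_F intf; rewrite /fubini_F eF.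
rewrite /Rintegral; congr fine; move: key; rewrite eF.
move=> ->.
apply: eq_integral => y _; rewrite EFinM fineK; last exact: (integrable_fin_num _ (i2 y)).
rewrite -integralZl//; last exact: i2.
by apply: eq_integral => x _; rewrite /f /= -EFinM; congr (_%:E); ring.
Qed.

End RealIntegrals.

(** * Exponential damping and the Poisson kernel *)

Section Exponentials.
Context {R : realType}.
Local Notation mu := (@lebesgue_measure R).
Implicit Types (al s u : R).

Lemma is_derive_expRM (c u : R) : is_derive u (1 : R) (fun x => expR (c * x)) (c * expR (c * u)).
Proof.
have h : is_derive u (1 : R) (fun x : R => c * x) c.
  have -> : (fun x : R => c * x) = c \*: (id : R -> R) by [].
  by apply: is_derive_eq; rewrite /GRing.scale /= mulr1.
have := @is_derive1_comp R expR (fun x : R => c * x) u _ _ (is_derive_expR _) h.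
by rewrite mulrC.
Qed.

Lemma continuous_expRM (c : R) : continuous (fun x => expR (c * x)).
Proof. by move=> x; exact: is_derive_continuous_at (is_derive_expRM c x). Qed.

Lemma cvg_expRM al : 0 < al -> expR (- al * x) @[x --> +oo] --> (0 : R).
Proof.
move=> a0; under eq_fun do rewrite mulNr.
apply: (cvg_comp (fun x => al * x) (fun z => expR (- z))); first exact: gt0_cvgMry.
exact: cvgr_expR.
Qed.

Lemma integral_expR al : 0 < al ->
  (\int[mu]_(x in `[0%R, +oo[) (expR (- al * x))%:E = (al^-1)%:E)%E.
Proof.
move=> a0.
have dF x : is_derive x (1 : R) (fun u => - al^-1 * expR (- al * u)) (expR (- al * x)).
  have h := is_derive_expRM (- al) x.
  have -> : (fun u => - al^-1 * expR (- al * u)) = (- al^-1) \*: (fun u => expR (- al * u)) by [].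
  by apply: is_derive_eq; rewrite /GRing.scale /= mulrA mulNr mulrN opprK mulVf ?mul1r// gt_eqF.
rewrite (@ge0_continuous_FTC2y R (fun x => expR (- al * x)) (fun u => - al^-1 * expR (- al * u)) 0 0).
- by rewrite mulr0 expR0 mulr1 -EFinB sub0r opprK.
- by move=> x _; exact: expR_ge0.
- by apply: continuous_subspaceT => x; exact: continuous_expRM.
- rewrite -[X in _ --> X](mulr0 (- al^-1)); apply: cvgM; first exact: cvg_cst.
  exact: cvg_expRM.
- by move=> x _; have [] := dF x.
- apply: cvg_at_right_filter; exact: is_derive_continuous_at (dF 0).
- by move=> x _; rewrite derive1E; have [] := dF x.
Qed.

Lemma integrable_expR al : 0 < al ->
  mu.-integrable `[0, +oo[ (EFin \o (fun x => expR (- al * x))).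
Proof.
move=> a0; apply/integrableP; split.
  apply/measurable_EFinP; apply: measurable_funTS.
  by apply: continuous_measurable_fun; exact: continuous_expRM.
under eq_integral do rewrite gee0_abs ?lee_fin ?expR_ge0//.
by rewrite integral_expR// ltry.
Qed.

(** Evaluated on [[0, n]] through an explicit antiderivative. As a function of [s] the result is
    half the Poisson kernel, which [ker_abel] integrates against the cutoff. *)
Lemma Rintegral_expcos al s : 0 < al ->
  \int[mu]_(x in `[0, +oo[) (expR (- al * x) * cos (x * s)) = al / (al ^+ 2 + s ^+ 2).
Proof.
move=> a0; have d0 : 0 < al ^+ 2 + s ^+ 2 by rewrite ltr_pwDl ?sqr_ge0// exprn_gt0.
pose g x := expR (- al * x) * cos (x * s).
have cg : continuous g.
  by move=> x; apply: cvgM; [exact: continuous_expRM|exact: continuous_coslin].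
have ig : mu.-integrable `[0, +oo[ (EFin \o g).
  apply: (le_integrable _ _ _ (integrable_expR al a0)) => //.
    by apply/measurable_EFinP; apply: measurable_funTS; exact: continuous_measurable_fun.
  move=> x _; rewrite lee_fin normrM (ger0_norm (expR_ge0 _)) ler_piMr ?expR_ge0//.
  by rewrite ler_norml cos_geN1 cos_le1.
pose D := al ^+ 2 + s ^+ 2.
pose F x := expR (- al * x) * (D^-1 * (s * cos (x * s + - (pi / 2)) - al * cos (x * s + 0))).
have dcos th x : is_derive x (1 : R) (fun y => cos (y * s + th)) (- s * sin (x * s + th)).
  have h : is_derive x (1 : R) (fun y : R => y * s + th) s.
    have -> : (fun y : R => y * s + th) = (s \*: (id : R -> R)) + cst th.
      by apply/funext => y; rewrite [in LHS]mulrC.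
    by apply: is_derive_eq; rewrite addr0 /GRing.scale /= mulr1.
  have := @is_derive1_comp R cos (fun y : R => y * s + th) x _ _ (is_derive_cos _) h.
  by rewrite mulrC mulrN mulNr.
have dF x : is_derive x (1 : R) F (g x).
  have h1 := is_derive_expRM (- al) x; have h2 := dcos (- (pi / 2)) x; have h3 := dcos 0 x.
  have -> : F = (fun y => expR (- al * y)) * (D^-1 \*: (s \*: (fun y => cos (y * s + - (pi / 2))) -
     al \*: (fun y => cos (y * s + 0)))) by [].
  apply: is_derive_eq; rewrite /GRing.scale /= /g.
  transitivity (expR (- al * x) * (D^-1 * (s * (- s * sin (x * s - pi / 2)) - al * (- s * sin (x * s + 0)))) +
    D^-1 * (s * cos (x * s - pi / 2) - al * cos (x * s + 0)) * (- al * expR (- al * x))) => //.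
  rewrite -sin_shift.
  have -> : sin (x * s + - (pi / 2)) = - cos (x * s).
    by rewrite sinB cos_pihalf sin_pihalf mulr0 mulr1 sub0r.
  by rewrite /D addr0; field; rewrite gt_eqF.
have cI : \int[mu]_(x in `[0, n%:R]) g x @[n --> \oo] --> al / D.
  have e n : \int[mu]_(x in `[0, n%:R]) g x = F n%:R - F 0.
    (* With the constant factor 1, integration by parts is the fundamental theorem of calculus. *)
    have := @parts R F (cst 1) g (cst 0) 0 n%:R (ler0n _ n) (fun x _ => dF x) (fun x _ => is_derive_cst _ _ _)
      (fun x _ => cg x) (fun x _ => cvg_cst _).
    have -> : \int[mu]_(x in `[0, n%:R]) (F x * cst 0 x) = 0.
      by under eq_Rintegral do rewrite mulr0; rewrite Rintegral_cst// mul0r.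
    have -> : \int[mu]_(x in `[0, n%:R]) (g x * cst 1 x) = \int[mu]_(x in `[0, n%:R]) g x.
      by apply: eq_Rintegral => x _; rewrite mulr1.
    by rewrite /= !mulr1 => h; apply/esym/subr0_eq; rewrite -h.
  under eq_fun do rewrite e.
  have -> : al / D = 0 - F 0.
    by rewrite /F !mulr0 expR0 !mul0r !add0r cosN cos_pihalf cos0 /D; field; rewrite gt_eqF.
  apply: cvgB; last exact: cvg_cst.
  pose K := D^-1 * (`|s| + al).
  have FK n : `|F n%:R| <= expR (- al * n%:R) * K.
    rewrite /F normrM (ger0_norm (expR_ge0 _)); apply: ler_wpM2l; first exact: expR_ge0.
    have Di0 : 0 <= D^-1 by rewrite invr_ge0 ltW.
    rewrite /K normrM (ger0_norm Di0); apply: ler_wpM2l => //.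
    apply: le_trans (ler_normB _ _) _; rewrite !normrM (gtr0_norm a0).
    have c1 y : `|cos y| <= 1 :> R by rewrite ler_norml cos_geN1 cos_le1.
    by apply: lerD; rewrite ler_piMr// ltW.
  have eK : expR (- al * n%:R) * K @[n --> \oo] --> (0 : R).
    rewrite -[X in _ --> X](mul0r K); apply: cvgM; last exact: cvg_cst.
    apply: (cvg_comp (fun n : nat => n%:R : R) (fun x => expR (- al * x))); last exact: cvg_expRM.
    exact: cvgr_idn.
  apply: (@squeeze_cvgr _ _ _ _ (fun n : nat => - (expR (- al * n%:R) * K)) (fun n : nat => expR (- al * n%:R) * K)) => //.
    by apply: nearW => n; rewrite -ler_norml.
  by rewrite -[X in _ --> X]oppr0; exact: cvgN.
have h2 := Rintegral_cvg_itv g ig.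
exact: (cvg_unique _ h2 cI).
Qed.

End Exponentials.

(** * Derivative, continuity and total mass of the kernels *)

Section KernelMass.
Context {R : realType}.
Local Notation mu := (@lebesgue_measure R).

Lemma integrable_even (g : R -> R) : measurable_fun setT g -> (forall x, g (- x) = g x) ->
  mu.-integrable `[0, +oo[ (EFin \o g) -> mu.-integrable setT (EFin \o g).
Proof.
move=> mg ge ig.
pose I : set (measurableTypeR R) := `[0, +oo[%classic.
have mI : measurable I by exact: measurable_itv.
have i1 : mu.-integrable setT (EFin \o (g \_ I)).
  by have /(integrable_mkcond _ mI) := ig; rewrite restrict_EFin.
have i2 := integrable_reflect _ 0 i1.
have i4 := integrable_norm i1; have i5 := integrable_norm i2.
apply: (le_integrable measurableT _ _ (integrableD measurableT i4 i5)).
  exact/measurable_EFinP.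
move=> x _ /=; rewrite lee_fin sub0r !patchE.
rewrite (ger0_norm (addr_ge0 (normr_ge0 _) (normr_ge0 _))).
have [x0|x0] := leP 0 x.
  by rewrite ifT ?lerDl// mem_set//= /I /= in_itv/= x0.
rewrite [X in _ + `|X|]ifT ?ge ?lerDr// mem_set//= /I /= in_itv/= andbT oppr_ge0 ltW//.
Qed.

Lemma integrableTS (A : set R) (g : R -> R) : measurable A ->
  mu.-integrable setT (EFin \o g) -> mu.-integrable A (EFin \o g).
Proof. by move=> mA; apply: integrableS. Qed.

Section Fixed.
Variables (n : nat) (P : {poly R}).
Hypotheses (hP : step_poly n P) (n2 : (2 <= n)%N).
Variable rho : R.
Hypothesis rho0 : 0 < rho.

Lemma is_derive_ker (u : R) : is_derive u (1 : R) (ker P rho) (dker P rho u).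
Proof.
pose f (x y : R) := cutoff P rho y * cos (y * x).
have df x y : is_derive x (1 : R) (f ^~ y) (- (cutoff P rho y * (y * sin (y * x)))).
  have h : is_derive x (1 : R) (fun z : R => y * z) y.
    have -> : (fun z : R => y * z) = y \*: (id : R -> R) by [].
    by apply: is_derive_eq; rewrite /GRing.scale /= mulr1.
  have h2 := @is_derive1_comp R cos (fun z : R => y * z) x _ _ (is_derive_cos _) h.
  have -> : f ^~ y = cutoff P rho y \*: (cos \o (fun z : R => y * z)) by [].
  by apply: is_derive_eq; rewrite /GRing.scale /=; ring.
have I0 : `]u - 1, u + 1[%classic u by rewrite /= in_itv/=; lra.
have i1 x : `]u - 1, u + 1[%classic x -> mu.-integrable setT (EFin \o f x).
  by move=> _; apply: (integrable_cutoff n) => //; exact: continuous_coslin.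
have d1 x y : `]u - 1, u + 1[%classic x -> setT y -> derivable (f ^~ y) x 1.
  by move=> _ _; have [] := df x y.
have i2 : mu.-integrable setT (EFin \o (fun y => `|cutoff P rho y * y|)).
  apply: (@integrable_norm _ _ _ mu setT (fun y => cutoff P rho y * y)).
  by apply: (integrable_cutoff n) => // x; exact: cvg_id.
have b1 x y : `]u - 1, u + 1[%classic x -> setT y -> `|partial1of2 f x y| <= `|cutoff P rho y * y|.
  move=> _ _; rewrite partial1of2E; have [_ ->] := df x y.
  by rewrite normrN mulrA normrM ler_piMr// ler_norml sin_geN1 sin_le1.
have e1 := @differentiation_under_integral R _ _ mu f setT measurableT u _ _ I0 i1 d1 _ (fun y => normr_ge0 _) i2 b1.
have e2 := @derivable_under_integral R _ _ mu f setT measurableT u _ _ I0 i1 d1 _ (fun y => normr_ge0 _) i2 b1.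
apply: DeriveDef => //.
rewrite -derive1E e1 /dker -mulN1r -RintegralZl//; last first.
  by apply: (integrable_cutoff n) => //; exact: continuous_sinlin.
by apply: eq_Rintegral => y _; rewrite partial1of2E; have [_ ->] := df u y; rewrite mulN1r.
Qed.

Lemma continuous_ker : continuous (ker P rho).
Proof. by move=> u; exact: is_derive_continuous_at (is_derive_ker u). Qed.

Lemma continuous_dker : continuous (dker P rho).
Proof.
move=> u; apply: cvgN.
pose f (l y : R) := cutoff P rho y * (y * sin (y * l)).
have := @continuity_under_integral R _ _ mu f setT measurableT (u - 1) (u + 1) _ _
  (fun y => `|cutoff P rho y * y|).
apply.
- by move=> x _; apply: (integrable_cutoff n) => //; exact: continuous_sinlin.
- apply: aeW => y _ x _; apply: cvgM; first exact: cvg_cst.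
  apply: cvgM; first exact: cvg_cst.
  apply: (@continuous_comp _ _ _ (fun l : R => y * l) sin); last exact: continuous_sin.
  by apply: cvgM; [exact: cvg_cst|exact: cvg_id].
- apply: (@integrable_norm _ _ _ mu setT (fun y => cutoff P rho y * y)).
  by apply: (integrable_cutoff n) => // x; exact: cvg_id.
- move=> x _; apply: aeW => y _.
  by rewrite /f mulrA normrM ler_piMr// ler_norml sin_geN1 sin_le1.
- by apply/mem_set; rewrite /= in_itv/=; lra.
Qed.

Lemma integrable_ker : mu.-integrable setT (EFin \o ker P rho).
Proof.
have [ih _] := integrable_hump rho rho0.
apply: (le_integrable measurableT _ _ (integrableZl measurableT (4 * poly_bound P) ih)).
  by apply/measurable_EFinP; apply: continuous_measurable_fun; exact: continuous_ker.
move=> u _ /=; rewrite lee_fin.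
by apply: le_trans (ker_bounds n P hP rho u rho0 n2).1 (ler_norm _).
Qed.

Let c1 (y : R) : `|cos y| <= 1. Proof. by rewrite ler_norml cos_geN1 cos_le1. Qed.

(** By Fubini the damped mass of the kernel is the integral of the cutoff against the Poisson kernel
    [w], which concentrates at 0, where the cutoff is 1. On [[0, al]] alone [w] is at least [al^-1],
    so the positive half-line contributes at least 1; the error comes from the transition zone. *)
Lemma ker_abel (al : R) : 0 < al -> al <= rho / 2 ->
  2 * (1 - 4 * poly_bound P * al / rho) <= \int[mu]_u (expR (- al * `|u|) * ker P rho u).
Proof.
move=> a0 ar.
have A0 := poly_bound_ge1 n P hP.
pose E (u : R) := expR (- al * `|u|).
have mE : measurable_fun setT E.
  apply: continuous_measurable_fun => x.
  apply: (@continuous_comp _ _ _ (fun x : R => `|x|) (fun z => expR (- al * z))).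
    exact: norm_continuous.
  exact: continuous_expRM.
have EN x : E (- x) = E x by rewrite /E normrN.
have iE0 : mu.-integrable `[0, +oo[ (EFin \o E).
  have := integrable_expR al a0; apply: eq_integrable => // x.
  by rewrite inE/= in_itv/= andbT => x0; rewrite /E ger0_norm.
have iE := integrable_even E mE EN iE0.
have icut : mu.-integrable setT (EFin \o cutoff P rho).
  rewrite (_ : cutoff P rho = fun s => cutoff P rho s * cst 1 s).
    by apply: (integrable_cutoff n) => // x; exact: cvg_cst.
  by apply/funext => x /=; rewrite mulr1.
have mk : measurable_fun setT (fun z : R * R => cos (z.2 * z.1)).
  apply: measurableT_comp; first by apply: continuous_measurable_fun; exact: continuous_cos.
  by apply: measurable_funM; [exact: measurable_snd|exact: measurable_fst].
have inner s : \int[mu]_u (E u * cos (s * u)) = 2 * (al / (al ^+ 2 + s ^+ 2)).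
  have ig : mu.-integrable setT (EFin \o (fun u => E u * cos (s * u))).
    apply: (le_integrable measurableT _ _ iE).
      apply/measurable_EFinP; apply: measurable_funM => //.
      apply: measurableT_comp; first by apply: continuous_measurable_fun; exact: continuous_cos.
      exact: measurable_funM.
    by move=> x _ /=; rewrite lee_fin normrM ler_piMr.
  rewrite Rintegral_even// -(Rintegral_expcos al s a0) -RintegralZl//; last first.
    have := integrableTS _ _ (measurable_itv `[0%R, +oo[) ig.
    apply: eq_integrable => // x; rewrite inE/= in_itv/= andbT => x0.
    by rewrite /E ger0_norm// mulrC [s * x]mulrC mulrC.
  apply: eq_Rintegral => x; rewrite inE/= in_itv/= andbT => x0.
  by rewrite /E normrN ger0_norm// mulrN cosN [s * x]mulrC; ring.
have -> : \int[mu]_u (E u * ker P rho u) = \int[mu]_s (cutoff P rho s * (2 * (al / (al ^+ 2 + s ^+ 2)))).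
  rewrite /ker (Rfubini E (cutoff P rho) (fun u s => cos (s * u)) iE icut mk (fun _ _ => c1 _)).2.
  by apply: eq_Rintegral => s _; rewrite inner.
pose w s := 2 * (al / (al ^+ 2 + s ^+ 2)).
have d0 s : 0 < al ^+ 2 + s ^+ 2 by rewrite ltr_pwDl ?sqr_ge0// exprn_gt0.
have cw : continuous w.
  move=> x; apply: cvgM; first exact: cvg_cst.
  apply: cvgM; first exact: cvg_cst.
  apply: cvgV; first by rewrite gt_eqF.
  by apply: cvgD; [exact: cvg_cst|exact: exprn_continuous].
have icw := integrable_cutoff n P hP rho w rho0 cw.
rewrite Rintegral_even//.
have i0 : mu.-integrable `[0, +oo[ (EFin \o (fun s => cutoff P rho s * w s)) by exact: integrableS icw.
have -> : \int[mu]_(s in `[0, +oo[) (cutoff P rho s * w s + cutoff P rho (- s) * w (- s)) =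
   2 * \int[mu]_(s in `[0, +oo[) (cutoff P rho s * w s).
  rewrite -RintegralZl//; apply: eq_Rintegral => s _.
  by rewrite cutoffN /w sqrrN; ring.
rewrite ler_pM2l// (Rintegral_cutoff_half n)//.
have icw' a b : mu.-integrable `[a, b] (EFin \o w) by apply: integrable_itv => x _; exact: cw.
have L1 : 1 <= \int[mu]_(s in `[0, rho / 2]) w s.
  rewrite (Rintegral_itv_split _ 0 al _ (ltW a0) ar (icw' _ _)).
  have : 0 <= \int[mu]_(s in `[al, rho / 2]) w s.
    by apply: Rintegral_ge0 => s _; rewrite mulr_ge0// divr_ge0 ?ltW.
  have : \int[mu]_(s in `[0, al]) al^-1 <= \int[mu]_(s in `[0, al]) w s.
    apply: le_Rintegral => //; first by apply: integrable_itv => x _; exact: cvg_cst.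
    move=> s /=; rewrite in_itv/= => /andP[s0 sa].
    rewrite /w mulrA ler_pdivlMr// mulrC ler_pdivrMr//.
    have : s ^+ 2 <= al ^+ 2 by apply: lerXn2r; rewrite ?nnegrE//; exact: ltW.
    by rewrite -mulrA -expr2; lra.
  rewrite Rintegral_cst//= lebesgue_measure_itv/= lte_fin a0 /= subr0 mulVf ?gt_eqF// => h1 h2.
  by apply: le_trans h1 _; rewrite lerDl.
have L2 : `|\int[mu]_(s in `[rho / 2, rho]) (qfall P rho 0 s * w s)| <= 4 * poly_bound P * al / rho.
  have cq : forall x, rho / 2 <= x <= rho -> {for x, continuous (fun s => qfall P rho 0 s * w s)}.
    by move=> x _; apply: cvgM; [exact: is_derive_continuous_at (is_derive_qfall _ _ _ _)|exact: cw].
  have iq := integrable_itv _ _ _ cq.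
  apply: le_trans (le_normr_Rintegral _ _) _ => //.
  apply: (@le_trans _ _ (\int[mu]_(s in `[rho / 2, rho]) (poly_bound P * (8 * al / rho ^+ 2)))).
    apply: le_Rintegral => //; first exact: integrable_norm iq.
      by apply: integrable_itv => x _; exact: cvg_cst.
    move=> s /=; rewrite in_itv/= => /andP[s0 sa]; rewrite normrM; apply: ler_pM => //.
      have := qfall_le P rho rho0 0 s; rewrite expr0 invr1 mulr1; apply.
      by apply/andP; split => //; lra.
    rewrite ger0_norm /w; last by rewrite mulr_ge0// divr_ge0 ?ltW.
    rewrite mulrA ler_pdivrMr// mulrAC ler_pdivlMr ?exprn_gt0//.
    have : (rho / 2) ^+ 2 <= s ^+ 2 by apply: lerXn2r; rewrite ?nnegrE//; lra.
    rewrite expr_div_n; have := sqr_ge0 al; nra.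
  rewrite Rintegral_cst//= lebesgue_measure_itv/= lte_fin ifT; last lra.
  by rewrite le_eqVlt; apply/orP; left; apply/eqP; rewrite /=; field; rewrite gt_eqF.
by apply: lerD => //; move: L2; rewrite ler_norml => /andP[].
Qed.

(** The limit of [ker_abel] as the damping vanishes. Fourier inversion would give [2 * pi]; a
    positive lower bound free of [rho] serves as well. *)
Lemma ker_mass : 2 <= \int[mu]_u ker P rho u.
Proof.
pose al k : R := k.+1%:R^-1.
have al0 k : 0 < al k by rewrite invr_gt0.
have alc : al k @[k --> \oo] --> (0 : R) by exact: cvg_harmonic.
have [//||||||_ cv] := @Rintegral_cvg R setT (fun k u => expR (- al k * `|u|) * ker P rho u) (ker P rho)
   (fun u => `|ker P rho u|).
- move=> k; apply: continuous_measurable_fun => x; apply: cvgM; last exact: continuous_ker.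
  apply: (@continuous_comp _ _ _ (fun x : R => `|x|) (fun z => expR (- al k * z))).
    exact: norm_continuous.
  exact: continuous_expRM.
- by apply: continuous_measurable_fun; exact: continuous_ker.
- exact: (integrable_norm integrable_ker).
- move=> x _; rewrite -[X in _ --> X]mul1r; apply: cvgM; last exact: cvg_cst.
  rewrite -expR0; apply: (@cvg_comp _ _ _ (fun k => - al k * `|x|) expR); last exact: continuous_expR.
  by rewrite -(mul0r `|x|) -oppr0; apply: cvgM; [exact: cvgN|exact: cvg_cst].
- move=> k x _; rewrite normrM ler_piMl// ger0_norm ?expR_ge0// -expR0 ler_expR.
  by rewrite mulNr oppr_le0 mulr_ge0// ltW.
have lim2 : 2 * (1 - 4 * poly_bound P * al k / rho) @[k --> \oo] --> (2 : R).
  rewrite -[X in _ --> X](_ : 2 * (1 - 4 * poly_bound P * 0 / rho) = 2); last by rewrite mulr0 mul0r subr0 mulr1.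
  apply: cvgM; first exact: cvg_cst.
  apply: cvgB; first exact: cvg_cst.
  apply: cvgM; last exact: cvg_cst.
  by apply: cvgM; first exact: cvg_cst.
rewrite -(cvg_lim _ lim2)// -(cvg_lim _ cv)//.
apply: ler_lim; [by apply/cvg_ex; eexists; exact: lim2|by apply/cvg_ex; eexists; exact: cv|].
have r2 : 0 < rho / 2 by rewrite divr_gt0.
have /cvgrPdist_lt /(_ _ r2) := alc.
apply: filterS => k; rewrite sub0r normrN (gtr0_norm (al0 k)) => h.
by apply: ker_abel => //; exact: ltW.
Qed.

End Fixed.
End KernelMass.

(** * The Laplace transform on vertical lines *)

Section Functionals.
Context {R : realType} {X : normedModType R[i]}.
Local Notation mu := (@lebesgue_measure R).
Implicit Types (l : X -> R).

Lemma rfunZ B l (c : R[i]) x : rfunctional B l ->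
  l (c *: x) = complex.Re c * l x + complex.Im c * l ('i%C *: x).
Proof. by move=> [lD lZ _]; rewrite scale_ReIm lD !lZ. Qed.

Lemma cos_lip (x y : R) : `|cos x - cos y| <= `|x - y|.
Proof.
wlog xy : x y / x <= y.
  move=> h; case: (leP x y) => [|/ltW]; first exact: h.
  by rewrite (distrC (cos x)) (distrC x); exact: h.
have [|c] := @MVT_segment R cos (fun z => - sin z) x y xy.
  by apply: continuous_subspaceT => z; exact: continuous_cos.
move=> _ e; rewrite distrC e distrC normrM ler_piMl//.
by rewrite normrN ler_norml sin_geN1 sin_le1.
Qed.

Lemma sin_lip (x y : R) : `|sin x - sin y| <= `|x - y|.
Proof.
by rewrite !sin_shift; apply: le_trans (cos_lip _ _) _; rewrite opprD addrACA subrr addr0.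
Qed.

Lemma lip_continuous (g : R -> R) (L : R) : (forall s t, `|g t - g s| <= L * `|t - s|) -> continuous g.
Proof.
move=> hL x; apply/cvgrPdist_lt => e e0.
have L0 : 0 < Num.max L 1 by rewrite lt_max ltr01 orbT.
near=> y.
apply: le_lt_trans (hL _ _) _.
apply: (@le_lt_trans _ _ (Num.max L 1 * `|x - y|)).
  by apply: ler_wpM2r => //; rewrite le_max lexx.
rewrite -ltr_pdivlMl//; near: y.
apply/nbhs_ballP; exists ((Num.max L 1)^-1 * e) => /=; first by rewrite mulr_gt0// invr_gt0.
by move=> z; exact.
Unshelve. all: by end_near. Qed.

Lemma nneg_itv : [set t : R | 0 <= t] = `[0, +oo[%classic.
Proof. by apply/seteqP; split => t /=; rewrite in_itv/= andbT. Qed.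

Lemma cexpE (al s tau : R) : cexp (- ((tau%:C)%C * Complex al s)) =
  Complex (expR (- al * tau) * cos (s * tau)) (- (expR (- al * tau) * sin (s * tau))).
Proof.
rewrite /cexp /= !mul0r subr0 addr0 cosN sinN mulrN.
by rewrite mulNr [al * _]mulrC [s * _]mulrC.
Qed.

Lemma continuous_sinM u : continuous (fun s : R => sin (s * u)).
Proof.
move=> x; apply: (@continuous_comp _ _ _ (fun s : R => s * u) sin); last exact: continuous_sin.
by apply: cvgM; [exact: cvg_id|exact: cvg_cst].
Qed.

End Functionals.

Section Laplace.
Context {R : realType} {X : completeNormedModType R[i]}.
Local Notation mu := (@lebesgue_measure R).
Variables (f : R -> X) (B L : R).
Hypothesis fB : forall t, 0 <= t -> nrm (f t) <= B.
Hypothesis fL : forall s t, 0 <= s -> 0 <= t -> nrm (f t - f s) <= L * `|t - s|.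

Lemma bound_ge0 : 0 <= B.
Proof. by apply: le_trans (nrm_ge0 (f 0)) _; exact: fB. Qed.

(** On [[0, N]] the integrand is a continuous bounded scalar times a Lipschitz function. Beyond [N]
    the damping is split into two equal factors [E]: one is small there and the other is
    integrable. *)
Lemma bapprox_laplace (al s : R) : 0 < al ->
  bapprox (`[0, +oo[%classic : set R) (fun tau => cexp (- ((tau%:C)%C * Complex al s)) *: f tau).
Proof.
move=> a0; have B0 := bound_ge0.
have a20 : 0 < al / 2 by rewrite divr_gt0.
pose E tau := expR (- (al / 2) * tau).
have E2 tau : expR (- al * tau) = E tau * E tau.
  by rewrite /E -expRD; congr expR; field.
have mE : measurable_fun (`[0, +oo[%classic : set R) E.
  by apply: measurable_funTS; apply: continuous_measurable_fun; exact: continuous_expRM.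
apply: bapprox_near => [|e e0]; first exact: measurable_itv.
pose M := 4 * (B + 1) / al.
have M0 : 0 < M by rewrite divr_gt0// mulr_gt0//; lra.
have eM0 : 0 < e / M by rewrite divr_gt0.
have [N [N0 hN]] : exists N : R, 0 <= N /\ E N <= e / M.
  have /cvgrPdist_lt /(_ _ eM0) := cvg_expRM (al / 2) a20.
  move=> [N [_ hN]]; exists (Num.max N 0 + 1).
  have N1 : N < Num.max N 0 + 1 by rewrite ltr_pwDr// le_max lexx.
  split; first by rewrite addr_ge0// le_max lexx orbT.
  by have := hN _ N1; rewrite sub0r normrN ger0_norm ?expR_ge0// => /ltW.
pose c tau := cexp (- ((tau%:C)%C * Complex al s)).
pose c' tau := if tau <= N then c tau else 0.
exists (fun tau => c' tau *: f tau), (fun tau => (2 * B * E N * E tau)%:E); split.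
  have cre : continuous (fun t => complex.Re (c t)).
    rewrite (_ : (fun t => _) = (fun t => expR (- al * t) * cos (t * s))).
      by move=> x; apply: cvgM; [exact: continuous_expRM|exact: continuous_coslin].
    by apply/funext => t; rewrite /c cexpE /= [s * t]mulrC.
  have cim : continuous (fun t => complex.Im (c t)).
    rewrite (_ : (fun t => _) = (fun t => - (expR (- al * t) * sin (t * s)))).
      by move=> x; apply: cvgN; apply: cvgM; [exact: continuous_expRM|exact: continuous_sinM].
    by apply/funext => t; rewrite /c cexpE /= [s * t]mulrC.
  apply: (bapprox_mul _ `[0, N] _ _ 1) => //.
  - by apply: subset_itvl; rewrite bnd_simp.
  - apply: (eq_measurable_fun (fun t => complex.Re (c t))).
      by move=> t; rewrite inE/= in_itv/= => /andP[_ tN]; rewrite /c' tN.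
    by apply: measurable_funTS; exact: continuous_measurable_fun.
  - apply: (eq_measurable_fun (fun t => complex.Im (c t))).
      by move=> t; rewrite inE/= in_itv/= => /andP[_ tN]; rewrite /c' tN.
    by apply: measurable_funTS; exact: continuous_measurable_fun.
  - move=> t /=; rewrite in_itv/= => /andP[t0 tN]; rewrite /c' tN /c cexpE /=.
    have e1 : expR (- al * t) <= 1 by rewrite -expR0 ler_expR mulNr oppr_le0 mulr_ge0// ltW.
    rewrite normrN !normrM (ger0_norm (expR_ge0 _)).
    split; apply: mulr_ile1 => //; rewrite ?expR_ge0//.
      by rewrite ler_norml cos_geN1 cos_le1.
    by rewrite ler_norml sin_geN1 sin_le1.
  - move=> t /=; rewrite !in_itv/= andbT => t0; rewrite t0 /= => /negP.
    by rewrite /c' => /negbTE ->.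
  - apply: (bapprox_lip _ _ L) => // u v /andP[u0 _] /andP[v0 _]; exact: fL.
split.
- by apply/measurable_EFinP; apply: measurable_funM.
- move=> t /=; rewrite in_itv/= andbT => t0; rewrite lee_fin -scalerBl /c'.
  have EE : 0 <= E N * E t by rewrite mulr_ge0// expR_ge0.
  case: (leP t N) => [tN|Nt].
    by rewrite /c subrr scale0r nrm0 -mulrA; apply: mulr_ge0 => //; exact: mulr_ge0.
  rewrite subr0; apply: le_trans (nrmZ_le _ _) _.
  rewrite /c cexpE /= normrN !normrM (ger0_norm (expR_ge0 _)) E2.
  have EtN : E t <= E N.
    by rewrite ler_expR !mulNr lerN2 ler_pM2l// ltW.
  have cs : `|cos (s * t)| + `|sin (s * t)| <= 2.
    by apply: lerD; rewrite ler_norml ?cos_geN1 ?cos_le1 ?sin_geN1 ?sin_le1.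
  rewrite -mulrDr.
  apply: (@le_trans _ _ (E N * E t * 2 * B)); last by rewrite le_eqVlt; apply/orP; left; apply/eqP; ring.
  apply: ler_pM; rewrite ?nrm_ge0//; [by rewrite mulr_ge0 ?addr_ge0// mulr_ge0 ?expR_ge0| |exact: fB].
  apply: ler_pM; rewrite ?addr_ge0// ?mulr_ge0 ?expR_ge0//.
  by apply: ler_wpM2r => //; exact: expR_ge0.
- under eq_integral do rewrite EFinM.
  have e0' t : (0 <= (E t)%:E)%E by rewrite lee_fin expR_ge0.
  rewrite ge0_integralZl//; last 2 first.
  + by apply/measurable_EFinP.
  + by rewrite lee_fin mulr_ge0 ?expR_ge0// mulr_ge0.
  rewrite /E integral_expR// -EFinM lee_fin.
  rewrite (_ : 2 * B * _ / _ = 4 * B / al * E N); last by rewrite /E; field; rewrite gt_eqF.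
  apply: (@le_trans _ _ (M * (e / M))); last by rewrite mulrC divfK// gt_eqF.
  apply: ler_pM => //.
  + by apply: divr_ge0; [exact: mulr_ge0|exact: ltW].
  + exact: expR_ge0.
  + by rewrite /M ler_pM2r ?invr_gt0// ler_pM2l// lerDl.
Qed.

End Laplace.

Section LaplaceFun.
Context {R : realType} {X : completeNormedModType R[i]}.
Local Notation mu := (@lebesgue_measure R).
Variables (f : R -> X) (B L : R).
Hypothesis fB : forall t, 0 <= t -> nrm (f t) <= B.
Hypothesis fL : forall s t, 0 <= s -> 0 <= t -> nrm (f t - f s) <= L * `|t - s|.
Implicit Types (l : X -> R).

(** Extending [f] by its value at 0 keeps the scalar function Lipschitz on the whole line, so
    continuity and derivatives at 0 are two-sided. *)
Definition part l (tau : R) : R := l (f (Num.max tau 0)).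

Lemma part_pos l tau : 0 <= tau -> part l tau = l (f tau).
Proof. by move=> t0; rewrite /part max_l. Qed.

Lemma part_le B' l tau : 0 <= B' -> rfunctional B' l -> `|part l tau| <= B' * B.
Proof.
move=> B0 [_ _ h]; apply: le_trans (h _) _; apply: ler_wpM2l => //.
by apply: fB; rewrite le_max lexx orbT.
Qed.

Lemma part_lip B' l s t : 0 <= B' -> rfunctional B' l -> `|part l t - part l s| <= B' * L * `|t - s|.
Proof.
move=> B0 hl; rewrite /part -(rfunB _ _ _ _ hl).
case: hl => _ _ h; apply: le_trans (h _) _; rewrite -mulrA; apply: ler_wpM2l => //.
have L0 : 0 <= L.
  by have := fL 0 1 (lexx 0) ler01; rewrite subr0 normr1 mulr1; apply: le_trans; exact: nrm_ge0.
apply: le_trans (fL _ _ _ _) _; rewrite ?le_max ?lexx ?orbT//.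
apply: ler_wpM2l => //; rewrite !maxr_absE !addr0 !subr0 -mulrBl.
rewrite (_ : t + _ - _ = (t - s) + (`|t| - `|s|)); last by ring.
have h1 := ler_normD (t - s) (`|t| - `|s|); have h2 := ler_dist_dist t s.
rewrite normrM (ger0_norm (_ : 0 <= 2^-1)); lra.
Qed.

Lemma continuous_part B' l : 0 <= B' -> rfunctional B' l -> continuous (part l).
Proof. by move=> B0 hl; apply: (lip_continuous _ (B' * L)) => s t; exact: part_lip. Qed.

Lemma rfunctional_i B' l : rfunctional B' l -> rfunctional B' (fun x => l ('i%C *: x)).
Proof.
move=> [lD lZ lB]; split=> [x y|a x|x].
- by rewrite scalerDr lD.
- by rewrite -lZ /rscale !scalerA mulrC.
- by apply: le_trans (lB _) _; rewrite nrmi.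
Qed.

Definition lapint l (al s tau : R) : R := expR (- al * tau) *
  (part l tau * cos (s * tau) - part (fun x => l ('i%C *: x)) tau * sin (s * tau)).

Lemma rfun_laplace B' l al s : 0 <= B' -> rfunctional B' l -> 0 < al ->
  mu.-integrable `[0, +oo[ (EFin \o lapint l al s) /\
  l (laplace f (Complex al s)) = \int[mu]_(tau in `[0, +oo[) lapint l al s tau.
Proof.
move=> B0 hl a0.
have hap := bapprox_laplace f B L fB fL al s a0.
have hE tau : 0 <= tau -> l (cexp (- ((tau%:C)%C * Complex al s)) *: f tau) = lapint l al s tau.
  move=> t0; rewrite (rfunZ _ _ _ _ hl) cexpE /= /lapint !part_pos//; ring.
have cl : continuous (lapint l al s).
  move=> x; apply: cvgM; first exact: continuous_expRM.
  have [cc cs] : continuous (fun tau => cos (s * tau)) /\ continuous (fun tau => sin (s * tau)).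
    by split; under eq_fun do rewrite mulrC; [exact: continuous_coslin|exact: continuous_sinM].
  apply: cvgB; apply: cvgM; [exact: (continuous_part B')|exact: cc| |exact: cs].
  by apply: (continuous_part B') => //; exact: rfunctional_i.
have mI : measurable (`[0, +oo[%classic : set R) by exact: measurable_itv.
have ml : measurable_fun (`[0, +oo[%classic : set R) (l \o (fun tau => cexp (- ((tau%:C)%C * Complex al s)) *: f tau)).
  apply: (eq_measurable_fun (lapint l al s)).
    by move=> tau; rewrite inE/= in_itv/= andbT => t0; rewrite hE.
  by apply: measurable_funTS; exact: continuous_measurable_fun.
have [i e] := rfun_bintegral _ _ _ _ mI hap hl ml.
split.
  apply: eq_integrable i => // tau; rewrite inE/= in_itv/= andbT => t0 /=.
  by rewrite hE.
rewrite /laplace nneg_itv e; apply: eq_Rintegral => tau; rewrite inE/= in_itv/= andbT => t0.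
by rewrite hE.
Qed.

(** Regularity along a vertical line makes the transform Bochner integrable over bounded intervals,
    by [bapprox_lip]. Half of the damping absorbs the factor [tau] produced by differences of
    cosines and sines. *)
Lemma laplace_lip al s s' : 0 < al ->
  nrm (laplace f (Complex al s) - laplace f (Complex al s')) <= 8 * B / al ^+ 2 * `|s - s'|.
Proof.
move=> a0; have [l [hl <-]] := hahn_banach_norming (laplace f (Complex al s) - laplace f (Complex al s')).
have B0 := bound_ge0 f B fB.
have a20 : 0 < al / 2 by rewrite divr_gt0.
rewrite (rfunB _ _ _ _ hl).
have [i1 ->] := rfun_laplace 1 l al s ler01 hl a0.
have [i2 ->] := rfun_laplace 1 l al s' ler01 hl a0.
rewrite -RintegralB//.
have iE := integrable_expR (al / 2) a20.
have mI : measurable (`[0, +oo[%classic : set (measurableTypeR R)) by exact: measurable_itv.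
pose c := 4 * B / al * `|s - s'|.
apply: (@le_trans _ _ (\int[mu]_(tau in `[0, +oo[) (c * expR (- (al / 2) * tau)))).
  apply: le_Rintegral => //.
  - exact: (integrableB mI i1 i2).
  - exact: (integrableZl mI c iE).
  move=> tau /=; rewrite in_itv/= andbT => t0.
  rewrite /lapint -mulrBr.
  set p := part l tau; set q := part _ tau.
  have pB : `|p| <= B by have := part_le 1 l tau ler01 hl; rewrite mul1r.
  have qB : `|q| <= B by have := part_le 1 _ tau ler01 (rfunctional_i _ _ hl); rewrite mul1r.
  have dc : `|cos (s * tau) - cos (s' * tau)| <= `|s - s'| * tau.
    by apply: le_trans (cos_lip _ _) _; rewrite -mulrBl normrM (ger0_norm t0).
  have ds : `|sin (s * tau) - sin (s' * tau)| <= `|s - s'| * tau.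
    by apply: le_trans (sin_lip _ _) _; rewrite -mulrBl normrM (ger0_norm t0).
  have -> : p * cos (s * tau) - q * sin (s * tau) - (p * cos (s' * tau) - q * sin (s' * tau)) =
    p * (cos (s * tau) - cos (s' * tau)) - q * (sin (s * tau) - sin (s' * tau)) by ring.
  have h1 : p * (cos (s * tau) - cos (s' * tau)) - q * (sin (s * tau) - sin (s' * tau)) <=
      2 * B * (`|s - s'| * tau).
    apply: le_trans (ler_norm _) _; apply: le_trans (ler_normB _ _) _; rewrite !normrM.
    by rewrite -mulrA mulr_natl mulr2n; apply: lerD; apply: ler_pM.
  apply: le_trans (ler_wpM2l (expR_ge0 _) h1) _.
  have -> : expR (- al * tau) = expR (- (al / 2) * tau) * expR (- (al / 2) * tau).
    by rewrite -expRD; congr expR; field.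
  (* From [1 + x <= expR x] at [x = al / 2 * tau]. *)
  have h2 : expR (- (al / 2) * tau) * tau <= 2 / al.
    have := expR_ge1Dx (al / 2 * tau) => h3.
    rewrite mulNr expRN mulrC ler_pdivrMr ?expR_gt0//.
    apply: (@le_trans _ _ (2 / al * (1 + al / 2 * tau))); last first.
      by apply: ler_wpM2l => //; rewrite divr_ge0// ltW.
    rewrite mulrDr mulr1 (_ : 2 / al * (al / 2 * tau) = tau); last by field; rewrite gt_eqF.
    by rewrite lerDr divr_ge0// ltW.
  set E := expR (- (al / 2) * tau) in h2 *.
  have E0 : 0 <= E by exact: expR_ge0.
  have -> : E * E * (2 * B * (`|s - s'| * tau)) = (2 * B * `|s - s'| * E) * (E * tau) by ring.
  have -> : c * E = (2 * B * `|s - s'| * E) * (2 / al) by rewrite /c; field; rewrite gt_eqF.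
  by apply: ler_wpM2l => //; rewrite mulr_ge0// mulr_ge0// mulr_ge0.
rewrite RintegralZl// /Rintegral integral_expR//= /c.
by rewrite le_eqVlt; apply/orP; left; apply/eqP; field; rewrite gt_eqF.
Qed.

End LaplaceFun.

Section ComplexContinuity.
Context {R : realType}.
Local Notation C := (R[i] : numFieldType).

Lemma continuous_Complex (u v : R -> R) : continuous u -> continuous v ->
  continuous ((fun s => Complex (u s) (v s)) : R -> C).
Proof.
move=> cu cv s; apply/cvgrPdist_lt => -[e e'].
rewrite ltcE /= => /andP[/eqP -> e0].
have e20 : 0 < e / 2 by rewrite divr_gt0.
have /cvgrPdist_lt /(_ _ e20) hu := cu s; have /cvgrPdist_lt /(_ _ e20) hv := cv s.
near=> x.
have h1 : `|u s - u x| < e / 2 by near: x.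
have h2 : `|v s - v x| < e / 2 by near: x.
rewrite normc_def ltcR /=.
apply: (@le_lt_trans _ _ (Num.sqrt ((`|u s - u x| + `|v s - v x|) ^+ 2))).
  apply: ler_wsqrtr; rewrite -(real_normK (num_real (u s - u x))) -(real_normK (num_real (v s - v x))).
  rewrite sqrrD addrAC lerDl mulrn_wge0// mulr_ge0//.
rewrite sqrtr_sqr ger0_norm ?addr_ge0//; lra.
Unshelve. all: by end_near. Qed.

End ComplexContinuity.

(** * Convolution representation of the integral over a band *)

Section Representation.
Context {R : realType} {X : completeNormedModType R[i]}.
Local Notation mu := (@lebesgue_measure R).
Variables (f : R -> X) (B L : R).
Hypothesis fB : forall t, 0 <= t -> nrm (f t) <= B.
Hypothesis fL : forall s t, 0 <= s -> 0 <= t -> nrm (f t - f s) <= L * `|t - s|.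
Variable F : R -> X.
Hypothesis F1 : L1loc_punct F.
Hypothesis bF : boundary_function f F.
Variables (h : R -> R) (r0 R0 : R).
Hypotheses (r00 : 0 < r0) (rR0 : r0 <= R0).
Hypothesis ch : continuous h.
Hypothesis hN : forall s, h (- s) = h s.
Hypothesis hin : forall s, `|s| <= r0 -> h s = 0.
Hypothesis hout : forall s, R0 <= `|s| -> h s = 0.
Implicit Types (l : X -> R).

(* [h s * exp (i s t)] *)
Definition psi (t s : R) : R[i] := Complex (h s * cos (s * t)) (h s * sin (s * t)).

Let K : set R := [set s | r0 <= `|s| <= R0].

Let KE : K = `[- R0, - r0] `|` `[r0, R0].
Proof.
apply/seteqP; split => s; rewrite /K /= !in_itv/=.
  by case: (ger0P s) => s0 hs; [right|left]; lra.
by case=> hs; have h1 := r00; have h2 := rR0; case: (ger0P s) => s0; lra.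
Qed.

Let cK : compact K.
Proof. by rewrite KE; apply: compactU; exact: segment_compact. Qed.

Let mK : measurable K.
Proof. by rewrite KE; apply: measurableU; exact: measurable_itv. Qed.

Let K0 : K `<=` ~` [set 0].
Proof. by move=> s /andP[h1 _] /= s0; move: h1; rewrite s0 normr0 leNgt r00. Qed.

Let h0 s : ~ K s -> h s = 0.
Proof.
move=> nK; have [hs|hs] := leP `|s| r0; first exact: hin.
have [hs2|hs2] := leP R0 `|s|; first exact: hout.
by exfalso; apply: nK; rewrite /K /= !ltW.
Qed.

Let ccos t : continuous (fun s => h s * cos (s * t)).
Proof. by move=> s; apply: cvgM; [exact: ch|exact: continuous_coslin]. Qed.

Let csin t : continuous (fun s => h s * sin (s * t)).
Proof. by move=> s; apply: cvgM; [exact: ch|exact: continuous_sinM]. Qed.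

Lemma psi_Cc t : Cc_punct (psi t).
Proof.
split; first by apply: continuous_subspaceT; exact: continuous_Complex.
by exists K; split => // s nK; rewrite /psi h0// !mul0r.
Qed.

Lemma h_bounded : exists H : R, 0 <= H /\ forall s, `|h s| <= H.
Proof.
have /compact_bounded[M [_ hM]] := continuous_compact (continuous_subspaceT ch) cK.
exists (Num.max M 0 + 1); split; first by rewrite addr_ge0// le_max lexx orbT.
move=> s; have [Ks|nK] := pselect (K s); last by rewrite h0// normr0 addr_ge0// le_max lexx orbT.
by apply: (hM (Num.max M 0 + 1)); [rewrite ltr_pwDr// le_max lexx|exists s].
Qed.

Let psi_bound H t s : 0 <= H -> (forall s, `|h s| <= H) ->
  `|complex.Re (psi t s)| <= H /\ `|complex.Im (psi t s)| <= H.
Proof.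
move=> H0 hH; rewrite /psi /= !normrM; split; rewrite -[H]mulr1; apply: ler_pM => //.
  by rewrite ler_norml cos_geN1 cos_le1.
by rewrite ler_norml sin_geN1 sin_le1.
Qed.

Lemma bapprox_F_K : bapprox K F.
Proof.
by have [v hv] := F1 K cK K0; apply: bint_approx; apply: bochner_bint hv.
Qed.

Lemma bapprox_psi (G : R -> X) (A : set R) t : measurable A -> K `<=` A -> bapprox A G ->
  bapprox setT (fun s => psi t s *: G s).
Proof.
move=> mA KA hG; have [H [H0 hH]] := h_bounded.
apply: (bapprox_mul setT A _ _ H) => //.
- by apply: measurable_funTS; apply: continuous_measurable_fun; exact: (ccos t).
- by apply: measurable_funTS; apply: continuous_measurable_fun; exact: (csin t).
- by move=> s _; exact: psi_bound.
- by move=> s _ nA; rewrite /psi h0 ?mul0r// => /KA.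
Qed.

Lemma bapprox_psiF t : bapprox setT (fun s => psi t s *: F s).
Proof. by apply: (bapprox_psi _ K) => //; exact: bapprox_F_K. Qed.

Lemma bapprox_psilap al t : 0 < al ->
  bapprox setT (fun s => psi t s *: laplace f (Complex al s)).
Proof.
move=> a0; apply: (bapprox_psi _ `[- R0, R0]) => //.
- by have h1 := r00; have h2 := rR0; move=> s; rewrite KE /= !in_itv/=; case; lra.
- apply: (bapprox_lip _ _ (8 * B / al ^+ 2)) => [|s t' _ _]; first by have h1 := r00; have h2 := rR0; lra.
  exact: (laplace_lip f B L fB fL).
Qed.

Let Phi u := \int[mu]_s (h s * cos (s * u)).
Hypothesis iPhi : mu.-integrable setT (EFin \o Phi).
Hypothesis cPhi : continuous Phi.

Let ih : mu.-integrable setT (EFin \o h).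
Proof.
apply: (integrable_support _ K) => //; first exact: continuous_subspaceT.
Qed.

Lemma sin_part_eq0 u : \int[mu]_s (h s * sin (s * u)) = 0.
Proof.
have i : mu.-integrable setT (EFin \o (fun s => h s * sin (s * u))).
  apply: (integrable_support _ K) => //; first by apply: continuous_subspaceT; exact: csin.
  by move=> s nK; rewrite h0// mul0r.
rewrite Rintegral_even//.
have -> : \int[mu]_(s in `[0, +oo[) (h s * sin (s * u) + h (- s) * sin (- s * u)) = \int[mu]_(s in `[0, +oo[) 0.
  by apply: eq_Rintegral => s _; rewrite hN mulNr sinN mulrN subrr.
by rewrite Rintegral_cst//= mul0r.
Qed.

Let damp al (g : R -> R) : R -> R := (fun tau => expR (- al * tau) * g tau) \_ `[0, +oo[.

Let idamp al g (M : R) : 0 < al -> continuous g -> (forall x, `|g x| <= M) ->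
  mu.-integrable setT (EFin \o damp al g).
Proof.
move=> a0 cg gM.
have mI : measurable (`[0, +oo[%classic : set (measurableTypeR R)) by exact: measurable_itv.
have : mu.-integrable `[0, +oo[ (EFin \o (fun tau => expR (- al * tau) * g tau)).
  apply: (le_integrable mI _ _ (integrableZl mI M (integrable_expR al a0))).
    apply/measurable_EFinP; apply: measurable_funTS; apply: continuous_measurable_fun => x.
    by apply: cvgM; [exact: continuous_expRM|exact: cg].
  move=> x _ /=; rewrite lee_fin !normrM mulrC; apply: ler_wpM2r => //.
  by apply: le_trans (gM x) (ler_norm _).
by move=> /(integrable_mkcond _ mI); rewrite restrict_EFin.
Qed.

Let mlin t : measurable_fun setT (fun z : R * R => z.1 * (t - z.2)).
Proof.
apply: measurable_funM; first exact: measurable_fst.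
by apply: measurable_funB => //; exact: measurable_snd.
Qed.

(** The addition formulas merge the phases [s t] and [s tau] into cosine and sine of
    [s * (t - tau)], with amplitudes [l (f tau)] and [l ('i *: f tau)]. After Fubini the sine part
    vanishes because [h] is even, and the cosine part produces [Phi (t - tau)]. *)
Lemma laplace_side B' l al t : 0 <= B' -> rfunctional B' l -> 0 < al ->
  l (bintegral setT (fun s => psi t s *: laplace f (Complex al s))) =
  \int[mu]_(tau in `[0, +oo[) (expR (- al * tau) * part f l tau * Phi (t - tau)).
Proof.
move=> B0 hl a0.
have B00 := bound_ge0 f B fB.
pose li x := l ('i%C *: x).
have hli : rfunctional B' li := rfunctional_i _ _ hl.
pose a := part f l; pose b := part f li.
have ca : continuous a := continuous_part f L fL B' l B0 hl.
have cb : continuous b := continuous_part f L fL B' li B0 hli.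
have aM x : `|a x| <= B' * B := part_le f B fB B' l x B0 hl.
have bM x : `|b x| <= B' * B := part_le f B fB B' li x B0 hli.
have mI : measurable (`[0, +oo[%classic : set (measurableTypeR R)) by exact: measurable_itv.
have ia := idamp al a _ a0 ca aM; have ib := idamp al b _ a0 cb bM.
have clap l' : rfunctional B' l' -> continuous (fun s => l' (laplace f (Complex al s))).
  move=> hl'; apply: (lip_continuous _ (B' * (8 * B / al ^+ 2))) => s s'.
  rewrite -(rfunB _ _ _ _ hl'); case: hl' => _ _ lB; apply: le_trans (lB _) _.
  by rewrite -[leRHS]mulrA; apply: ler_wpM2l => //; exact: (laplace_lip f B L fB fL).
pose g s := l (psi t s *: laplace f (Complex al s)).
have gE s : g s = h s * cos (s * t) * l (laplace f (Complex al s)) + h s * sin (s * t) * li (laplace f (Complex al s)).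
  by rewrite /g (rfunZ _ _ _ _ hl).
have mg : measurable_fun setT g.
  apply: continuous_measurable_fun => s.
  rewrite (_ : g = (fun s => h s * cos (s * t) * l (laplace f (Complex al s)) + h s * sin (s * t) * li (laplace f (Complex al s)))); last by apply/funext.
  by apply: cvgD; apply: cvgM; [exact: ccos|exact: clap|exact: csin|exact: clap].
have [_ ->] := rfun_bintegral _ _ _ _ measurableT (bapprox_psilap al t a0) hl mg.
have ccosr s : continuous (fun tau : R => cos (s * (t - tau))).
  move=> x; apply: (@continuous_comp _ _ _ (fun tau : R => s * (t - tau)) cos); last exact: continuous_cos.
  by apply: cvgM; [exact: cvg_cst|apply: cvgB; [exact: cvg_cst|exact: cvg_id]].
have csinr s : continuous (fun tau : R => sin (s * (t - tau))).
  move=> x; apply: (@continuous_comp _ _ _ (fun tau : R => s * (t - tau)) sin); last exact: continuous_sin.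
  by apply: cvgM; [exact: cvg_cst|apply: cvgB; [exact: cvg_cst|exact: cvg_id]].
have gI s : g s = h s * \int[mu]_tau (damp al a tau * cos (s * (t - tau))) +
    h s * \int[mu]_tau (damp al b tau * sin (s * (t - tau))).
  have [i1 e1] := rfun_laplace f B L fB fL B' l al s B0 hl a0.
  have [i2 e2] := rfun_laplace f B L fB fL B' li al s B0 hli a0.
  have ic : mu.-integrable setT (EFin \o (fun tau => damp al a tau * cos (s * (t - tau)))).
    apply: (le_integrable measurableT _ _ ia).
      apply/measurable_EFinP; apply: measurable_funM; last exact: continuous_measurable_fun.
      by apply/measurable_EFinP; case/integrableP: ia.
    by move=> x _ /=; rewrite lee_fin normrM ler_piMr// ler_norml cos_geN1 cos_le1.
  have is_ : mu.-integrable setT (EFin \o (fun tau => damp al b tau * sin (s * (t - tau)))).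
    apply: (le_integrable measurableT _ _ ib).
      apply/measurable_EFinP; apply: measurable_funM; last exact: continuous_measurable_fun.
      by apply/measurable_EFinP; case/integrableP: ib.
    by move=> x _ /=; rewrite lee_fin normrM ler_piMr// ler_norml sin_geN1 sin_le1.
  rewrite gE -mulrDr -RintegralD// -!mulrA -mulrDr; congr (_ * _).
  rewrite e1 e2 -RintegralZl// -RintegralZl// -RintegralD//; last 2 first.
  - exact: (integrableZl mI (cos (s * t)) i1).
  - exact: (integrableZl mI (sin (s * t)) i2).
  rewrite Rintegral_mkcond; apply: eq_Rintegral => tau _.
  rewrite /damp !patchE; case: ifP => _; last by rewrite !mul0r addr0.
  rewrite /lapint -/li /a /b (mulrBr s) cosB sinB.
  (* Rotating by ['i] twice changes the sign of the functional. *)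
  have -> : part f (fun x => li ('i%C *: x)) tau = - part f l tau.
    rewrite /part /li scalerA; have -> : ('i * 'i)%C = -1 :> R[i] by rewrite -expr2 sqr_i.
    by rewrite scaleN1r -[- f _](scaleN1r) (rfunZ _ _ _ _ hl) /= oppr0 mul0r addr0 mulN1r.
  rewrite /a /b; ring.
have mcos : measurable_fun setT (fun z : R * R => cos (z.1 * (t - z.2))).
  exact: (measurableT_comp (continuous_measurable_fun (@continuous_cos R)) (mlin t)).
have msin : measurable_fun setT (fun z : R * R => sin (z.1 * (t - z.2))).
  exact: (measurableT_comp (continuous_measurable_fun (@continuous_sin R)) (mlin t)).
have FA := Rfubini h (damp al a) (fun s tau => cos (s * (t - tau))) ih ia mcos.
have FB := Rfubini h (damp al b) (fun s tau => sin (s * (t - tau))) ih ib msin.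
have [iFA {}FA] := FA (fun _ _ => normr_cos_le1 _).
have [iFB {}FB] := FB (fun _ _ => normr_sin_le1 _).
transitivity (\int[mu]_s (h s * \int[mu]_tau (damp al a tau * cos (s * (t - tau))) +
    h s * \int[mu]_tau (damp al b tau * sin (s * (t - tau))))).
  by apply: eq_Rintegral => s _; exact: gI.
rewrite (RintegralD measurableT iFA iFB) FA FB.
have -> : \int[mu]_tau (damp al b tau * \int[mu]_s (h s * sin (s * (t - tau)))) = 0.
  transitivity (\int[mu]_(tau in [set: R]) 0); last by rewrite (Rintegral_cst _ measurableT) mul0r.
  by apply: eq_Rintegral => tau _; rewrite sin_part_eq0 mulr0.
rewrite addr0 [RHS]Rintegral_mkcond; apply: eq_Rintegral => tau _.
by rewrite /damp !patchE; case: ifP => _; rewrite ?mul0r.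
Qed.

(** Let the damping tend to 0 along [1 / (k + 1)] in [laplace_side]: one side converges by dominated
    convergence, as [Phi] is integrable, the other by the definition of the boundary function. *)
Lemma representation B' l t : 0 <= B' -> rfunctional B' l ->
  mu.-integrable `[0, +oo[ (EFin \o (fun tau => part f l tau * Phi (t - tau))) /\
  \int[mu]_(tau in `[0, +oo[) (part f l tau * Phi (t - tau)) =
  l (bintegral setT (fun s => psi t s *: F s)).
Proof.
move=> B0 hl.
have B00 := bound_ge0 f B fB.
pose al k : R := k.+1%:R^-1.
have al0 k : 0 < al k by rewrite invr_gt0.
have alc : al k @[k --> \oo] --> (0 : R) by exact: cvg_harmonic.
set v := bintegral _ _.
pose V k := bintegral setT (fun s => psi t s *: laplace f (Complex (al k) s)).
have ca : continuous (part f l) := continuous_part f L fL B' l B0 hl.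
have aM x : `|part f l x| <= B' * B := part_le f B fB B' l x B0 hl.
have cPt : continuous (fun tau => Phi (t - tau)).
  move=> x; apply: (@continuous_comp _ _ _ (fun tau => t - tau) Phi); last exact: cPhi.
  by apply: cvgB; [exact: cvg_cst|exact: cvg_id].
have iPt := integrable_reflect _ t iPhi.
have mI : measurable (`[0, +oo[%classic : set (measurableTypeR R)) by exact: measurable_itv.
have iPt0 : mu.-integrable `[0, +oo[ (EFin \o (fun tau => Phi (t - tau))) := integrableTS _ _ mI iPt.
have iG : mu.-integrable `[0, +oo[ (EFin \o (fun tau => B' * B * `|Phi (t - tau)|)).
  exact: (integrableZl mI (B' * B) (integrable_norm iPt0)).
have mg k : measurable_fun (`[0, +oo[%classic : set (measurableTypeR R)) (fun tau => expR (- al k * tau) * part f l tau * Phi (t - tau)).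
  apply: measurable_funTS; apply: continuous_measurable_fun => x.
  by apply: cvgM; [apply: cvgM; [exact: continuous_expRM|exact: ca]|exact: cPt].
have mg0 : measurable_fun (`[0, +oo[%classic : set (measurableTypeR R)) (fun tau => part f l tau * Phi (t - tau)).
  apply: measurable_funTS; apply: continuous_measurable_fun => x.
  by apply: cvgM; [exact: ca|exact: cPt].
have [|k tau|i cv] := Rintegral_cvg _ _ _ _ mI mg mg0 iG.
- move=> tau _; apply: cvgM; last exact: cvg_cst.
  rewrite -[X in _ --> X]mul1r; apply: cvgM; last exact: cvg_cst.
  rewrite -expR0; apply: (@cvg_comp _ _ _ (fun k => - al k * tau) expR); last exact: continuous_expR.
  by rewrite -(mul0r tau) -oppr0; apply: cvgM; [exact: cvgN|exact: cvg_cst].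
- rewrite /= in_itv/= andbT => t0; rewrite !normrM; apply: ler_pM => //.
  rewrite (ger0_norm (expR_ge0 _)) -[leRHS]mul1r; apply: ler_pM => //.
  by rewrite -expR0 ler_expR mulNr oppr_le0 mulr_ge0// ltW.
split => //; apply: (cvg_unique _ cv) => //.
rewrite (_ : (fun k => _) = (fun k => l (V k))); last first.
  by apply/funext => k; rewrite (laplace_side B').
have VC : V k @[k --> \oo] --> v.
  have /cvg_nrmP hb := bF (psi t) (psi_Cc t).
  apply/cvg_nrmP => e e0.
  have := hb e e0; rewrite /at_right /within /= => /nbhs_ballP[d /= d0 hd].
  have /cvgrPdist_lt /(_ _ d0) := alc.
  apply: filterS => k hk; apply: hd => //=.
apply/cvgrPdist_le => e e0.
have b10 : 0 < B' + 1 by lra.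
have /cvg_nrmP /(_ _ (divr_gt0 e0 b10)) := VC.
apply: filterS => k hk; rewrite -(rfunB _ _ _ _ hl).
case: hl => _ _ lB; apply: le_trans (lB _) _.
have := nrm_ge0 (v - V k).
move: hk; rewrite ltr_pdivlMr//; lra.
Qed.

End Representation.

(** * Reduction to a band of frequencies *)

Lemma band_estimate_arith {R : realType} (a c1 c2 r Ri I1 I2 : R) :
  2 * a <= `|I1| + c1 * Ri -> `|I2| <= c2 * r -> 0 <= a -> 0 <= r -> 0 <= Ri -> 0 <= c1 -> 0 <= c2 ->
  a <= (c1 + c2) * (r + Ri) + `|I1 - I2|.
Proof.
move=> h1 h2 a0 r0 Ri0 c10 c20.
have := ler_normD (I1 - I2) I2; rewrite subrK => h3.
have p1 : 0 <= c1 * r by exact: mulr_ge0.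
have p2 : 0 <= c2 * Ri by exact: mulr_ge0.
have p3 : 0 <= c1 * Ri by exact: mulr_ge0.
have p4 : 0 <= c2 * r by exact: mulr_ge0.
rewrite mulrDl !mulrDr; lra.
Qed.

Section BandEstimate.
Context {R : realType} {X : completeNormedModType R[i]}.
Local Notation mu := (@lebesgue_measure R).
Variables (f : R -> X) (B L B1 : R).
Hypothesis fB : forall t, 0 <= t -> nrm (f t) <= B.
Hypothesis fL : forall s t, 0 <= s -> 0 <= t -> nrm (f t - f s) <= L * `|t - s|.
Hypothesis fB1 : forall t, 0 <= t -> nrm (bintegral [set s | 0 <= s <= t] f) <= B1.
Variable F : R -> X.
Hypothesis F1 : L1loc_punct F.
Hypothesis bF : boundary_function f F.
Variables (n : nat) (P : {poly R}).
Hypotheses (hP : step_poly n P) (n2 : (2 <= n)%N).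
Implicit Types (l : X -> R).

Lemma primitive_part l T : rfunctional 1 l -> 0 <= T ->
  `|\int[mu]_(tau in `[0, T]) part f l tau| <= B1.
Proof.
move=> hl T0; have cp := continuous_part f L fL 1 l ler01 hl.
have mI : measurable (`[0, T]%classic : set R) by exact: measurable_itv.
have hap : bapprox (`[0, T]%classic : set R) f.
  by apply: (bapprox_lip _ _ L) => // s t /andP[s0 _] /andP[t0 _]; exact: fL.
have ml : measurable_fun (`[0, T]%classic : set R) (l \o f).
  apply: (eq_measurable_fun (part f l)).
    by move=> tau; rewrite inE/= in_itv/= => /andP[t0 _]; rewrite part_pos.
  by apply: measurable_funTS; exact: continuous_measurable_fun.
have [_ e] := rfun_bintegral _ _ _ _ mI hap hl ml.
have -> : \int[mu]_(tau in `[0, T]) part f l tau = l (bintegral [set s | 0 <= s <= T] f).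
  have -> : [set s : R | 0 <= s <= T] = `[0, T]%classic by apply/seteqP; split => s /=; rewrite in_itv.
  rewrite e; apply: eq_Rintegral => tau; rewrite inE/= in_itv/= => /andP[t0 _].
  exact: part_pos.
by case: hl => _ _ lB; apply: le_trans (lB _) _; rewrite mul1r; exact: fB1.
Qed.

Lemma is_derive_comp_reflect (g : R -> R) (d t x : R) : is_derive (t - x) (1 : R) g d ->
  is_derive x (1 : R) (fun y => g (t - y)) (- d).
Proof.
move=> hg.
have h : is_derive x (1 : R) (fun y : R => t - y) (-1).
  have -> : (fun y : R => t - y) = cst t - (id : R -> R) by [].
  by apply: is_derive_eq; rewrite sub0r.
have := @is_derive1_comp R g (fun y : R => t - y) x _ _ hg h.
by rewrite mulrN1.
Qed.

(** Integration by parts moves the derivative onto the kernel: the primitive of [l o f] is bounded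
    by [B1], while [dker] has integral [O(rho)]. *)
Lemma low_part l rho t T : rfunctional 1 l -> 0 < rho -> 0 <= T ->
  `|\int[mu]_(tau in `[0, T]) (part f l tau * ker P rho (t - tau))| <=
    B1 * (8 * poly_bound P * (1 + pi)) * rho.
Proof.
move=> hl r0 T0; have cp := continuous_part f L fL 1 l ler01 hl.
have A1 := poly_bound_ge1 n P hP.
pose a := part f l.
have ia u v : mu.-integrable `[u, v] (EFin \o a) by apply: integrable_itv => x _; exact: cp.
(* The base point -1 makes [A] differentiable from both sides at 0; subtracting the integral over
   [[-1, 0]] gives back the primitive vanishing at 0. *)
pose A x := \int[mu]_(s in `[-1, x]) a s - \int[mu]_(s in `[-1, 0]) a s.
have AE x : 0 <= x -> A x = \int[mu]_(s in `[0, x]) a s.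
  move=> x0; rewrite /A (Rintegral_itv_split _ (-1) 0 x (lerN10 R) x0 (ia _ _)).
  by rewrite addrAC subrr add0r.
have AB x : 0 <= x -> `|A x| <= B1 by move=> x0; rewrite AE//; exact: primitive_part.
have dA x : 0 <= x <= T -> is_derive x (1 : R) A (a x).
  move=> /andP[x0 xT].
  have [|||d1 d2] := @continuous_FTC1_closed R a (-1) x (T + 1) _ (ia _ _).
  - lra.
  - lra.
  - exact: cp.
  have dI : is_derive x (1 : R) (fun x => \int[mu]_(s in `[-1, x]) a s) (a x).
    by apply: (DeriveDef d1); rewrite -derive1E; exact: d2.
  have -> : A = (fun x => \int[mu]_(s in `[-1, x]) a s) - cst (\int[mu]_(s in `[-1, 0]) a s) by [].
  by apply: is_derive_eq; rewrite subr0.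
have ck : continuous (fun tau => dker P rho (t - tau)).
  move=> x; apply: (@continuous_comp _ _ _ (fun tau => t - tau) (dker P rho)).
    by apply: cvgB; [exact: cvg_cst|exact: cvg_id].
  exact: (continuous_dker n).
have dk x : is_derive x (1 : R) (fun tau => ker P rho (t - tau)) (- dker P rho (t - x)).
  by apply: is_derive_comp_reflect; exact: (is_derive_ker n).
have e := parts (fun tau => ker P rho (t - tau)) A (fun x => - dker P rho (t - x)) a 0 T T0
  (fun x _ => dk x) dA (fun x _ => cvgN (ck x)) (fun x _ => cp x).
have -> : \int[mu]_(tau in `[0, T]) (a tau * ker P rho (t - tau)) =
   \int[mu]_(tau in `[0, T]) (ker P rho (t - tau) * a tau).
  by apply: eq_Rintegral => x _; rewrite mulrC.
rewrite e.
have A0 : A 0 = 0 by rewrite /A subrr.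
rewrite A0 mulr0 subr0.
apply: le_trans (ler_normB _ _) _.
have h1 : `|ker P rho (t - T) * A T| <= 4 * poly_bound P * rho * B1.
  rewrite normrM; apply: ler_pM => //; last exact: AB.
  apply: le_trans (ker_bounds n P hP rho (t - T) r0 n2).1 _.
  apply: ler_wpM2l; first by lra.
  have p1 : 0 < 1 + (rho * (t - T)) ^+ 2 by rewrite ltr_pwDl// sqr_ge0.
  rewrite /hump ler_pdivrMr// ler_peMr//; first exact: ltW.
  by rewrite lerDl sqr_ge0.
have cA : forall x, 0 <= x <= T -> {for x, continuous A}.
  by move=> x xT; exact: is_derive_continuous_at (dA x xT).
have i1 : mu.-integrable `[0, T] (EFin \o (fun x => - dker P rho (t - x) * A x)).
  by apply: integrable_itv => x xT; apply: cvgM; [exact: cvgN (ck x)|exact: cA].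
have [ih eh] := integrable_hump rho r0.
have iht := integrable_reflect _ t ih.
have mT : measurable (`[0, T]%classic : set (measurableTypeR R)) by exact: measurable_itv.
have h2 : `|\int[mu]_(x in `[0, T]) (- dker P rho (t - x) * A x)| <= 8 * poly_bound P * rho * B1 * pi.
  apply: le_trans (le_normr_Rintegral mT i1) _.
  pose c := 8 * poly_bound P * rho * B1.
  have B10 : 0 <= B1 by apply: le_trans (AB 0 (lexx 0)).
  have c0 : 0 <= c by rewrite /c !mulr_ge0// ?ltW//; lra.
  have ihT := integrableTS _ _ mT iht.
  apply: (@le_trans _ _ (\int[mu]_(x in `[0, T]) (c * hump rho (t - x)))).
    apply: le_Rintegral => //; first exact: (integrable_norm i1).
      exact: (integrableZl mT c ihT).
    move=> x /=; rewrite in_itv/= => /andP[x0 xT]; rewrite normrM normrN /c.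
    have -> : 8 * poly_bound P * rho * B1 * hump rho (t - x) = (8 * poly_bound P * rho * hump rho (t - x)) * B1 by ring.
    by apply: ler_pM => //; [exact: (dker_bound n)|exact: AB].
  rewrite RintegralZl//; apply: ler_wpM2l => //.
  rewrite -eh -(Rintegral_reflect _ t ih) Rintegral_mkcond.
  apply: le_Rintegral => //.
    by have /(integrable_mkcond _ mT) := ihT; rewrite restrict_EFin.
  by move=> x _; rewrite patchE; case: ifP => // _; rewrite hump_ge0// ltW.
apply: le_trans (lerD h1 h2) _.
have B10 : 0 <= B1 by apply: le_trans (AB 0 (lexx 0)).
have : 0 <= poly_bound P * rho * B1 by rewrite !mulr_ge0//; lra.
lra.
Qed.

Lemma integrable_part_ker l rho t : rfunctional 1 l -> 0 < rho ->
  mu.-integrable `[0, +oo[ (EFin \o (fun tau => part f l tau * ker P rho (t - tau))).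
Proof.
move=> hl r0; have cp := continuous_part f L fL 1 l ler01 hl.
have mI : measurable (`[0, +oo[%classic : set (measurableTypeR R)) by exact: measurable_itv.
have ik := integrable_reflect _ t (integrable_ker n P hP n2 rho r0).
apply: (le_integrable mI _ _ (integrableZl mI B (integrableTS _ _ mI ik))).
  apply/measurable_EFinP; apply: measurable_funTS; apply: continuous_measurable_fun => x.
  apply: cvgM; first exact: cp.
  apply: (@continuous_comp _ _ _ (fun tau => t - tau) (ker P rho)).
    by apply: cvgB; [exact: cvg_cst|exact: cvg_id].
  exact: (continuous_ker n).
move=> x _ /=; rewrite lee_fin !normrM; apply: ler_wpM2r => //.
by have := part_le f B fB 1 l x ler01 hl; rewrite mul1r => /le_trans; apply; exact: ler_norm.
Qed.

Lemma low_tail l rho t : rfunctional 1 l -> 0 < rho ->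
  `|\int[mu]_(tau in `[0, +oo[) (part f l tau * ker P rho (t - tau))| <=
    B1 * (8 * poly_bound P * (1 + pi)) * rho.
Proof.
move=> hl r0; have ig := integrable_part_ker l rho t hl r0.
have cv := Rintegral_cvg_itv _ ig.
apply/ler_addgt0Pr => e e0.
have /cvgrPdist_lt /(_ _ e0) [N _ hN] := cv.
have {hN} := hN N (leqnn N).
have := low_part l rho t N%:R hl r0 (ler0n _ N).
set I := (X in `|X| <= _ -> _ -> `|_| <= _); set J := Rintegral _ _ _ => h1 h2.
have : `|J| <= `|I| + `|J - I| by rewrite -[X in `|X| <= _](subrK I) addrC ler_normD.
lra.
Qed.

(** Compare [l (f tau)] with [l (f t)] under the kernel, whose mass is at least 2. The difference is
    at most [(L + B) * |t - tau|]: for [tau >= 0] by the Lipschitz bound, and for [tau < 0], where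
    the integrand is cut off, because [t >= 1] gives [|t - tau| >= 1]. *)
Lemma high_part l rho t : rfunctional 1 l -> 0 < rho -> 1 <= t ->
  2 * `|part f l t| <= `|\int[mu]_(tau in `[0, +oo[) (part f l tau * ker P rho (t - tau))| +
     (L + B) * (4 * poly_bound P * pi) / rho.
Proof.
move=> hl r0 t1; have cp := continuous_part f L fL 1 l ler01 hl.
have B0 := bound_ge0 f B fB.
have L0 : 0 <= L.
  by have := fL 0 1 (lexx 0) ler01; rewrite subr0 normr1 mulr1; apply: le_trans; exact: nrm_ge0.
pose I : set (measurableTypeR R) := `[0, +oo[%classic.
have mI : measurable I by exact: measurable_itv.
pose k tau := ker P rho (t - tau).
have ik : mu.-integrable setT (EFin \o k) := integrable_reflect _ t (integrable_ker n P hP n2 rho r0).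
have aB x : `|part f l x| <= B by have := part_le f B fB 1 l x ler01 hl; rewrite mul1r.
have ck : continuous k.
  move=> x; apply: (@continuous_comp _ _ _ (fun tau => t - tau) (ker P rho)).
    by apply: cvgB; [exact: cvg_cst|exact: cvg_id].
  exact: (continuous_ker n).
have ig : mu.-integrable I (EFin \o (fun tau => part f l tau * k tau)) := integrable_part_ker l rho t hl r0.
pose g := (fun tau => part f l tau * k tau) \_ I.
have igT : mu.-integrable setT (EFin \o g).
  by have /(integrable_mkcond _ mI) := ig; rewrite restrict_EFin.
have iak : mu.-integrable setT (EFin \o (fun tau => part f l t * k tau)).
  exact: (integrableZl measurableT (part f l t) ik).
pose m := \int[mu]_u ker P rho u.
have m2 : 2 <= m := ker_mass n P hP n2 rho r0.
have e1 : \int[mu]_tau (part f l t * k tau) = part f l t * m.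
  by rewrite (RintegralZl _ measurableT ik) /m -(Rintegral_reflect _ t (integrable_ker n P hP n2 rho r0)).
have e2 : \int[mu]_(tau in I) (part f l tau * k tau) = \int[mu]_tau g tau by rewrite Rintegral_mkcond.
have [ih eh] := integrable_hump rho r0.
have iht := integrable_reflect _ t ih.
have pb := poly_bound_ge1 n P hP.
pose c := (L + B) * (4 * poly_bound P) / rho.
have key : `|part f l t * m - \int[mu]_tau g tau| <= c * pi.
  rewrite -e1 -RintegralB//.
  have iB := integrableB measurableT iak igT.
  apply: le_trans (le_normr_Rintegral measurableT iB) _.
  apply: (@le_trans _ _ (\int[mu]_x (c * hump rho (t - x)))); last first.
    by rewrite RintegralZl// (Rintegral_reflect _ t ih) eh.
  apply: le_Rintegral => //; first exact: (integrable_norm iB).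
    exact: (integrableZl measurableT c iht).
  move=> x _.
  have kb := (ker_bounds n P hP rho (t - x) r0 n2).2.
  have kb2 : `|t - x| * `|k x| <= 4 * poly_bound P / rho * hump rho (t - x).
    by rewrite mulrAC ler_pdivlMr// mulrC mulrA.
  have -> : c * hump rho (t - x) = (L + B) * (4 * poly_bound P / rho * hump rho (t - x)) by rewrite /c; ring.
  apply: (@le_trans _ _ ((L + B) * (`|t - x| * `|k x|))); last by apply: ler_wpM2l => //; lra.
  rewrite mulrA /g patchE.
  have [x0|x0] := leP 0 x.
    rewrite ifT; last by rewrite mem_set// /I /= in_itv/= x0.
    rewrite -mulrBl normrM; apply: ler_wpM2r => //.
    have := part_lip f L fL 1 l x t ler01 hl; rewrite mul1r => /le_trans; apply.
    by apply: ler_wpM2r => //; lra.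
  rewrite ifF; last by apply: memNset; rewrite /I /= in_itv/= andbT; apply/negP; rewrite -ltNge.
  rewrite subr0 normrM; apply: ler_wpM2r => //; apply: le_trans (aB t) _.
  rewrite ger0_norm; last lra.
  have : 0 <= L * (t - x) by apply: mulr_ge0 => //; lra.
  have : B * 1 <= B * (t - x) by apply: ler_wpM2l => //; lra.
  by rewrite mulrDl; lra.
rewrite e2.
have h1 : 2 * `|part f l t| <= `|part f l t * m|.
  by rewrite normrM mulrC; apply: ler_wpM2l => //; apply: le_trans m2 (ler_norm _).
apply: le_trans h1 _.
rewrite -[part f l t * m](subrK (\int[mu]_tau g tau)) addrC.
apply: le_trans (ler_normD _ _) _; apply: lerD => //.
by apply: le_trans key _; rewrite /c le_eqVlt; apply/orP; left; apply/eqP; ring.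
Qed.

(* Vanishes for [|s| <= r] and for [|s| >= R0], and equals [1] for [2 r <= |s| <= R0 / 2]. *)
Definition band r R0 (s : R) : R := cutoff P R0 s - cutoff P (2 * r) s.

Lemma continuous_band r R0 : continuous (band r R0).
Proof. by move=> s; apply: cvgB; exact: continuous_cutoff. Qed.

Lemma bandN r R0 s : band r R0 (- s) = band r R0 s.
Proof. by rewrite /band !cutoffN. Qed.

Lemma band_in r R0 s : 0 < r -> 4 * r <= R0 -> `|s| <= r -> band r R0 s = 0.
Proof. by move=> r0 rR sr; rewrite /band !(cutoff_flat n P) ?subrr//; lra. Qed.

Lemma band_out r R0 s : 0 < r -> 4 * r <= R0 -> R0 <= `|s| -> band r R0 s = 0.
Proof. by move=> r0 rR sr; rewrite /band !(cutoff_out n P) ?subrr//; lra. Qed.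

Lemma band_estimate l r R0 t : rfunctional 1 l -> 0 < r -> 4 * r <= R0 -> 1 <= t ->
  `|part f l t| <= ((L + B) * (4 * poly_bound P * pi) + B1 * (16 * poly_bound P * (1 + pi))) * (r + R0^-1) +
     `|l (bintegral setT (fun s => psi (band r R0) t s *: F s))|.
Proof.
move=> hl r0 rR t1.
have R00 : 0 < R0 by lra.
have r20 : 0 < 2 * r by lra.
have hk u : \int[mu]_s (band r R0 s * cos (s * u)) = ker P R0 u - ker P (2 * r) u.
  rewrite /ker -RintegralB//.
  - by apply: eq_Rintegral => s _; rewrite mulrBl.
  - by apply: (integrable_cutoff n) => //; exact: continuous_coslin.
  - by apply: (integrable_cutoff n) => //; exact: continuous_coslin.
have ik1 := integrable_ker n P hP n2 R0 R00; have ik2 := integrable_ker n P hP n2 (2 * r) r20.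
have ck1 := continuous_ker n P hP R0 R00; have ck2 := continuous_ker n P hP (2 * r) r20.
have iPhi : mu.-integrable setT (EFin \o (fun u => \int[mu]_s (band r R0 s * cos (s * u)))).
  by rewrite (_ : (fun u => _) = (fun u => ker P R0 u - ker P (2 * r) u)); [exact: (integrableB measurableT ik1 ik2)|apply/funext].
have cPhi : continuous (fun u => \int[mu]_s (band r R0 s * cos (s * u))).
  rewrite (_ : (fun u => _) = (fun u => ker P R0 u - ker P (2 * r) u)); last by apply/funext.
  by move=> x; apply: cvgB; [exact: ck1|exact: ck2].
have rR0 : r <= R0 by lra.
have [i <-] := representation f B L fB fL F bF (band r R0) r R0 r0 rR0 (continuous_band r R0) (bandN r R0)
  (fun s => band_in r R0 s r0 rR) (fun s => band_out r R0 s r0 rR) iPhi cPhi 1 l t ler01 hl.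
have h1 := high_part l R0 t hl R00 t1.
have h2 := low_tail l (2 * r) t hl r20.
have i1 := integrable_part_ker l R0 t hl R00; have i2 := integrable_part_ker l (2 * r) t hl r20.
have mI : measurable (`[0, +oo[%classic : set (measurableTypeR R)) by exact: measurable_itv.
have -> : \int[mu]_(tau in `[0, +oo[) (part f l tau * \int[mu]_s (band r R0 s * cos (s * (t - tau)))) =
  \int[mu]_(tau in `[0, +oo[) (part f l tau * ker P R0 (t - tau)) -
  \int[mu]_(tau in `[0, +oo[) (part f l tau * ker P (2 * r) (t - tau)).
  rewrite -(RintegralB mI i1 i2); apply: eq_Rintegral => tau _.
  by rewrite hk mulrBr.
have L0 : 0 <= L.
  by have := fL 0 1 (lexx 0) ler01; rewrite subr0 normr1 mulr1; apply: le_trans; exact: nrm_ge0.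
have B0 := bound_ge0 f B fB.
have pb := poly_bound_ge0 P.
have pi0 : 0 <= pi :> R by exact: pi_ge0.
have B10 : 0 <= B1 by apply: le_trans (fB1 0 (lexx 0)); exact: nrm_ge0.
have e2 : B1 * (8 * poly_bound P * (1 + pi)) * (2 * r) = B1 * (16 * poly_bound P * (1 + pi)) * r by ring.
rewrite e2 in h2.
apply: (band_estimate_arith _ _ _ _ _ _ _ h1 h2) => //; first exact: ltW.
- by rewrite invr_ge0 ltW.
- by apply: mulr_ge0; [exact: addr_ge0|apply: mulr_ge0 => //; exact: mulr_ge0].
- by apply: mulr_ge0 => //; apply: mulr_ge0; [exact: mulr_ge0|exact: addr_ge0].
Qed.

End BandEstimate.

(** * Decay *)

Section RiemannLebesgue.
Context {R : realType}.
Local Notation mu := (@lebesgue_measure R).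
Variables (N th : R).
Hypothesis N0 : 0 <= N.

Let mN : measurable (`[- N, N]%classic : set (measurableTypeR R)).
Proof. exact: measurable_itv. Qed.

Let osc_small (g : R -> R) := forall e, 0 < e -> exists T, forall t, T <= t ->
  `|\int[mu]_(s in `[- N, N]) (g s * cos (s * t + th))| <= e.

Lemma osc_small_C1 (g g' : R -> R) : (forall x, - N <= x <= N -> is_derive x (1 : R) g (g' x)) ->
  (forall x, - N <= x <= N -> {for x, continuous g'}) -> osc_small g.
Proof.
move=> dg cg' e e0.
have NN : - N <= N by rewrite ge0_cp.
have cg x : - N <= x <= N -> {for x, continuous g} by move=> /dg; exact: is_derive_continuous_at.
have bnd (h : R -> R) : (forall x, - N <= x <= N -> {for x, continuous h}) ->
    exists M, 0 <= M /\ forall x, - N <= x <= N -> `|h x| <= M.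
  move=> ch; have ch' : {within `[- N, N], continuous h}.
    by apply: continuous_at_within => x /=; rewrite in_itv; exact: ch.
  have /compact_bounded[M [_ hM]] := continuous_compact ch' (@segment_compact _ _ _).
  exists (Num.max M 0 + 1); split; first by rewrite addr_ge0// le_max lexx orbT.
  move=> x xN; apply: (hM (Num.max M 0 + 1)); first by rewrite ltr_pwDr// le_max lexx.
  by exists x => //=; rewrite in_itv.
have [M [M0 hM]] := bnd g cg; have [M' [M'0 hM']] := bnd g' cg'.
pose u (j : nat) := if j == 0%N then g else g'.
have hu : dsq (- N) N 1 u.
  move=> x xN; split => -[|j] // _; [exact: dg|exact: cg|exact: cg'].
exists (Num.max 1 ((2 * M + M' * (2 * N)) / e)) => t.
rewrite ge_max => /andP[t1 tT]; have t0 : 0 < t by lra.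
have h := osc_flat 1 u (- N) N t th M' NN t0 hu hM'.
rewrite /= in h.
have hb x : - N <= x <= N -> `|bdry 1 u t th x| <= t^-1 * M.
  move=> xN; apply: le_trans (bdry_le _ _ _ _ _ t0) _.
  by rewrite big_ord1 expr1 ler_pM2l ?invr_gt0//; exact: hM.
have b1 := hb N _; have b2 := hb (- N) _.
have {b1} b1 : `|bdry 1 u t th N| <= t^-1 * M by apply: b1; rewrite NN lexx.
have {b2} b2 : `|bdry 1 u t th (- N)| <= t^-1 * M by apply: b2; rewrite NN lexx.
rewrite -[X in `|X| <= _](subrK (bdry 1 u t th N - bdry 1 u t th (- N))).
apply: le_trans (ler_normD _ _) _.
apply: le_trans (lerD h (ler_normB _ _)) _.
apply: le_trans (lerD (lexx _) (lerD b1 b2)) _.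
rewrite expr1 (_ : _ + _ = t^-1 * (2 * M + M' * (2 * N))); last by ring.
by rewrite mulrC ler_pdivrMr// [e * t]mulrC -ler_pdivrMr.
Qed.

(** Oscillatory decay survives approximation in mean because [|cos| <= 1] makes the error uniform in
    [t]. *)
Lemma osc_small_near (g : R -> R) : mu.-integrable `[- N, N] (EFin \o g) ->
  (forall e, 0 < e -> exists g', [/\ osc_small g', mu.-integrable `[- N, N] (EFin \o g') &
     \int[mu]_(s in `[- N, N]) `|g s - g' s| <= e]) -> osc_small g.
Proof.
move=> ig hg e e0; have e20 : 0 < e / 2 by rewrite divr_gt0.
have [g' [og' ig' d]] := hg _ e20; have [T hT] := og' _ e20.
exists T => t tT.
have icos (h : R -> R) : mu.-integrable `[- N, N] (EFin \o h) ->
    mu.-integrable `[- N, N] (EFin \o (fun s => h s * cos (s * t + th))).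
  move=> ih; apply: (le_integrable mN _ _ ih).
    apply/measurable_EFinP; apply: measurable_funM.
      by apply/measurable_EFinP; case/integrableP: ih.
    by apply: measurable_funTS; apply: continuous_measurable_fun => x; exact: continuous_cos_lin.
  by move=> x _ /=; rewrite lee_fin normrM ler_piMr// normr_cos_le1.
have iB : mu.-integrable `[- N, N] (EFin \o (fun s => g s - g' s)) := integrableB mN ig ig'.
have -> : \int[mu]_(s in `[- N, N]) (g s * cos (s * t + th)) =
    \int[mu]_(s in `[- N, N]) ((g s - g' s) * cos (s * t + th)) +
    \int[mu]_(s in `[- N, N]) (g' s * cos (s * t + th)).
  rewrite -(RintegralD mN (icos _ iB) (icos _ ig')); apply: eq_Rintegral => s _.
  by rewrite -mulrDl subrK.
apply: le_trans (ler_normD _ _) _; rewrite [e]splitr; apply: lerD; last exact: hT.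
apply: le_trans (le_normr_Rintegral mN (icos _ iB)) _; apply: le_trans d.
apply: le_Rintegral => //; [exact: (integrable_norm (icos _ iB))|exact: (integrable_norm iB)|].
by move=> s _; rewrite normrM ler_piMr// normr_cos_le1.
Qed.

(* Steklov averages of a continuous function are continuously differentiable and converge
   pointwise and boundedly to it. *)
Lemma osc_small_continuous (g : R -> R) : continuous g -> osc_small g.
Proof.
move=> cg.
have ig a b : mu.-integrable `[a, b] (EFin \o g) by apply: integrable_itv => x _; exact: cg.
(* The margin on the left gives a two-sided derivative at [- N]; on the right room is kept for
   shifts by [d k <= 1]. *)
pose G x := \int[mu]_(s in `[- N - 1, x]) g s.
have dG x : - N <= x <= N + 1 -> is_derive x (1 : R) G (g x).
  move=> /andP[x0 xT].
  have [|||d1 d2] := @continuous_FTC1_closed R g (- N - 1) x (N + 2) _ (ig _ _).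
  - lra.
  - lra.
  - exact: cg.
  by apply: (DeriveDef d1); rewrite -derive1E; exact: d2.
pose d k : R := k.+1%:R^-1.
have d0 k : 0 < d k by rewrite invr_gt0.
have d1 k : d k <= 1 by rewrite invf_le1// ler1n.
have dc : d k @[k --> \oo] --> (0 : R) by exact: cvg_harmonic.
pose A k x := (d k)^-1 * (G (d k + x) - G x).
have dA k x : - N <= x <= N -> is_derive x (1 : R) (A k) ((d k)^-1 * (g (d k + x) - g x)).
  move=> /andP[x1 x2].
  have h1 : is_derive x (1 : R) G (g x) by apply: dG; lra.
  have hs : is_derive x (1 : R) (fun y : R => d k + y) 1.
    have -> : (fun y : R => d k + y) = cst (d k) + (id : R -> R) by [].
    by apply: is_derive_eq; rewrite add0r.
  have h2 : is_derive (d k + x) (1 : R) G (g (d k + x)).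
    by apply: dG; have := d0 k; have := d1 k; lra.
  have h3 := @is_derive1_comp R G (fun y : R => d k + y) x _ _ h2 hs.
  have -> : A k = (d k)^-1 \*: ((G \o (fun y : R => d k + y)) - G) by [].
  by apply: is_derive_eq; rewrite /GRing.scale /= mulr1.
have cA k x : - N <= x <= N -> {for x, continuous (A k)}.
  by move=> h; exact: (is_derive_continuous_at _ _ _ (dA k x h)).
have osA k : osc_small (A k).
  apply: (osc_small_C1 _ (fun x => (d k)^-1 * (g (d k + x) - g x))).
  move=> x _; apply: cvgM; first exact: cvg_cst.
  apply: cvgB; last exact: cg.
  apply: (@continuous_comp _ _ _ (fun y : R => d k + y) g); last exact: cg.
  by apply: cvgD; [exact: cvg_cst|exact: cvg_id].
have iA k : mu.-integrable `[- N, N] (EFin \o A k) by apply: integrable_itv; exact: cA.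
have [M [M0 hM]] : exists M, 0 <= M /\ forall x, - N <= x <= N + 1 -> `|g x| <= M.
  have cw : {within `[- N, N + 1], continuous g} by apply: continuous_subspaceT.
  have /compact_bounded[M [_ hM]] := continuous_compact cw (@segment_compact _ _ _).
  exists (Num.max M 0 + 1); split; first by rewrite addr_ge0// le_max lexx orbT.
  move=> x xN; apply: (hM (Num.max M 0 + 1)); first by rewrite ltr_pwDr// le_max lexx.
  by exists x => //=; rewrite in_itv.
have bA k x : - N <= x <= N -> `|A k x| <= M.
  move=> /andP[x1 x2].
  have -> : A k x = (d k)^-1 * \int[mu]_(s in `[x, d k + x]) g s.
    rewrite /A /G (Rintegral_itv_split _ (- N - 1) x (d k + x)) ?[_ + _ - _]addrAC ?subrr ?add0r//.
      lra.
    by rewrite lerDr ltW.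
  rewrite normrM (gtr0_norm (_ : 0 < (d k)^-1)) ?invr_gt0// ler_pdivrMl//.
  have mx : measurable (`[x, d k + x]%classic : set (measurableTypeR R)) by exact: measurable_itv.
  apply: le_trans (le_normr_Rintegral mx (ig _ _)) _.
  apply: (@le_trans _ _ (\int[mu]_(s in `[x, d k + x]) M)).
    apply: le_Rintegral => //; first exact: (integrable_norm (ig _ _)).
      by apply: integrable_itv => y _; exact: cvg_cst.
    move=> s /=; rewrite in_itv/= => /andP[s1 s2]; apply: hM.
    by have := d1 k; lra.
  rewrite Rintegral_cst//= lebesgue_measure_itv/= lte_fin ltrDr d0 /= mulrC.
  by rewrite addrK.
apply: osc_small_near => // e e0.
pose f_ k x := `|g x - A k x|.
have mg : measurable_fun (`[- N, N]%classic : set (measurableTypeR R)) g.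
  by apply: measurable_funTS; exact: continuous_measurable_fun.
have mA k : measurable_fun (`[- N, N]%classic : set (measurableTypeR R)) (A k).
  by apply/measurable_EFinP; case/integrableP: (iA k).
have mf k : measurable_fun (`[- N, N]%classic : set (measurableTypeR R)) (f_ k).
  by apply: measurableT_comp => //; apply: measurable_funB.
have [|||_ cv] := @Rintegral_cvg R `[- N, N] f_ (cst 0) (cst (M + M)) mN mf (measurable_cst _).
- by apply: integrable_itv => y _; exact: cvg_cst.
- move=> x /=; rewrite in_itv/= => /andP[x1 x2].
  have [dv De] : is_derive x (1 : R) G (g x) by apply: dG; lra.
  have ed : derive G x 1 = g x := De.
  rewrite /f_; have AG : A k x @[k --> \oo] --> g x.
    have : (fun h : R => h^-1 *: (G (h *: (1 : R) + x) - G x)) @ 0^' --> g x by rewrite -ed; exact: dv.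
    move=> hh.
    have d' : d k @[k --> \oo] --> (0 : R)^'.
      move=> B /=; rewrite /dnbhs /within /= => /nbhs_ballP[h0 /= h00 hB].
      have /cvgrPdist_lt /(_ _ h00) := dc; apply: filterS => k hk.
      by apply: hB => //; rewrite gt_eqF.
    have /= := cvg_comp _ _ d' hh; apply: cvg_trans; apply: near_eq_cvg.
    by near=> k; rewrite /A /= /GRing.scale /= mulr1.
  rewrite -[X in _ --> X](normr0 R) -(subrr (g x)); apply: cvg_norm.
  by apply: cvgB; [exact: cvg_cst|exact: AG].
- move=> k x /=; rewrite in_itv/= => /andP[x1 x2]; rewrite /f_ normr_id.
  by apply: le_trans (ler_normB _ _) _; apply: lerD; [apply: hM; lra|apply: bA; lra].
have /cvgrPdist_le /(_ _ e0) [k _ hk] := cv.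
exists (A k); split => //.
have := hk k (leqnn k); rewrite Rintegral_cst// mul0r sub0r normrN => /(le_trans (ler_norm _)).
exact.
Unshelve. all: by end_near.
Qed.

Lemma osc_small_integrable (g : R -> R) : mu.-integrable `[- N, N] (EFin \o g) -> osc_small g.
Proof.
move=> ig; apply: osc_small_near => // e e0.
have fN : (mu (`[(- N)%R, N]%classic : set R) < +oo)%E.
  rewrite lebesgue_measure_itv/= lte_fin; by case: ifP => _; exact: ltry.
have [g_ [cg ig_ cv]] := approximation_continuous_integrable mN fN ig.
have /fine_cvgP[h1 /cvgrPdist_lt /(_ _ e0) h2] := cv.
have [k [k1 k2]] := filter_ex (filterI h1 h2).
exists (g_ k); split; [exact: osc_small_continuous|exact: ig_|].
move: k2; rewrite sub0r normrN => /ltW; apply: le_trans.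
rewrite /Rintegral; apply: le_trans (ler_norm _).
exact: lexx.
Qed.

End RiemannLebesgue.

(** * Riemann-Lebesgue for vector-valued functions on a band *)

Section BandDecay.
Context {R : realType} {X : completeNormedModType R[i]}.
Local Notation mu := (@lebesgue_measure R).
Implicit Types (l : X -> R).

Lemma bint_dist (D : set R) (G G' : R -> X) w e v v' : measurable D -> bint D G v -> bint D G' v' ->
  majorizes D (fun t => G t - G' t) w e -> nrm (v - v') <= e.
Proof.
move=> mD h h' hd; apply/ler_addgt0Pl => d d0.
have d40 : 0 < d / 4 by rewrite divr_gt0.
have [s [w1 [hw hs]]] := h _ d40; have [s' [w' [hw' hs']]] := h' _ d40.
have {}hd : nrm (sint D s - sint D s') <= d / 4 + e + d / 4.
  apply: (sint_le _ _ _ (fun t => w1 t + w t + w' t)%E) => //.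
  apply: eq_majorizes (majorizesD _ _ _ _ _ _ _ mD (majorizesD _ _ _ _ _ _ _ mD (majorizesN _ _ _ _ hw) hd) hw') => t _ /=.
  by rewrite opprB !addrA !subrK.
rewrite (_ : v - v' = (v - sint D s) + (sint D s - sint D s') + (sint D s' - v')); last first.
  by rewrite !addrA !subrK.
apply: le_trans (nrmD _ _) _.
have := nrmD (v - sint D s) (sint D s - sint D s').
by move: hs'; rewrite nrmB; lra.
Qed.

Variable F : R -> X.
Hypothesis F1 : L1loc_punct F.
Variables (h : R -> R) (r0 R0 : R).
Hypotheses (r00 : 0 < r0) (rR0 : r0 <= R0).
Hypothesis ch : continuous h.
Hypothesis hin : forall s, `|s| <= r0 -> h s = 0.
Hypothesis hout : forall s, R0 <= `|s| -> h s = 0.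

Let R00 : 0 <= R0.
Proof. exact: le_trans (ltW r00) rR0. Qed.

Let hK s : ~ `[- R0, R0]%classic s -> h s = 0.
Proof.
move=> ns; apply: hout; rewrite leNgt; apply/negP => hs; apply: ns => /=.
by rewrite in_itv/= -ler_norml ltW.
Qed.

Let mR : measurable (`[- R0, R0]%classic : set (measurableTypeR R)).
Proof. exact: measurable_itv. Qed.

Let ih : mu.-integrable setT (EFin \o h).
Proof.
apply: (integrable_support _ `[- R0, R0]) => //; first exact: segment_compact.
exact: continuous_subspaceT.
Qed.

Lemma band_osc (A : set (measurableTypeR R)) th e : measurable A -> 0 < e ->
  exists T, forall t, T <= t ->
    mu.-integrable setT (EFin \o (fun s => h s * \1_A s * cos (s * t + th))) /\
    `|\int[mu]_s (h s * \1_A s * cos (s * t + th))| <= e.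
Proof.
move=> mA e0.
have iA : mu.-integrable setT (EFin \o (fun s => h s * \1_A s)).
  apply: (le_integrable measurableT _ _ ih).
    apply/measurable_EFinP; apply: measurable_funM; first exact: continuous_measurable_fun.
    exact: measurable_indic.
  move=> s _ /=; rewrite lee_fin normrM ler_piMr// indicE.
  by case: (_ \in _); rewrite ?normr1// normr0.
have [T hT] := osc_small_integrable R0 th R00 _ (integrableTS _ _ mR iA) e e0.
exists T => t tT; split.
  apply: (le_integrable measurableT _ _ iA).
    apply/measurable_EFinP; apply: measurable_funM.
      by apply/measurable_EFinP; case/integrableP: iA.
    by apply: continuous_measurable_fun => x; exact: continuous_cos_lin.
  by move=> x _ /=; rewrite lee_fin normrM ler_piMr// normr_cos_le1.
rewrite (Rintegral_support _ `[- R0, R0]) //; first exact: hT.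
by move=> x _ nx; rewrite hK// !mul0r.
Qed.

(** [T] must not depend on [l]. Each block contributes two scalar oscillatory integrals free of [l],
    with coefficients [l (bvec p)] and [l ('i *: bvec p)] that are at most [nrm (bvec p)]. *)
Lemma sfn_osc (s : seq (@block R X)) e : 0 < e -> exists T, forall t l, T <= t -> rfunctional 1 l ->
  mu.-integrable setT (EFin \o (fun x => l (psi h t x *: sfn s x))) /\
  `|\int[mu]_x l (psi h t x *: sfn s x)| <= e.
Proof.
elim: s e => [|p s IH] e e0.
  exists 0 => t l _ hl.
  have E x : l (psi h t x *: sfn [::] x) = 0.
    by rewrite /sfn big_nil scaler0 -(subrr 0) (rfunB _ _ _ _ hl) subrr.
  split.
    rewrite (_ : _ \o _ = cst 0%E); first exact: integrable0.
    by apply/funext => x /=; rewrite E.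
  by under eq_Rintegral do rewrite E; rewrite (Rintegral_cst _ measurableT) mul0r normr0 ltW.
have c0 : 0 < nrm (bvec p) + 1 by rewrite ltr_pwDr// nrm_ge0.
have d0 : 0 < e / 4 / (nrm (bvec p) + 1) by rewrite !divr_gt0.
have [T1 h1] := IH (e / 2) (divr_gt0 e0 (ltr0n _ 2)).
have [T2 h2] := band_osc (bset p) 0 _ (bset_meas p) d0.
have [T3 h3] := band_osc (bset p) (- (pi / 2)) _ (bset_meas p) d0.
exists (Num.max T1 (Num.max T2 T3)) => t l; rewrite !ge_max => /andP[t1 /andP[t2 t3]] hl.
have {h1} [i1 h1] := h1 t l t1 hl; have {h2} [i2 h2] := h2 t t2; have {h3} [i3 h3] := h3 t t3.
pose a := l (bvec p); pose b := l ('i%C *: bvec p).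
have ha : `|a| <= nrm (bvec p) by case: hl => _ _ /(_ (bvec p)); rewrite mul1r.
have hb : `|b| <= nrm (bvec p) by case: hl => _ _ /(_ ('i%C *: bvec p)); rewrite mul1r nrmi.
pose g1 x := h x * \1_(bset p) x * cos (x * t + 0).
pose g2 x := h x * \1_(bset p) x * cos (x * t + - (pi / 2)).
have E : (fun x => l (psi h t x *: sfn (p :: s) x)) =
    (fun x => (a * g1 x + b * g2 x) + l (psi h t x *: sfn s x)).
  apply/funext => x; rewrite /sfn big_cons scalerDr.
  have [lD lZ _] := hl; rewrite lD (rfunZ _ _ _ _ hl) /= !lZ; congr (_ + _).
  have -> : l ('i%C *: rscale (\1_(bset p) x) (bvec p)) = \1_(bset p) x * b.
    by rewrite /b -lZ /rscale !scalerA mulrC.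
  by rewrite /g1 /g2 -sin_shift addr0 /a; ring.
have ia : mu.-integrable setT (EFin \o (fun x => a * g1 x)) := integrableZl measurableT a i2.
have ib : mu.-integrable setT (EFin \o (fun x => b * g2 x)) := integrableZl measurableT b i3.
have iab : mu.-integrable setT (EFin \o (fun x => a * g1 x + b * g2 x)) := integrableD measurableT ia ib.
rewrite E; split; first exact: (integrableD measurableT iab i1).
rewrite (RintegralD measurableT iab i1) (RintegralD measurableT ia ib).
rewrite (RintegralZl _ measurableT i2) (RintegralZl _ measurableT i3).
have k c I : `|c| <= nrm (bvec p) -> `|I| <= e / 4 / (nrm (bvec p) + 1) -> `|c * I| <= e / 4.
  move=> hc hI; rewrite normrM.
  have -> : e / 4 = (nrm (bvec p) + 1) * (e / 4 / (nrm (bvec p) + 1)) by rewrite [RHS]mulrC divfK// gt_eqF.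
  by apply: ler_pM => //; apply: le_trans hc _; rewrite lerDl.
have k1 := k _ _ ha h2; have k2 := k _ _ hb h3.
apply: le_trans (ler_normD _ _) _; apply: le_trans (lerD (ler_normD _ _) h1) _.
apply: le_trans (lerD (lerD k1 k2) (lexx _)) _.
by rewrite le_eqVlt; apply/orP; left; apply/eqP; field.
Qed.

(** On the support of [h], [F] is close in mean to a simple function, for which [sfn_osc] applies;
    multiplication by [psi] costs at most the factor [2 * H], uniformly in [t] and [l]. *)
Lemma band_decay e : 0 < e -> exists T, forall t l, T <= t -> rfunctional 1 l ->
  `|l (bintegral setT (fun s => psi h t s *: F s))| <= e.
Proof.
move=> e0; pose K : set R := [set s | r0 <= `|s| <= R0].
have KE : K = `[- R0, - r0] `|` `[r0, R0].
  apply/seteqP; split => s; rewrite /K /= !in_itv/=.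
    by case: (ger0P s) => s0 hs; [right|left]; lra.
  by case=> hs; have h1 := r00; have h2 := rR0; case: (ger0P s) => s0; lra.
have mK : measurable K by rewrite KE; apply: measurableU; exact: measurable_itv.
have [H [H0 hH]] := h_bounded h r0 R0 r00 rR0 ch hin hout.
have H10 : 0 < 4 * (H + 1) by rewrite mulr_gt0// ltr_pwDr.
have d0 : 0 < e / (4 * (H + 1)) by rewrite divr_gt0.
have [s [w hw]] := bapprox_F_K F F1 r0 R0 r00 rR0 _ d0.
have [T hT] := sfn_osc s (e / 2) (divr_gt0 e0 (ltr0n _ 2)).
exists T => t l tT hl; have [i1 h1] := hT t l tT hl.
have as_ : bapprox setT (fun x => psi h t x *: sfn s x).
  apply: (bapprox_psi h r0 R0 r00 rR0 ch hin hout _ K) => //.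
  move=> d d1; exists s, (cst 0%E).
  apply: eq_majorizes (majorizes0 K d (ltW d1)) => x _ /=.
  by rewrite subrr.
have aF := bapprox_psiF F F1 h r0 R0 r00 rR0 ch hin hout t.
have [_ e1] := rfun_bintegral _ _ _ _ measurableT as_ hl ((measurable_EFinP _ _).1 (measurable_int _ i1)).
have hpsi x : K x -> `|complex.Re (psi h t x)| <= H /\ `|complex.Im (psi h t x)| <= H.
  move=> _; rewrite /psi /= !normrM; split; rewrite -[H]mulr1; apply: ler_pM => //.
    exact: normr_cos_le1.
  exact: normr_sin_le1.
have hpsi0 x : setT x -> ~ K x -> psi h t x = 0.
  move=> _ nK; rewrite /psi; suff -> : h x = 0 by rewrite !mul0r.
  have [hs|hs] := leP `|x| r0; first exact: hin.
  have [hs2|hs2] := leP R0 `|x|; first exact: hout.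
  by exfalso; apply: nK; rewrite /K /= !ltW.
have hm := majorizes_mul _ _ _ _ _ _ _ measurableT mK (@subsetT _ K) H0 hpsi hpsi0 hw.
have hd : nrm (bintegral setT (fun x => psi h t x *: F x) - bintegral setT (fun x => psi h t x *: sfn s x))
    <= 2 * H * (e / (4 * (H + 1))).
  apply: (bint_dist setT _ _ _ _ _ _ measurableT (bintegralP _ _ measurableT aF) (bintegralP _ _ measurableT as_)).
  by apply: eq_majorizes hm => x _; rewrite scalerBr.
rewrite -[bintegral _ _](subrK (bintegral setT (fun x => psi h t x *: sfn s x))).
have [lD _ lB] := hl; rewrite lD; apply: le_trans (ler_normD _ _) _.
rewrite [e]splitr; apply: lerD; last by rewrite e1.
apply: le_trans (lB _) _; rewrite mul1r; apply: le_trans hd _.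
rewrite mulrA ler_pdivrMr// (_ : e / 2 * _ = 2 * H * e + 2 * e); last by field.
by rewrite lerDl mulr_ge0// ltW.
Qed.

End BandDecay.

(** * Convergence to zero *)

Section Decay.
Context {R : realType} {X : completeNormedModType R[i]}.
Variables (f : R -> X) (B L B1 : R).
Hypothesis fB : forall t, 0 <= t -> nrm (f t) <= B.
Hypothesis fL : forall s t, 0 <= s -> 0 <= t -> nrm (f t - f s) <= L * `|t - s|.
Hypothesis fB1 : forall t, 0 <= t -> nrm (bintegral [set s | 0 <= s <= t] f) <= B1.
Variable F : R -> X.
Hypothesis F1 : L1loc_punct F.
Hypothesis bF : boundary_function f F.

(** The bound [b] is asked for all functionals at once because the one that norms [f t] varies with
    [t]; [A] depends on none of [r], [R0], [t]. *)
Lemma norm_estimate n P : step_poly n P -> (2 <= n)%N ->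
  exists A, 0 <= A /\ forall r R0 t b, 0 < r -> 4 * r <= R0 -> 1 <= t ->
    (forall l : X -> R, rfunctional 1 l ->
       `|l (bintegral setT (fun s => psi (band P r R0) t s *: F s))| <= b) ->
    nrm (f t) <= A * (r + R0^-1) + b.
Proof.
move=> hP n2; pose A := (L + B) * (4 * poly_bound P * pi) + B1 * (16 * poly_bound P * (1 + pi)).
exists (Num.max A 0); split; first by rewrite le_max lexx orbT.
move=> r R0 t b r0 rR t1 hb.
have [l [hl lE]] := hahn_banach_norming (f t).
have t0 : 0 <= t by apply: le_trans t1; exact: ler01.
have := band_estimate f B L B1 fB fL fB1 F bF n P hP n2 l r R0 t hl r0 rR t1.
rewrite part_pos// lE ger0_norm ?nrm_ge0// => /le_trans; apply; apply: lerD; last exact: hb.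
apply: ler_wpM2r; last by rewrite le_max lexx.
have R00 : 0 < R0 by apply: lt_le_trans rR; rewrite mulr_gt0.
by rewrite addr_ge0// ?invr_ge0 ltW.
Qed.

Lemma decay : f t @[t --> +oo] --> (0 : X).
Proof.
have [P hP] := @step_poly_exists R 2; have [A [A0 hA]] := norm_estimate 2 P hP (leqnn 2).
apply: (proj2 (cvg_nrmP (pinfty_nbhs R) f 0)) => e e0.
(* With [R0 = r^-1] the error [A * (r + R0^-1)] stays below [e / 2], and [r <= 1/2] ensures
   [4 * r <= R0]. *)
pose r := Num.min 2^-1 (e / (4 * (A + 1))).
have A10 : 0 < 4 * (A + 1) by rewrite mulr_gt0// ltr_pwDr.
have r0 : 0 < r by rewrite lt_min invr_gt0 ltr0n divr_gt0.
have r2 : r <= 2^-1 by rewrite ge_min lexx.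
have re : r * (4 * (A + 1)) <= e by rewrite -ler_pdivlMr// ge_min lexx orbT.
have rR : 4 * r <= r^-1.
  rewrite -[_^-1]mul1r ler_pdivlMr//.
  have : r * r <= 2^-1 * 2^-1 by apply: ler_pM => //; exact: ltW.
  lra.
have rR' : r <= r^-1 by lra.
have [T hT] := band_decay F F1 (band P r r^-1) r r^-1 r0 rR' (continuous_band P r r^-1)
  (fun s => band_in 2 P hP r r^-1 s r0 rR) (fun s => band_out 2 P hP r r^-1 s r0 rR) (e / 4) (divr_gt0 e0 (ltr0n _ 4)).
near=> t.
have t1 : 1 <= t by near: t; exact: nbhs_pinfty_ge.
have tT : T <= t by near: t; apply: nbhs_pinfty_ge; exact: num_real.
rewrite sub0r nrmN.
have := hA r r^-1 t (e / 4) r0 rR t1 (fun l => hT t l tT).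
rewrite invrK => h.
have : A * (r + r) = (r * (4 * (A + 1)) - 4 * r) / 2 by field.
lra.
Unshelve. all: by end_near.
Qed.

End Decay.

(** * Rates for finitely many derivatives *)

Section FunctionalSplit.
Context {R : realType} {X : completeNormedModType R[i]}.
Local Notation mu := (@lebesgue_measure R).
Implicit Types (l : X -> R) (w : nat -> R -> R).

Definition smooth_pos k w := forall x : R, 0 < x ->
  (forall j, (j < k)%N -> is_derive x (1 : R) (w j) (w j.+1 x)) /\
  (forall j, (j <= k)%N -> {for x, continuous (w j)}).

Lemma smooth_pos_dsq k w a b : smooth_pos k w -> 0 < a -> dsq a b k w.
Proof. by move=> h a0 x /andP[ax _]; apply: h; exact: lt_le_trans ax. Qed.

Lemma is_derive_cvg (g : R -> R) (x d : R) :
  h^-1 * (g (x + h) - g x) @[h --> 0^'] --> d -> is_derive x (1 : R) g d.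
Proof.
move=> h.
have E : (fun h : R => h^-1 *: ((g \o shift x) (h *: 1) - g x)) = (fun h => h^-1 * (g (x + h) - g x)).
  by apply/funext => y; rewrite /= {2}/GRing.scale /= mulr1 [y + x]addrC.
have c : cvg ((fun h : R => h^-1 *: ((g \o shift x) (h *: 1) - g x)) @ 0^').
  by rewrite E; apply/cvg_ex; exists d.
apply: (DeriveDef c); rewrite /derive; apply: cvg_lim => //.
by rewrite E.
Qed.

Lemma is_deriveNx (g : R -> R) (x d : R) : is_derive (- x) (1 : R) g d ->
  is_derive x (1 : R) (fun y => g (- y)) (- d).
Proof.
move=> hg; have h : is_derive x (1 : R) (fun y : R => - y) (- 1).
  have -> : (fun y : R => - y) = - (id : R -> R) by [].
  by apply: is_derive_eq.
by have := @is_derive1_comp R g (fun y : R => - y) x _ _ hg h; rewrite mulrN1.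
Qed.

Section Functional.
Variables (k : nat) (F : R -> X) (G : nat -> R -> X) (B : R) (l : X -> R).
Hypotheses (hG : Ck_derivs k F G) (B0 : 0 <= B) (hl : rfunctional B l).

Let lle x y : `|l x - l y| <= (B + 1) * nrm (x - y).
Proof.
rewrite -(rfunB _ _ _ _ hl); case: hl => _ _ lB; apply: le_trans (lB _) _.
by apply: ler_wpM2r; [exact: nrm_ge0|rewrite lerDl].
Qed.

Let B10 : 0 < B + 1.
Proof. by rewrite ltr_pwDr. Qed.

Lemma functional_continuous j s : (j <= k)%N -> s != 0 -> {for s, continuous (fun x => l (G j x))}.
Proof.
move=> jk s0; have [_ _ /(_ j jk) cG] := hG.
have op : open (~` [set 0] : set R) by apply: closed_openC; exact: closed_eq.
have : {for s, continuous (G j)}.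
  rewrite continuous_open_subspace// in cG; apply: cG; rewrite inE /=.
  exact/eqP.
move=> /(cvg_nrmP _ _ _).1 h; apply/cvgrPdist_lt => e e0.
have := h _ (divr_gt0 e0 B10); apply: filterS => x.
by rewrite ltr_pdivlMr// mulrC; apply: le_lt_trans; exact: lle.
Qed.

Lemma functional_derive j s : (j < k)%N -> s != 0 ->
  is_derive s (1 : R) (fun x => l (G j x)) (l (G j.+1 s)).
Proof.
move=> jk s0; have [_ /(_ j s jk s0) dG _] := hG.
apply: is_derive_cvg; apply/cvgrPdist_lt => e e0.
have /(cvg_nrmP _ _ _).1 h := dG.
have := h _ (divr_gt0 e0 B10); apply: filterS => x.
rewrite ltr_pdivlMr// mulrC; apply: le_lt_trans.
have -> : x^-1 * (l (G j (s + x)) - l (G j s)) = l ((x^-1)%:C%C *: (G j (s + x) - G j s)).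
  by rewrite -(rfunB _ _ _ _ hl); case: hl => _ lZ _; rewrite -lZ.
exact: lle.
Qed.

(* [sg = 1] gives the cosine part and [sg = -1] the sine part of the even/odd splitting. *)
Lemma functional_smooth_pos (sg : R) :
  smooth_pos k (fun j s => l (G j s) + sg * ((-1) ^+ j * l (G j (- s)))).
Proof.
move=> x x0; have nx : x != 0 by rewrite gt_eqF.
have nx' : - x != 0 by rewrite oppr_eq0.
split => j jk.
  have d1 := functional_derive j x jk nx; have d2 := is_deriveNx _ _ _ (functional_derive j (- x) jk nx').
  rewrite (_ : (fun s => _) = (fun s => l (G j s)) + (sg * (-1) ^+ j) \*: (fun s => l (G j (- s)))); last first.
    by apply/funext => s; rewrite mulrA.
  by apply: is_derive_eq; rewrite exprS /GRing.scale /=; ring.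
apply: cvgD; first exact: functional_continuous.
apply: cvgM; first exact: cvg_cst.
apply: cvgM; first exact: cvg_cst.
apply: (@continuous_comp _ _ _ (fun x : R => - x) (fun x => l (G j x))).
  by apply: cvgN; exact: cvg_id.
exact: functional_continuous.
Qed.

End Functional.

Variables (k : nat) (F : R -> X) (G : nat -> R -> X).
Hypotheses (hG : Ck_derivs k F G) (F1 : L1loc_punct F).
Variables (n : nat) (P : {poly R}) (r R0 t b : R).
Hypotheses (hP : step_poly n P) (r0 : 0 < r) (rR : 4 * r <= R0).
Hypothesis hb : forall w th, smooth_pos k w ->
  (forall j s, (j <= k)%N -> 0 < s -> `|w j s| <= nrm (G j s) + nrm (G j (- s))) ->
  `|\int[mu]_(s in `[r, R0]) (band P r R0 s * w 0%N s * cos (s * t + th))| <= b.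

Let h := band P r R0.
Let rR0 : r <= R0. Proof. by have := r0; have := rR; move=> *; lra. Qed.

(** The cosine and the sine part of [psi], folded onto [[r, R0]], are scalar integrals of the same
    shape with phases 0 and [- (pi / 2)]; the factor 2 counts them. Hypothesis [hb] is stated for
    every [w] and [th] so as to serve both, and it sees [l] only through the norms of [G]. *)
Lemma functional_le l : rfunctional 1 l ->
  `|l (bintegral setT (fun s => psi h t s *: F s))| <= 2 * b.
Proof.
move=> hl; pose li x := l ('i%C *: x).
have hli : rfunctional 1 li := rfunctional_i _ _ hl.
have ch : continuous h := continuous_band P r R0.
have hin s : `|s| <= r -> h s = 0 by exact: (band_in n P hP).
have hout s : R0 <= `|s| -> h s = 0 by exact: (band_out n P hP).
pose g s := h s * l (G 0%N s) * cos (s * t + 0) + h s * li (G 0%N s) * cos (s * t + - (pi / 2)).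
have gE s : l (psi h t s *: F s) = g s.
  have [->|s0] := eqVneq s 0.
    by rewrite /g /psi hin ?normr0 ?ltW// !mul0r addr0 scale0r -(subrr 0) (rfunB _ _ _ _ hl) subrr.
  have [G0 _ _] := hG; rewrite -G0// (rfunZ _ _ _ _ hl) /= /g /li -sin_shift addr0; ring.
have cpart l' th : rfunctional 1 l' -> continuous (fun s => h s * l' (G 0%N s) * cos (s * t + th)).
  move=> hl' s; have [->|s0] := eqVneq s 0; last first.
    apply: cvgM; last exact: continuous_cos_lin.
    by apply: cvgM; [exact: ch|exact: (functional_continuous k F G 1 l' hG ler01 hl' 0 s)].
  (* At 0 the derivatives of [F] may blow up, but [h] vanishes on a whole neighbourhood. *)
  rewrite /continuous_at hin ?normr0 ?ltW// !mul0r; apply: cvg_near_cst.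
  apply/nbhs_ballP; exists r => //= x; rewrite /ball /= sub0r normrN => /ltW xr.
  by rewrite hin// !mul0r.
have ipart l' th : rfunctional 1 l' ->
    mu.-integrable setT (EFin \o (fun s => h s * l' (G 0%N s) * cos (s * t + th))).
  move=> hl'; apply: (integrable_support _ `[- R0, R0]) => //; first exact: segment_compact.
    by apply: continuous_subspaceT; exact: cpart.
  move=> s ns; rewrite hout ?mul0r// leNgt; apply/negP => hs; apply: ns => /=.
  by rewrite in_itv/= -ler_norml ltW.
have mg : measurable_fun setT (l \o (fun s => psi h t s *: F s)).
  rewrite (_ : _ \o _ = g); last by apply/funext => s /=; rewrite gE.
  apply: continuous_measurable_fun => s.
  by apply: cvgD; [exact: (cpart l)|exact: (cpart li)].
have aF := bapprox_psiF F F1 h r R0 r0 rR0 ch hin hout t.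
have [_ ->] := rfun_bintegral _ _ _ _ measurableT aF hl mg.
under eq_Rintegral do rewrite gE.
rewrite (RintegralD measurableT (ipart l 0 hl) (ipart li (- (pi / 2)) hli)).
have half (sg : R) l' th : `|sg| = 1 -> rfunctional 1 l' ->
    (forall s : R, cos (- s * t + th) = sg * cos (s * t + th)) ->
    `|\int[mu]_s (h s * l' (G 0%N s) * cos (s * t + th))| <= b.
  move=> sg1 hl' hcos.
  pose w j s := l' (G j s) + sg * ((-1) ^+ j * l' (G j (- s))).
  rewrite (Rintegral_even _ (ipart l' th hl')).
  have -> : \int[mu]_(s in `[0, +oo[) (h s * l' (G 0%N s) * cos (s * t + th) +
      h (- s) * l' (G 0%N (- s)) * cos (- s * t + th)) =
    \int[mu]_(s in `[0, +oo[) (h s * w 0%N s * cos (s * t + th)).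
    by apply: eq_Rintegral => s _; rewrite hcos /h bandN /w expr0; ring.
  rewrite (Rintegral_support _ `[r, R0]) //.
  - apply: hb; first exact: (functional_smooth_pos k F G 1 l' hG ler01 hl' sg).
    move=> j s jk s0; rewrite /w; apply: le_trans (ler_normD _ _) _.
    rewrite !normrM sg1 normrX normrN1 expr1n !mul1r.
    by have [_ _ lB] := hl'; apply: lerD; apply: le_trans (lB _) _; rewrite mul1r.
  - by move=> x /=; rewrite !in_itv/= andbT => /andP[x1 _]; apply: le_trans x1; exact: ltW.
  move=> x /=; rewrite !in_itv/= andbT => x0 nx.
  have [xr|xr] := leP `|x| r; first by rewrite hin// !mul0r.
  have [xR|xR] := leP R0 `|x|; first by rewrite hout// !mul0r.
  by exfalso; apply: nx; rewrite ger0_norm// in xr xR; rewrite !ltW.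
have -> : 2 * b = b + b by ring.
apply: le_trans (ler_normD _ _) _; apply: lerD.
  by apply: (half 1) => //; [rewrite normr1|move=> s; rewrite !addr0 mulNr cosN mul1r].
apply: (half (-1)) => //; first by rewrite normrN1.
by move=> s; rewrite -!sin_shift mulNr sinN mulN1r.
Qed.

End FunctionalSplit.

(** * Integration by parts over a band *)

Section OscBand.
Context {R : realType}.
Local Notation mu := (@lebesgue_measure R).

(** The boundary values at [2 * r] and at [R0 / 2] telescope; the two values at 1 need not agree,
    and their difference stays. *)
Lemma five_terms (I1 I2 I3 I4 b2r b1 b1' bR e1 e2 e3 e4 : R) :
  `|I1 - b2r| <= e1 -> `|I2 - (b1 - b2r)| <= e2 -> `|I3 - (bR - b1')| <= e3 -> `|I4 + bR| <= e4 ->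
  `|I1 + (I2 + (I3 + I4))| <= e1 + e2 + `|b1 - b1'| + e3 + e4.
Proof.
move=> h1 h2 h3 h4.
have -> : I1 + (I2 + (I3 + I4)) = (I1 - b2r) + (I2 - (b1 - b2r)) + (b1 - b1') + (I3 - (bR - b1')) + (I4 + bR) by ring.
apply: le_trans (ler_normD _ _) (lerD _ h4); apply: le_trans (ler_normD _ _) (lerD _ h3).
by apply: le_trans (ler_normD _ _) (lerD _ (lexx _)); apply: le_trans (ler_normD _ _) (lerD h1 h2).
Qed.

Variables (n : nat) (P : {poly R}) (r R0 t : R).
Hypotheses (hP : step_poly n P) (r0 : 0 < r) (r1 : 2 * r <= 1) (R1 : 2 <= R0) (t0 : 0 < t).

(* Integrating by parts a different number of times below and above frequency [1] leaves a
   boundary term there. *)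
Lemma osc_band (w : nat -> R -> R) k k1 k2 th A1 A2 A3 A4 : smooth_pos k w ->
  (k1 <= k)%N -> (k2 <= k)%N ->
  (forall s, r <= s <= 2 * r -> `|leib (qrise P (2 * r)) w k1 s| <= A1) ->
  (forall s, 2 * r <= s <= 1 -> `|w k1 s| <= A2) ->
  (forall s, 1 <= s <= R0 / 2 -> `|w k2 s| <= A3) ->
  (forall s, R0 / 2 <= s <= R0 -> `|leib (qfall P R0) w k2 s| <= A4) ->
  `|\int[mu]_(s in `[r, R0]) (band P r R0 s * w 0%N s * cos (s * t + th))| <=
  (\sum_(j < k1) t ^- j.+1 * (jump n (qrise P (2 * r)) w j r + jump n (qrise P (2 * r)) w j (2 * r)) +
     t ^- k1 * A1 * (2 * r - r)) + t ^- k1 * A2 * (1 - 2 * r) +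
  `|bdry k1 w t th 1 - bdry k2 w t th 1| + t ^- k2 * A3 * (R0 / 2 - 1) +
  (\sum_(j < k2) t ^- j.+1 * (jump n (qfall P R0) w j (R0 / 2) + jump n (qfall P R0) w j R0) +
     t ^- k2 * A4 * (R0 - R0 / 2)).
Proof.
move=> hw k1k k2k a1 a2 a3 a4.
have r00 := r0; have r10 := r1; have R10 := R1.
have R00 : 0 < R0 by lra.
have r20 : 0 < 2 * r by lra.
have dw a b kk : (kk <= k)%N -> 0 < a -> dsq a b kk w.
  move=> le a0 x /(smooth_pos_dsq _ _ _ _ hw a0)[h1 h2]; split => j jk.
    by apply: h1; exact: leq_trans jk le.
  by apply: h2; exact: leq_trans jk le.
have cg x : r <= x -> {for x, continuous (fun s => band P r R0 s * w 0%N s * cos (s * t + th))}.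
  move=> rx; apply: cvgM; last exact: continuous_cos_lin.
  apply: cvgM; first exact: continuous_band.
  by have [_ h] := hw x (lt_le_trans r0 rx); exact: h.
have ig a b : r <= a -> mu.-integrable `[a, b] (EFin \o (fun s => band P r R0 s * w 0%N s * cos (s * t + th))).
  by move=> ra; apply: integrable_itv => x /andP[ax _]; apply: cg; exact: le_trans ax.
rewrite (Rintegral_itv_split _ r (2 * r) R0); [|lra|lra|exact: ig].
rewrite (Rintegral_itv_split _ (2 * r) 1 R0); [|lra|lra|apply: ig; lra].
rewrite (Rintegral_itv_split _ 1 (R0 / 2) R0); [|lra|lra|apply: ig; lra].
have c1 s : s <= R0 / 2 -> 0 <= s -> cutoff P R0 s = 1.
  by move=> h1 h2; apply: (cutoff_flat n) => //; rewrite ger0_norm.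
have c2 s : 2 * r <= s -> cutoff P (2 * r) s = 0.
  by move=> h2; apply: (cutoff_out n) => //; rewrite ger0_norm//; lra.
have -> : \int[mu]_(s in `[r, 2 * r]) (band P r R0 s * w 0%N s * cos (s * t + th)) =
    \int[mu]_(s in `[r, 2 * r]) (qrise P (2 * r) 0 s * w 0%N s * cos (s * t + th)).
  apply: eq_Rintegral => s; rewrite inE/= in_itv/= => /andP[s1 s2].
  rewrite /band c1; [|lra|lra].
  by rewrite (cutoff_fall P (2 * r)) //; lra.
have -> : \int[mu]_(s in `[2 * r, 1]) (band P r R0 s * w 0%N s * cos (s * t + th)) =
    \int[mu]_(s in `[2 * r, 1]) (w 0%N s * cos (s * t + th)).
  apply: eq_Rintegral => s; rewrite inE/= in_itv/= => /andP[s1 s2].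
  by rewrite /band c1; [rewrite c2// subr0 mul1r|lra|lra].
have -> : \int[mu]_(s in `[1, R0 / 2]) (band P r R0 s * w 0%N s * cos (s * t + th)) =
    \int[mu]_(s in `[1, R0 / 2]) (w 0%N s * cos (s * t + th)).
  apply: eq_Rintegral => s; rewrite inE/= in_itv/= => /andP[s1 s2].
  by rewrite /band c1; [rewrite c2 ?subr0 ?mul1r//; lra|lra|lra].
have -> : \int[mu]_(s in `[R0 / 2, R0]) (band P r R0 s * w 0%N s * cos (s * t + th)) =
    \int[mu]_(s in `[R0 / 2, R0]) (qfall P R0 0 s * w 0%N s * cos (s * t + th)).
  apply: eq_Rintegral => s; rewrite inE/= in_itv/= => /andP[s1 s2].
  by rewrite /band c2; [rewrite subr0 cutoff_fall// s1 s2|lra].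
apply: (five_terms _ _ _ _ (bdry k1 w t th (2 * r)) (bdry k1 w t th 1) (bdry k2 w t th 1) (bdry k2 w t th (R0 / 2))).
- apply: osc_rise => //; [lra|exact: dw|exact: is_derive_qrise| |].
    move=> i ni; rewrite {2}(_ : r = 2 * r / 2); last by field.
    exact: (qrise_half n).
  by move=> i ni; exact: (qrise_top n).
- by apply: osc_flat => //; exact: dw.
- by apply: osc_flat => //; [lra|exact: dw].
- apply: osc_fall => //; [lra|apply: dw => //; lra|exact: is_derive_qfall| |].
    by move=> i ni; exact: (qfall_half n).
  by move=> i ni; exact: (qfall_top n).
Qed.

End OscBand.

(** * Arithmetic of [m_k] and [M_k] *)

Section Numeric.
Context {R : realType}.

Lemma leib_le q w k (s E : R) : (forall i, (i <= k)%N -> `|q i s| * `|w (k - i)%N s| <= E) ->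
  `|leib q w k s| <= 2 ^+ k * E.
Proof.
move=> h; apply: le_trans (ler_norm_sum _ _ _) _.
have -> : (2 : R) ^+ k = \sum_(i < k.+1) 'C(k, i)%:R.
  rewrite (_ : 2 = 1 + 1); last by ring.
  by rewrite exprDn; apply: eq_bigr => i _; rewrite !expr1n mulr1.
rewrite mulr_suml; apply: ler_sum => i _; rewrite !normrM normr_nat -mulrA.
by apply: ler_wpM2l => //; exact: h (leq_ord i).
Qed.

Lemma root_exp (a : R) k : 0 <= a -> (0 < k)%N -> (a `^ (k%:R)^-1) ^+ k = a.
Proof.
move=> a0 k0; rewrite -powR_mulrn ?powR_ge0// -powRrM mulVf ?powRr1//.
by rewrite pnatr_eq0 -lt0n.
Qed.

(** This is the balance that defines [m_k]: with [y = c * t], the remainder [m r ^+ k.+1 / t ^+ k]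
    is a constant multiple of [r]. *)
Lemma m_k_eq (m : R -> R) k r y : 0 < r -> 0 < m r -> (0 < k)%N -> m_k m k r = y ->
  m r ^+ k.+1 = y ^+ k * r.
Proof.
move=> r0 m0 k0 <-; rewrite /m_k exprMn root_exp//; last by rewrite divr_ge0 ?ltW.
by rewrite exprSr -mulrA divfK// gt_eqF.
Qed.

(** The factor [(1 + R)^2] in [M_k] provides one power for the length of the band, on the left, and
    one for the target [1 / x]. *)
Lemma M_k_eq (M : R -> R) k x y : 0 < x -> 0 < M x -> (0 < k)%N -> M_k M k x = y ->
  x * M x ^+ k.+1 <= y ^+ k / x.
Proof.
move=> x0 M0 k0 <-; rewrite /M_k exprMn root_exp//; last first.
  by rewrite mulr_ge0 ?ltW// exprn_gt0// addr_gt0.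
rewrite ler_pdivlMr// exprSr.
have -> : x * (M x ^+ k * M x) * x = M x ^+ k * (x ^+ 2 * M x) by ring.
apply: ler_wpM2l; first by rewrite exprn_ge0// ltW.
apply: ler_wpM2r; first exact: ltW.
by rewrite lerXn2r ?nnegrE ?addr_ge0 ?ltW// ltr_pwDl.
Qed.

Lemma m_k_ge (m : R -> R) k r a : 0 < a -> a <= r -> 0 < m r -> m r <= m a -> m_k m k r <= m_k m k a.
Proof.
move=> a0 ar m0 ma; have r0 := lt_le_trans a0 ar; rewrite /m_k.
apply: ler_pM => //; [exact: ltW|exact: powR_ge0|].
have ma0 := lt_le_trans m0 ma.
apply: ge0_ler_powR; rewrite ?nnegrE ?invr_ge0//; [exact: divr_ge0 (ltW _) (ltW _)|exact: divr_ge0 (ltW _) (ltW _)|].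
by apply: ler_pM => //; [exact: ltW|rewrite invr_ge0 ltW|rewrite lef_pV2 ?posrE].
Qed.

Lemma M_k_le (M : R -> R) k x a : 0 < x -> x <= a -> 0 < M x -> M x <= M a -> M_k M k x <= M_k M k a.
Proof.
move=> x0 xa M0 Ma; have a0 := lt_le_trans x0 xa; have Ma0 := lt_le_trans M0 Ma; rewrite /M_k.
apply: ler_pM => //; [exact: ltW|exact: powR_ge0|].
have p0 (y : R) : 0 < y -> 0 <= (1 + y) ^+ 2 by move=> y0; rewrite exprn_ge0// addr_ge0// ltW.
have := ltW M0; have := ltW Ma0 => h1 h2.
apply: ge0_ler_powR; rewrite ?nnegrE ?invr_ge0//; [exact: mulr_ge0 (p0 _ _) _|exact: mulr_ge0 (p0 _ _) _|].
apply: ler_pM => //; first exact: p0.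
by rewrite lerXn2r ?nnegrE ?lerD2l// addr_ge0// ltW.
Qed.

End Numeric.

Lemma osc_band_Ck_arith (R : realType) (T K0 mm MM r R0 c t : R) k : 0 < t -> 0 < r -> 1 <= R0 -> 0 <= K0 ->
  0 <= mm -> 0 <= MM -> 0 <= c ->
  mm = (c * t) ^+ k * r -> R0 * MM <= (c * t) ^+ k / R0 -> T = t ^- k ->
  (0 + T * (K0 * mm) * (2 * r - r)) + T * (K0 * mm) * (1 - 2 * r) + 0 +
    T * (K0 * MM) * (R0 / 2 - 1) + (0 + T * (K0 * MM) * (R0 - R0 / 2)) <= K0 * c ^+ k * (r + R0^-1).
Proof.
move=> t0 r0 R1 K00 m0 M0 c0 e1 e2 eT.
have tk : 0 < t ^+ k by rewrite exprn_gt0.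
have T0 : 0 < T by rewrite eT invr_gt0.
have h1 : T * mm = c ^+ k * r by rewrite e1 eT exprMn; field; rewrite gt_eqF.
have h2 : T * (R0 * MM) <= c ^+ k / R0.
  apply: le_trans (ler_wpM2l (ltW T0) e2) _; rewrite eT exprMn le_eqVlt; apply/orP; left; apply/eqP; field.
  by rewrite !gt_eqF//; lra.
have -> : (0 + T * (K0 * mm) * (2 * r - r)) + T * (K0 * mm) * (1 - 2 * r) + 0 +
    T * (K0 * MM) * (R0 / 2 - 1) + (0 + T * (K0 * MM) * (R0 - R0 / 2)) =
   K0 * (T * mm * (1 - r) + (T * (R0 * MM) - T * MM)) by field.
rewrite -[leRHS]mulrA; apply: ler_wpM2l => //; rewrite h1 [leRHS]mulrDr; apply: lerD.
  have p : 0 <= c ^+ k * r by rewrite mulr_ge0 ?exprn_ge0// ltW.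
  by rewrite ler_piMr//; lra.
have : 0 <= T * MM by rewrite mulr_ge0// ltW.
lra.
Qed.

(** * The rate obtained from [k] derivatives *)

Section RateCk.
Context {R : realType} {X : completeNormedModType R[i]}.
Variables (f : R -> X) (B L B1 : R).
Hypothesis fB : forall t, 0 <= t -> nrm (f t) <= B.
Hypothesis fL : forall s t, 0 <= s -> 0 <= t -> nrm (f t - f s) <= L * `|t - s|.
Hypothesis fB1 : forall t, 0 <= t -> nrm (bintegral [set s | 0 <= s <= t] f) <= B1.
Variable F : R -> X.
Hypothesis F1 : L1loc_punct F.
Hypothesis bF : boundary_function f F.
Variables (m M : R -> R).
Hypothesis m1 : forall r, 0 < r <= 1 -> 1 <= m r.
Hypothesis m_dec : forall r r', 0 < r -> r <= r' -> r' <= 1 -> m r' <= m r.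
Hypothesis M1 : forall x, 1 <= x -> 1 <= M x.
Hypothesis M_inc : forall x y, 1 <= x -> x <= y -> M x <= M y.

(** The same number [k] of integrations below and above frequency 1 cancels the boundary term there,
    and [k <= n + 1] removes the jumps. Near [r] the [i]-th derivative of the cutoff costs
    [(2 * r) ^- i], which the factor [s ^+ i] in the bound on derivative number [k - i]
    compensates. *)
Lemma osc_band_Ck k n P C r R0 t (G : nat -> R -> X) w th : step_poly n P -> (k <= n.+1)%N -> (1 <= k)%N ->
  0 < C ->
  (forall j s, (j <= k)%N -> 0 < `|s| <= 1 -> nrm (G j s) <= C * `|s| ^+ (k - j) * m `|s| ^+ k.+1) ->
  (forall j s, (j <= k)%N -> 1 <= `|s| -> nrm (G j s) <= C * M `|s| ^+ j.+1) ->
  0 < r -> 2 * r <= 1 -> 2 <= R0 -> 0 < t -> smooth_pos k w ->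
  (forall j s, (j <= k)%N -> 0 < s -> `|w j s| <= nrm (G j s) + nrm (G j (- s))) ->
  forall c, 0 < c -> m_k m k r = c * t -> M_k M k R0 = c * t ->
  `|\int[@lebesgue_measure R]_(s in `[r, R0]) (band P r R0 s * w 0%N s * cos (s * t + th))| <=
  2 ^+ k * ((1 + poly_bound P) * (2 * C)) * c ^+ k * (r + R0^-1).
Proof.
move=> hP kn k0 C0 hl hh r0 r1 R2 t0 hw wG c c0 er eR.
have pb1 := poly_bound_ge1 n P hP.
have pb0 : 0 <= poly_bound P := poly_bound_ge0 P.
have C2 : 0 <= 2 * C := mulr_ge0 (ler0n _ 2) (ltW C0).
pose K0 := 2 ^+ k * ((1 + poly_bound P) * (2 * C)).
have K1 : 2 * C <= K0.
  rewrite (_ : K0 = 2 ^+ k * (1 + poly_bound P) * (2 * C)); last by rewrite /K0 mulrA.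
  apply: ler_peMl; first by lra.
  by apply: mulr_ege1; [rewrite exprn_ege1//|]; lra.
have wl j s : (j <= k)%N -> 0 < s -> s <= 1 -> `|w j s| <= 2 * C * s ^+ (k - j) * m s ^+ k.+1.
  move=> jk s0 s1; apply: le_trans (wG j s jk s0) _.
  have h1 := hl j s jk; have h2 := hl j (- s) jk.
  rewrite normrN gtr0_norm// in h1 h2.
  have -> : 2 * C * s ^+ (k - j) * m s ^+ k.+1 = C * s ^+ (k - j) * m s ^+ k.+1 + C * s ^+ (k - j) * m s ^+ k.+1 by ring.
  by apply: lerD; [apply: h1|apply: h2]; rewrite s0 s1.
have wh j s : (j <= k)%N -> 1 <= s -> `|w j s| <= 2 * C * M s ^+ j.+1.
  move=> jk s1; have s0 : 0 < s by lra.
  apply: le_trans (wG j s jk s0) _.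
  have h1 := hh j s jk; have h2 := hh j (- s) jk.
  rewrite normrN gtr0_norm// in h1 h2.
  have -> : 2 * C * M s ^+ j.+1 = C * M s ^+ j.+1 + C * M s ^+ j.+1 by ring.
  by apply: lerD; [exact: h1|exact: h2].
have mr0 : 0 < m r by apply: lt_le_trans (m1 r _) => //; rewrite r0; lra.
have MR0 : 1 <= M R0 by apply: M1; lra.
have mle s : r <= s -> s <= 1 -> m s ^+ k.+1 <= m r ^+ k.+1.
  move=> rs s1; have s0 : 0 < s by lra.
  have ms : 1 <= m s by apply: m1; rewrite s0.
  by rewrite lerXn2r ?nnegrE//; [lra|lra|exact: m_dec].
have Mle j s : (j <= k)%N -> 1 <= s -> s <= R0 -> M s ^+ j.+1 <= M R0 ^+ k.+1.
  move=> jk s1 sR; have Ms := M1 s s1.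
  apply: (@le_trans _ _ (M R0 ^+ j.+1)); last by rewrite ler_weXn2l.
  by rewrite lerXn2r ?nnegrE//; [lra|lra|exact: M_inc].
have R00 : 0 < R0 by lra.
have r20 : 0 < 2 * r by lra.
have rr2 : r <= 2 * r by lra.
have R21 : 1 <= R0 / 2 by lra.
have R2R : R0 / 2 <= R0 by lra.
have mk0 : 0 <= m r ^+ k.+1 by rewrite exprn_ge0// ltW.
have Mk0 : 0 <= M R0 ^+ k.+1 by rewrite exprn_ge0//; lra.
have := osc_band n P r R0 t hP r0 r1 R2 t0 w k k k th (K0 * m r ^+ k.+1) (K0 * m r ^+ k.+1)
  (K0 * M R0 ^+ k.+1) (K0 * M R0 ^+ k.+1) hw (leqnn k) (leqnn k).
have J0 q x : \sum_(j < k) t ^- j.+1 * (jump n q w j x) = 0.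
  apply: big1 => j _; rewrite jump_eq0 ?mulr0// -ltnS; exact: leq_trans (ltn_ord j) kn.
have J q x y : \sum_(j < k) t ^- j.+1 * (jump n q w j x + jump n q w j y) = 0.
  under eq_bigr do rewrite mulrDr.
  by rewrite big_split /= !J0 addr0.
rewrite !J subrr normr0 => H; apply: le_trans (H _ _ _ _) _ => {H}.
- move=> s /andP[s1 s2]; have s0 : 0 < s by lra.
  have s11 : s <= 1 by lra.
  rewrite /K0 -(mulrA (2 ^+ k)); apply: leib_le => i ik.
  have h1 := qrise_le P (2 * r) r20 i s; have h2 := wl (k - i)%N s (leq_subr i k) s0 s11.
  rewrite subKn// in h2.
  have s01 : 0 <= s <= 2 * r by rewrite ltW.
  apply: le_trans (ler_pM (normr_ge0 _) (normr_ge0 _) (h1 s01) h2) _.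
  have q1 : (2 * r) ^- i * s ^+ i <= 1.
    rewrite mulrC ler_pdivrMr ?exprn_gt0// mul1r lerXn2r ?nnegrE//; exact: ltW.
  have -> : (1 + poly_bound P) * (2 * r) ^- i * (2 * C * s ^+ i * m s ^+ k.+1) =
     ((1 + poly_bound P) * (2 * C)) * ((2 * r) ^- i * s ^+ i * m s ^+ k.+1) by ring.
  apply: ler_wpM2l; first exact: mulr_ge0 (addr_ge0 ler01 pb0) C2.
  rewrite -[leRHS]mul1r; apply: ler_pM => //.
  - by rewrite mulr_ge0 ?invr_ge0 ?exprn_ge0 ?ltW.
  - by rewrite exprn_ge0//; apply: le_trans (m1 s _); rewrite ?ler01 ?s0.
  - exact: mle.
- move=> s /andP[s1 s2]; have s0 : 0 < s by lra.
  apply: le_trans (wl k s (leqnn k) s0 s2) _.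
  rewrite subnn expr0 mulr1; apply: ler_pM => //; [rewrite exprn_ge0//|apply: mle => //; exact: le_trans rr2 s1].
  by apply: le_trans (m1 s _); rewrite ?ler01 ?s0.
- move=> s /andP[s1 s2]; apply: le_trans (wh k s (leqnn k) s1) _.
  apply: ler_pM => //; [rewrite exprn_ge0//|apply: Mle => //; exact: le_trans s2 R2R].
  by apply: le_trans (M1 s s1); rewrite ler01.
- move=> s /andP[s1 s2]; have s11 : 1 <= s := le_trans R21 s1.
  rewrite /K0 -(mulrA (2 ^+ k)); apply: leib_le => i ik.
  have h1 := qfall_le P R0 R00 i s; have h2 := wh (k - i)%N s (leq_subr i k) s11.
  have s01 : 0 <= s <= R0 by rewrite s2 andbT; exact: le_trans ler01 s11.
  apply: le_trans (ler_pM (normr_ge0 _) (normr_ge0 _) (h1 s01) h2) _.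
  have q1 : R0 ^- i <= 1 by rewrite invf_le1 ?exprn_gt0// exprn_ege1//; lra.
  have q2 := Mle (k - i)%N s (leq_subr i k) s11 s2.
  have -> : poly_bound P * R0 ^- i * (2 * C * M s ^+ (k - i).+1) =
     (poly_bound P * (2 * C)) * (R0 ^- i * M s ^+ (k - i).+1) by ring.
  have M0 : 0 <= M s ^+ (k - i).+1 by rewrite exprn_ge0//; apply: le_trans (M1 s s11).
  have Ri0 : 0 <= R0 ^- i by rewrite invr_ge0 exprn_ge0// ltW.
  apply: ler_pM.
  - exact: mulr_ge0 pb0 C2.
  - exact: mulr_ge0.
  - by apply: ler_wpM2r => //; rewrite lerDr.
  by rewrite -[leRHS]mul1r; apply: ler_pM.
rewrite -!addrA; have := osc_band_Ck_arith R (t ^- k) K0 (m r ^+ k.+1) (M R0 ^+ k.+1) r R0 c t k t0 r0 _ _ mk0 Mk0 (ltW c0).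
rewrite -!addrA; apply => //; [lra|lra| |].
- by apply: m_k_eq.
- by apply: M_k_eq => //; lra.
Qed.

(** Values of the inverse functions enter as solutions [r] and [x] of the two balance equations,
    which [m_k_eq] and [M_k_eq] use directly. *)
Theorem decay_Ck k C (G : nat -> R -> X) c : (1 <= k)%N -> Ck_derivs k F G -> 0 < C ->
  (forall j s, (j <= k)%N -> 0 < `|s| <= 1 -> nrm (G j s) <= C * `|s| ^+ (k - j) * m `|s| ^+ k.+1) ->
  (forall j s, (j <= k)%N -> 1 <= `|s| -> nrm (G j s) <= C * M `|s| ^+ j.+1) -> 0 < c ->
  exists K t0 : R, forall t, t0 <= t ->
    forall r x, 0 < r <= 1 -> m_k m k r = c * t -> 1 <= x -> M_k M k x = c * t ->
    nrm (f t) <= K * (r + x^-1).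
Proof.
move=> k0 hG C0 hl hh c0.
(* Flatness 2 serves the decay of the kernels, flatness [k] the absence of jumps. *)
pose n := maxn k 2; have n2 : (2 <= n)%N by rewrite leq_maxr.
have kn : (k <= n.+1)%N by apply: leqW; rewrite leq_maxl.
have [P hP] := @step_poly_exists R n.
have [A [A0 hA]] := norm_estimate f B L B1 fB fL fB1 F bF n P hP n2.
pose K0 := 2 ^+ k * ((1 + poly_bound P) * (2 * C)) * c ^+ k.
(* Once [c * t] exceeds both thresholds, monotonicity of [m_k] and [M_k] forces [r <= 1/4] and
   [x >= 4], so that the transition zones do not meet. *)
pose T1 := m_k m k 4^-1; pose T2 := M_k M k 4.
exists (A + 2 * K0), (1 + (`|T1| + `|T2|) / c) => t ht r x /andP[r0 r1] er x1 ex.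
have t1 : 1 <= t by apply: le_trans ht; rewrite lerDl divr_ge0 ?addr_ge0// ltW.
have tT : `|T1| + `|T2| < c * t.
  rewrite mulrC -ltr_pdivrMr//; apply: lt_le_trans ht; lra.
have rr : r <= 4^-1.
  rewrite leNgt; apply/negP => r4.
  have mr : 0 < m r by apply: lt_le_trans (m1 r _) => //; rewrite r0.
  have i4 : 0 < 4^-1 :> R by rewrite invr_gt0.
  have := m_k_ge m k r 4^-1 i4 (ltW r4) mr (m_dec _ _ i4 (ltW r4) r1).
  rewrite er -/T1 => h; have := ler_norm T1; have := normr_ge0 T2; lra.
have xx : 4 <= x.
  rewrite leNgt; apply/negP => x4.
  have Mx : 0 < M x by apply: lt_le_trans (M1 x x1).
  have := M_k_le M k x 4 (lt_le_trans ltr01 x1) (ltW x4) Mx (M_inc _ _ x1 (ltW x4)).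
  rewrite ex -/T2 => h; have := ler_norm T2; have := normr_ge0 T1; lra.
rewrite mulrDl -mulrA; apply: hA => //; [lra|].
have t0 : 0 < t by lra.
have r2 : 2 * r <= 1 by lra.
have x2 : 2 <= x by lra.
have rx : 4 * r <= x by lra.
move=> l hl'; apply: (functional_le k F G hG F1 n P r x t _ hP r0 rx) => // w th hw wG.
exact: (osc_band_Ck k n P C r x t G w th hP kn k0 C0 hl hh r0 r2 x2 t0 hw wG c c0 er ex).
Qed.

End RateCk.

(** * Rates for infinitely many derivatives *)

Section FactorialBounds.
Context {R : realType}.

(* The induction step is [e <= (1 + 1/k)^(k+1)], from [1 - 1/(k+1) <= exp (- 1/(k+1))]. *)
Lemma fact_expR_le k : k.+1`!%:R * expR k.+1%:R <= expR 1 * k.+1%:R ^+ k.+2 :> R.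
Proof.
elim: k => [|k IH]; first by rewrite factS fact0 muln1 expr1n mul1r mulr1.
have k0 : 0 < k.+2%:R :> R by [].
have key : expR 1 * k.+1%:R ^+ k.+2 <= k.+2%:R ^+ k.+2 :> R.
  have h1 : k.+1%:R / k.+2%:R <= expR (- k.+2%:R^-1) :> R.
    apply: le_trans (expR_ge1Dx _); rewrite le_eqVlt; apply/orP; left; apply/eqP.
    have E : k.+2%:R = k.+1%:R + 1 :> R by rewrite natr1.
    have gen (u : R) : u + 1 != 0 -> u / (u + 1) = 1 + - (u + 1)^-1 by move=> h; field.
    by rewrite [in LHS]E [in RHS]E gen// natr1 gt_eqF.
  have h2 : (k.+1%:R / k.+2%:R) ^+ k.+2 <= expR (- k.+2%:R^-1) ^+ k.+2 :> R.
    by rewrite lerXn2r ?nnegrE ?divr_ge0// expR_ge0.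
  rewrite -expRM_natl mulrN divff ?gt_eqF// expRN in h2.
  rewrite exprMn exprVn ler_pdivrMr ?exprn_gt0// in h2.
  by rewrite mulrC -ler_pdivlMr ?expR_gt0// mulrC.
rewrite factS natrM -[in expR _]natr1 expRD exprS.
have -> : k.+2%:R * k.+1`!%:R * (expR k.+1%:R * expR 1) = k.+2%:R * (expR 1 * (k.+1`!%:R * expR k.+1%:R)) :> R by ring.
rewrite [leRHS]mulrCA; apply: ler_wpM2l => //; apply: ler_wpM2l; first exact: expR_ge0.
exact: le_trans IH key.
Qed.

(** The Stirling-type bound [k! <= e * k^(k+1) * exp (- k)], where [k <= y < k + 1] replaces [k] by
    [y] at the cost of one more factor [e]. The case [k = 0] is separate. *)
Lemma fact_truncn_le (y : R) : 0 < y ->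
  (Num.truncn y)`!%:R / y ^+ Num.truncn y <= expR 1 ^+ 2 * (1 + y) * expR (- y).
Proof.
move=> y0; set k := Num.truncn y.
have /andP[ky yk] := truncn_itv (ltW y0); rewrite -/k in ky yk.
have e0 := @expR_gt0 R 1.
have yk1 : expR y <= expR k%:R * expR 1 by rewrite -expRD ler_expR natr1 ltW.
rewrite expRN ler_pdivlMr ?expR_gt0// mulrAC ler_pdivrMr ?exprn_gt0//.
case: (posnP k) => [k0|kp].
  rewrite k0 expr0 fact0 mul1r mulr1; apply: le_trans yk1 _; rewrite k0 expR0 mul1r.
  rewrite expr2 -mulrA; apply: ler_peMr; first exact: ltW.
  by apply: mulr_ege1; [apply: le_trans (expR_ge1Dx _)|]; lra.
have := fact_expR_le k.-1; rewrite prednK// exprS => h.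
apply: (@le_trans _ _ (k`!%:R * (expR k%:R * expR 1))); first exact: ler_wpM2l.
rewrite mulrA expr2; have -> : expR 1 * expR 1 * (1 + y) * y ^+ k = (expR 1 * ((1 + y) * y ^+ k)) * expR 1 by ring.
apply: ler_wpM2r; first exact: ltW.
apply: le_trans h _; apply: ler_wpM2l; first exact: ltW.
have k0 : 0 <= k%:R :> R by [].
apply: ler_pM => //; [lra|].
by rewrite lerXn2r ?nnegrE// ltW.
Qed.

(** The [N]-th power of [1 + y <= (N / a) * (1 + a * y / N) <= (N / a) * exp (a * y / N)]. *)
Lemma expn_le_expR N (a y : R) : (0 < N)%N -> 0 < a -> a <= 1 -> 0 <= y ->
  (1 + y) ^+ N <= (N%:R / a) ^+ N * expR (a * y).
Proof.
move=> N0 a0 a1 y0; have Np : 0 < N%:R :> R by rewrite ltr0n.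
have h1 : 1 + a * y / N%:R <= expR (a * y / N%:R) by exact: expR_ge1Dx.
have -> : expR (a * y) = expR (a * y / N%:R) ^+ N.
  by rewrite -expRM_natl [N%:R * _]mulrC divfK// gt_eqF.
have p0 : 0 <= 1 + a * y / N%:R by apply: addr_ge0 => //; apply: divr_ge0 => //; apply: mulr_ge0 => //; exact: ltW.
have q0 : 0 <= N%:R / a by rewrite divr_ge0// ltW.
have y10 : 0 <= 1 + y by rewrite addr_ge0.
have q1 : 0 <= N%:R / a * expR (a * y / N%:R) := mulr_ge0 q0 (expR_ge0 _).
rewrite -exprMn (lerXn2r N (y10 : 1 + y \is Num.nneg) q1)//.
apply: (@le_trans _ _ (N%:R / a * (1 + a * y / N%:R))); last first.
  by apply: ler_wpM2l => //; rewrite divr_ge0// ltW.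
have -> : N%:R / a * (1 + a * y / N%:R) = N%:R / a + y by field; rewrite !gt_eqF.
rewrite lerD2r ler_pdivlMr// mul1r; apply: le_trans a1 _.
by rewrite ler1n.
Qed.

(** Giving up the part [a = 1 - b] of the exponential rate pays for [D + 1] powers of [1 + y]: the
    [D] of the statement and the one in [fact_truncn_le]. *)
Lemma fact_truncn_expR D (b : R) : 0 < b < 1 -> exists Th, 0 <= Th /\ forall y, 0 < y ->
  (Num.truncn y)`!%:R / y ^+ Num.truncn y * (1 + y) ^+ D <= Th * expR (- (b * y)).
Proof.
move=> /andP[b0 b1]; pose a := 1 - b.
have a0 : 0 < a by rewrite /a; lra.
have a1 : a <= 1 by rewrite /a; lra.
exists (expR 1 ^+ 2 * (D.+1%:R / a) ^+ D.+1); split.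
  by apply: mulr_ge0; apply: exprn_ge0; [exact: expR_ge0|rewrite divr_ge0// ltW].
move=> y y0; have y1 : 0 <= (1 + y) ^+ D by rewrite exprn_ge0//; lra.
apply: le_trans (ler_wpM2r y1 (fact_truncn_le y y0)) _.
have -> : expR 1 ^+ 2 * (1 + y) * expR (- y) * (1 + y) ^+ D = expR 1 ^+ 2 * ((1 + y) ^+ D.+1 * expR (- y)).
  by rewrite [(1 + y) ^+ D.+1]exprS; ring.
rewrite -[leRHS]mulrA; apply: ler_wpM2l; first by rewrite exprn_ge0// expR_ge0.
have -> : expR (- (b * y)) = expR (a * y) * expR (- y) by rewrite -expRD /a; congr expR; ring.
by rewrite mulrA; apply: ler_wpM2r; [exact: expR_ge0|apply: expn_le_expR => //; exact: ltW].
Qed.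

(** The first two terms are at most 1 each. In the others the factors 3, ..., j of [j!] are at most
    [k <= y], so each is at most [2 / y^2], and there are fewer than [y] of them. *)
Lemma sum_fact_le k (y : R) : 0 < y -> k%:R <= y -> \sum_(j < k) j`!%:R / y ^+ j <= 4.
Proof.
move=> y0; case: k => [|[|k]] ky.
- by rewrite big_ord0.
- by rewrite big_ord1 fact0 expr0 divr1; lra.
rewrite !big_ord_recl /= fact0 expr0 divr1 expr1.
have y1 : 1 <= y by apply: le_trans ky; rewrite ler1n.
have yi : y^-1 <= 1 by rewrite invf_le1.
have h j : (j <= k)%N -> j.+2`!%:R <= 2 * y ^+ j :> R.
  elim: j => [|j IH] jk; first by rewrite expr0 mulr1.
  rewrite factS natrM exprS mulrCA; apply: ler_pM => //; last exact: IH (ltnW jk).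
  by apply: le_trans ky; rewrite ler_nat.
have s : \sum_(i < k) (bump 0 (bump 0 i))`!%:R / y ^+ (bump 0 (bump 0 i)) <= \sum_(i < k) (2 / y ^+ 2).
  apply: ler_sum => i _; rewrite /bump /= !add1n ler_pdivrMr ?exprn_gt0//.
  have -> : 2 / y ^+ 2 * y ^+ i.+2 = 2 * y ^+ i by rewrite (_ : y ^+ i.+2 = y ^+ 2 * y ^+ i); [field; rewrite gt_eqF|rewrite -exprD add2n].
  by apply: h; exact: ltnW.
rewrite sumr_const card_ord -mulr_natl in s.
have h2 : k%:R * (2 / y ^+ 2) <= 2.
  rewrite mulrA ler_pdivrMr ?exprn_gt0// mulrC; apply: ler_wpM2l => //.
  have k1 : k%:R <= y by apply: le_trans ky; rewrite ler_nat (leq_trans (leqnSn k))// leqnSn.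
  by rewrite expr2; apply: le_trans k1 _; rewrite ler_peMl// ltW.
rewrite mul1r.
lra.
Qed.

End FactorialBounds.

Lemma ffact_le_expn n m : (n ^_ m <= n ^ m)%N.
Proof.
elim: m => [|m IH] //; rewrite ffactnSr expnSr; apply: leq_mul => //; exact: leq_subr.
Qed.

Lemma bin_fact_le_expn i j : (i <= j)%N -> ('C(j, i) * (j - i)`! <= j ^ (j - i))%N.
Proof. by move=> ij; rewrite -bin_sub// bin_ffact; exact: ffact_le_expn. Qed.

Lemma bin_fact_le_fact i j : (i <= j)%N -> ('C(j, i) * (j - i)`! <= j`!)%N.
Proof.
by move=> ij; rewrite -(bin_fact ij) leq_mul2l [(i`! * _)%N]mulnC leq_pmulr ?fact_gt0// orbT.
Qed.

(** * Derivatives of factorial growth against a polynomial cutoff *)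

Section FactorialSequences.
Context {R : realType}.

(** Here the number of derivatives grows with [t], and the factor [2 ^+ k] of [leib_le] would be too
    large; only indices below [D] give nonzero Leibniz terms. *)
Lemma sum_le_few (N D : nat) (p : pred nat) (u : nat -> R) E : 0 <= E ->
  (forall i, (i < N)%N -> p i -> u i <= E) -> (forall i, (D <= i)%N -> p i -> u i = 0) ->
  \sum_(i < N | p i) u i <= D%:R * E.
Proof.
move=> E0 hE h0.
have s : \sum_(i < N) (i < D)%N%:R = (minn N D)%:R :> R.
  elim: N {hE} => [|N IH]; first by rewrite big_ord0 min0n.
  rewrite big_ord_recr /= IH; case: (ltnP N D) => ND.
    by rewrite (minn_idPl ND) natr1.
  by rewrite (minn_idPr (leqW ND)) addr0.
apply: (@le_trans _ _ (\sum_(i < N) (i < D)%N%:R * E)).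
  rewrite big_mkcond /=; apply: ler_sum => i _; case: ifP => pi; last by rewrite mulr_ge0.
  case: ltnP => iD; first by rewrite mul1r; exact: hE.
  by rewrite h0// mul0r.
by rewrite -mulr_suml s; apply: ler_wpM2r => //; rewrite ler_nat geq_minr.
Qed.

Variables (w : nat -> R -> R) (x t nu Kw : R) (k : nat).
Hypotheses (t0 : 0 < t) (nu0 : 0 < nu) (Kw0 : 0 <= Kw).
Hypothesis ky : k%:R <= t / nu.
Hypothesis hw : forall j, (j <= k)%N -> `|w j x| <= Kw * j`!%:R * nu ^+ j.+1.

Let y0 : 0 < t / nu. Proof. exact: divr_gt0. Qed.

Lemma bdry_fact_le th : `|bdry k w t th x| <= 4 * Kw * nu / t.
Proof.
apply: le_trans (bdry_le _ _ _ _ _ t0) _.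
apply: (@le_trans _ _ (Kw * nu / t * \sum_(j < k) j`!%:R / (t / nu) ^+ j)).
  rewrite mulr_sumr; apply: ler_sum => j _.
  rewrite mulrC ler_pdivrMr ?exprn_gt0//; apply: le_trans (hw j (ltnW (ltn_ord j))) _.
  rewrite le_eqVlt; apply/orP; left; apply/eqP; rewrite expr_div_n !exprS.
  by field; rewrite !gt_eqF// exprn_gt0.
have -> : 4 * Kw * nu / t = Kw * nu / t * 4 by ring.
apply: ler_wpM2l; last exact: sum_fact_le.
by rewrite divr_ge0 ?mulr_ge0// ltW.
Qed.

Variables (n D : nat) (q : nat -> R -> R) (rho Kq : R).
Hypotheses (rho0 : 0 < rho) (rt : 1 <= rho * t) (Kq0 : 0 <= Kq) (D0 : (0 < D)%N).
Hypothesis hq : forall i, `|q i x| <= Kq * rho ^- i.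
Hypothesis hq0 : forall i, (D <= i)%N -> q i x = 0.

Let K0 : 0 <= Kq * Kw. Proof. exact: mulr_ge0. Qed.

Let term i j : (i <= j)%N -> (j <= k)%N ->
  'C(j, i)%:R * `|q i x| * `|w (j - i)%N x| <= Kq * Kw * (('C(j, i) * (j - i)`!)%:R * (rho ^- i * nu ^+ (j - i).+1)).
Proof.
move=> ij jk; rewrite natrM -mulrA.
have -> : Kq * Kw * ('C(j, i)%:R * (j - i)`!%:R * (rho ^- i * nu ^+ (j - i).+1)) =
  'C(j, i)%:R * ((Kq * rho ^- i) * (Kw * (j - i)`!%:R * nu ^+ (j - i).+1)) by ring.
apply: ler_wpM2l => //; apply: ler_pM => //.
by apply: hw; apply: leq_trans (leq_subr _ _) jk.
Qed.

(** The product ['C(j, i) * (j - i)!] is a falling factorial, at most [(t / nu) ^+ (j - i)], and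
    this collapses each jump term to [(rho * t) ^- i * nu / t]. At most [D] indices [i] count for
    each [j], and the at most [t / nu] values of [j] absorb [nu / t]. *)
Lemma junction_le (B : R) : 0 <= B -> (forall i, (n < i)%N -> (rho * t) ^- i <= B) ->
  \sum_(j < k) t ^- j.+1 * jump n q w j x <= D%:R * (Kq * Kw) * B.
Proof.
move=> B0 hB; set y := t / nu.
have DK : 0 <= D%:R * (Kq * Kw) * B by rewrite mulr_ge0// mulr_ge0.
case: (posnP k) => [->|k0]; first by rewrite big_ord0.
apply: (@le_trans _ _ (\sum_(j < k) D%:R * (Kq * Kw * B / y))); last first.
  rewrite sumr_const card_ord -[_ *+ k]mulr_natl.
  have -> : k%:R * (D%:R * (Kq * Kw * B / y)) = D%:R * (Kq * Kw) * B * (k%:R / y) by ring.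
  by rewrite ler_piMr// ler_pdivrMr// mul1r.
apply: ler_sum => j _; have jk := ltnW (ltn_ord j).
rewrite /jump mulr_sumr.
apply: (sum_le_few j.+1 D (fun i => n < i)%N (fun i => t ^- j.+1 * ('C(j, i)%:R * `|q i x| * `|w (j - i)%N x|))).
- by rewrite divr_ge0 ?(ltW y0)//; exact: mulr_ge0.
- move=> i; rewrite ltnS => ij ni.
  have tj : 0 <= t ^- j.+1 by rewrite invr_ge0 exprn_ge0// ltW.
  apply: le_trans (ler_wpM2l tj (term i j ij jk)) _.
  have -> : Kq * Kw * B / y = Kq * Kw * (B / y) by ring.
  rewrite mulrCA; apply: ler_wpM2l => //.
  have h1 : ('C(j, i) * (j - i)`!)%:R <= y ^+ (j - i).
    apply: (@le_trans _ _ (j%:R ^+ (j - i))); first by rewrite -natrX ler_nat bin_fact_le_expn.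
    apply: lerXn2r; rewrite ?nnegrE//; first exact: ltW.
    by apply: le_trans ky; rewrite ler_nat.
  have p0 : 0 <= rho ^- i * nu ^+ (j - i).+1.
    by rewrite mulr_ge0 ?invr_ge0 ?exprn_ge0// ltW.
  apply: le_trans (ler_wpM2l tj (ler_wpM2r p0 h1)) _.
  have -> : t ^- j.+1 * (y ^+ (j - i) * (rho ^- i * nu ^+ (j - i).+1)) = (rho * t) ^- i / y.
    rewrite /y -{1}(subnK ij) -addSn exprD expr_div_n exprMn !exprS.
    by field; rewrite !gt_eqF// ?exprn_gt0.
  by apply: ler_wpM2r; [rewrite invr_ge0 ltW|exact: hB].
- by move=> i Di _; rewrite hq0// normr0 mulr0 mul0r mulr0.
Qed.

(** Now ['C(k, i) * (k - i)! <= k!], and [rho * t >= 1] bounds [(rho * nu) ^- i] by a power of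
    [t / nu]; with fewer than [D + 1] derivatives of the cutoff the loss is polynomial in
    [t / nu]. *)
Lemma leib_fact_le :
  `|leib q w k x| <= D%:R * (Kq * Kw) * (k`!%:R * nu ^+ k.+1 * (1 + t / nu) ^+ D).
Proof.
set y := t / nu.
have y10 : 1 <= 1 + y by rewrite lerDl ltW.
apply: le_trans (ler_norm_sum _ _ _) _; rewrite -mulrA.
apply: (@le_trans _ _ (\sum_(i < k.+1 | true) 'C(k, i)%:R * `|q i x| * `|w (k - i)%N x|)).
  by apply: ler_sum => i _; rewrite !normrM normr_nat.
apply: (sum_le_few k.+1 D xpredT (fun i => 'C(k, i)%:R * `|q i x| * `|w (k - i)%N x|)).
- by rewrite !mulr_ge0 ?exprn_ge0 ?(ltW nu0)//; lra.
- move=> i; rewrite ltnS => ik _; case: (ltnP i D) => iD; last first.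
    rewrite hq0// normr0 mulr0 mul0r !mulr_ge0 ?exprn_ge0 ?(ltW nu0)//; lra.
  apply: le_trans (term i k ik (leqnn k)) _; apply: ler_wpM2l => //.
  rewrite -mulrA; apply: ler_pM => //.
  - by rewrite mulr_ge0 ?invr_ge0 ?exprn_ge0// ltW.
  - by rewrite ler_nat bin_fact_le_fact.
  have -> : rho ^- i * nu ^+ (k - i).+1 = nu ^+ k.+1 * (rho * nu) ^- i.
    rewrite -{2}(subnK ik) -addSn exprD exprMn; field.
    by rewrite !gt_eqF// ?exprn_gt0.
  apply: ler_wpM2l; first by rewrite exprn_ge0// ltW.
  apply: (@le_trans _ _ ((1 + y) ^+ i)); last by rewrite ler_weXn2l// ltnW.
  rewrite -exprVn; apply: lerXn2r; rewrite ?nnegrE ?invr_ge0 ?mulr_ge0 ?(ltW rho0) ?(ltW nu0)//; first lra.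
  apply: (@le_trans _ _ y); last by rewrite lerDr.
  rewrite /y invfM ler_pM2r ?invr_gt0//.
  by rewrite -[_^-1]mul1r ler_pdivrMr// mulrC.
- by move=> i Di _; rewrite hq0// normr0 mulr0 mul0r.
Qed.

End FactorialSequences.

(** * Arithmetic of [m_log] and [M_log] *)

Section LogGrowth.
Context {R : realType}.

(** The equation for [r] says that [exp (- c t / m r) = r / (r + m r)]. The smaller level [nu]
    allows for evaluating [m] at a larger frequency than [r], and a smaller [nu] only strengthens
    the exponential. *)
Lemma m_log_expR (m : R -> R) (r c t nu : R) : 0 < r -> 0 < c -> 0 < t -> 0 < nu -> nu <= m r ->
  m_log m r = c * t -> nu * expR (- (2 * c * (t / nu))) <= r.
Proof.
move=> r0 c0 t0 nu0 num er; have m0 : 0 < m r := lt_le_trans nu0 num.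
have p1 : 0 < 1 + m r / r by rewrite addr_gt0// divr_gt0.
have e1 : ln (1 + m r / r) = c * t / m r by rewrite -er /m_log [RHS]mulrC mulKf// gt_eqF.
have h1 : ln (1 + m r / r) <= 2 * c * (t / nu).
  rewrite e1 -[leRHS]mulrA.
  have h2 : c * t / m r <= c * (t / nu).
    rewrite -mulrA; apply: ler_wpM2l; first exact: ltW.
    by apply: ler_wpM2l; [exact: ltW|rewrite lef_pV2 ?posrE].
  have : 0 < c * (t / nu) by rewrite mulr_gt0// divr_gt0.
  lra.
have h2 : expR (- (2 * c * (t / nu))) <= (1 + m r / r)^-1.
  have -> : (1 + m r / r)^-1 = expR (- ln (1 + m r / r)) by rewrite expRN lnK ?posrE.
  by rewrite ler_expR lerN2.
apply: (@le_trans _ _ (m r * (1 + m r / r)^-1)).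
  by apply: ler_pM => //; exact: ltW.
by rewrite ler_pdivrMr// mulrDr mulr1 mulrC divfK ?gt_eqF// lerDr ltW.
Qed.

(** Here [exp (- 2 c t / M x)] is [((1 + x) * M x) ^- 2]: the square both cancels the band length
    [x] and leaves the target [1 / x]. This is the origin of the factor [2 * c]. *)
Lemma M_log_expR (M : R -> R) (x c t : R) : 1 <= x -> 1 <= M x ->
  M_log M x = c * t -> x * M x * expR (- (2 * c * (t / M x))) <= x^-1.
Proof.
move=> x1 M1 ex; have x0 : 0 < x := lt_le_trans ltr01 x1.
have M0 : 0 < M x := lt_le_trans ltr01 M1.
have p1 : 0 < 1 + x by rewrite addr_gt0.
have e1 : c * t / M x = ln ((1 + x) * M x) by rewrite lnM ?posrE// -ex /M_log [LHS]mulrC mulKf// gt_eqF.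
have -> : 2 * c * (t / M x) = 2 * (c * t / M x) by ring.
rewrite e1 -mulrN expRM_natl expRN lnK ?posrE ?mulr_gt0//.
rewrite -[leRHS]mul1r ler_pdivlMr//.
have -> : x * M x * ((1 + x) * M x)^-1 ^+ 2 * x = (x / (1 + x)) ^+ 2 * (M x)^-1.
  by field; rewrite !gt_eqF.
apply: mulr_ile1.
- by rewrite exprn_ge0// divr_ge0 ?ltW.
- by rewrite invr_ge0 ltW.
- by rewrite exprn_ile1// ?divr_ge0 ?(ltW x0) ?(ltW p1)// ler_pdivrMr// mul1r lerDr.
- by rewrite invf_le1.
Qed.

Lemma m_log_ge (m : R -> R) r a : 0 < a -> a <= r -> 0 < m r -> m r <= m a -> m_log m r <= m_log m a.
Proof.
move=> a0 ar m0 ma; have r0 := lt_le_trans a0 ar; have ma0 := lt_le_trans m0 ma; rewrite /m_log.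
have d0 : 0 <= m r / r by rewrite divr_ge0// ltW.
have d : m r / r <= m a / a.
  by apply: ler_pM => //; [exact: ltW|rewrite invr_ge0 ltW|rewrite lef_pV2 ?posrE].
apply: ler_pM => //; [exact: ltW|by rewrite ln_ge0// lerDl|].
by rewrite ler_ln ?posrE ?lerD2l//; lra.
Qed.

Lemma M_log_le (M : R -> R) x a : 0 < x -> x <= a -> 1 <= M x -> M x <= M a -> M_log M x <= M_log M a.
Proof.
move=> x0 xa M1 Ma; have M0 := lt_le_trans ltr01 M1; have Ma0 := lt_le_trans M0 Ma; rewrite /M_log.
have a0 := lt_le_trans x0 xa.
apply: ler_pM => //; [exact: ltW|by rewrite addr_ge0// ln_ge0// lerDl ltW|].
by apply: lerD; rewrite ler_ln ?posrE ?lerD2l//; lra.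
Qed.

End LogGrowth.

Lemma osc_band_Cinf_arith (R : realType) (S1 S2 T1 T2 V1 V2 b D Q C r R0 t m1 M1 : R) :
  0 <= D -> 0 <= Q -> 0 <= C -> 0 <= T1 -> 0 <= T2 -> 0 <= V1 -> 0 <= V2 ->
  0 < r -> 2 * r <= 1 -> 2 <= R0 ->
  S1 <= 2 * (D * (Q * (4 * C * r)) * 1) -> S2 <= 2 * (D * (Q * (2 * C)) * R0^-1) ->
  b <= 4 * (2 * C) * m1 / t + 4 * (2 * C) * M1 / t ->
  (S1 + T1 * (D * (Q * (4 * C * r)) * V1) * (2 * r - r)) + T1 * (2 * C * V1) * (1 - 2 * r) + b +
    T2 * (2 * C * V2) * (R0 / 2 - 1) + (S2 + T2 * (D * (Q * (2 * C)) * V2) * (R0 - R0 / 2)) <=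
  8 * D * Q * C * r + 4 * D * Q * C * (T1 * V1) + 2 * C * (T1 * V1) + 8 * C * (m1 + M1) / t +
  2 * C * (R0 * (T2 * V2)) + 4 * D * Q * C / R0 + 2 * D * Q * C * (R0 * (T2 * V2)).
Proof.
move=> D0 Q0 C0 T10 T20 V10 V20 r0 r1 R2 h1 h2 h3.
have p1 : 0 <= T1 * V1 by exact: mulr_ge0.
have p2 : 0 <= T2 * V2 by exact: mulr_ge0.
have K0 : 0 <= D * Q * C by rewrite !mulr_ge0.
have a1 : T1 * (D * (Q * (4 * C * r)) * V1) * (2 * r - r) <= 4 * D * Q * C * (T1 * V1).
  have -> : T1 * (D * (Q * (4 * C * r)) * V1) * (2 * r - r) = 4 * D * Q * C * (T1 * V1) * (r * r) by ring.
  rewrite (_ : 4 * D * Q * C = 4 * (D * Q * C)); last by ring.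
  apply: ler_piMr; first by rewrite !mulr_ge0.
  by apply: mulr_ile1; lra.
have a2 : T1 * (2 * C * V1) * (1 - 2 * r) <= 2 * C * (T1 * V1).
  have -> : T1 * (2 * C * V1) * (1 - 2 * r) = 2 * C * (T1 * V1) * (1 - 2 * r) by ring.
  by rewrite ler_piMr//; [rewrite !mulr_ge0|lra].
have a3 : T2 * (2 * C * V2) * (R0 / 2 - 1) <= 2 * C * (R0 * (T2 * V2)).
  have -> : T2 * (2 * C * V2) * (R0 / 2 - 1) = 2 * C * ((R0 / 2 - 1) * (T2 * V2)) by ring.
  by apply: ler_wpM2l; [rewrite mulr_ge0|apply: ler_wpM2r => //; lra].
have a4 : T2 * (D * (Q * (2 * C)) * V2) * (R0 - R0 / 2) <= 2 * D * Q * C * (R0 * (T2 * V2)).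
  have -> : T2 * (D * (Q * (2 * C)) * V2) * (R0 - R0 / 2) = 2 * (D * Q * C) * ((R0 - R0 / 2) * (T2 * V2)) by ring.
  rewrite (_ : 2 * D * Q * C = 2 * (D * Q * C)); last by ring.
  apply: ler_wpM2l; first by rewrite mulr_ge0.
  by apply: ler_wpM2r => //; lra.
have e1 : 2 * (D * (Q * (4 * C * r)) * 1) = 8 * D * Q * C * r by ring.
have e2 : 2 * (D * (Q * (2 * C)) * R0^-1) = 4 * D * Q * C / R0 by ring.
have e3 : 4 * (2 * C) * m1 / t + 4 * (2 * C) * M1 / t = 8 * C * (m1 + M1) / t by ring.
rewrite e1 in h1; rewrite e2 in h2; rewrite e3 in h3.
have := lerD (lerD (lerD (lerD (lerD h1 a1) a2) h3) a3) (lerD h2 a4).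
by rewrite !addrA.
Qed.

(** * Scalar estimate under factorial bounds *)

Section RateCinf.
Context {R : realType} {X : completeNormedModType R[i]}.
Variables (m M : R -> R).
Hypothesis m1 : forall r, 0 < r <= 1 -> 1 <= m r.
Hypothesis m_dec : forall r r', 0 < r -> r <= r' -> r' <= 1 -> m r' <= m r.
Hypothesis M1 : forall x, 1 <= x -> 1 <= M x.
Hypothesis M_inc : forall x y, 1 <= x -> x <= y -> M x <= M y.

(** Below and above frequency 1 the derivatives of [w] are compared with the constant levels [m r]
    and [M R0], so the factorial lemmas apply with [nu] equal to either. [U1] and [U2] collect the
    remainders after [k1] and [k2] integrations. *)
Lemma osc_band_Cinf P C r R0 t (G : nat -> R -> X) w th k1 k2 k : step_poly 2 P -> 0 < C ->
  (forall j s, 0 < `|s| <= 1 -> nrm (G j s) <= C * j`!%:R * `|s| * m `|s| ^+ j.+1) ->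
  (forall j s, 1 <= `|s| -> nrm (G j s) <= C * j`!%:R * M `|s| ^+ j.+1) ->
  0 < r -> 2 * r <= 1 -> 2 <= R0 -> 1 <= t -> 1 <= r * t ->
  k1%:R <= t / m r -> k2%:R <= t / M R0 -> (k1 <= k)%N -> (k2 <= k)%N ->
  smooth_pos k w ->
  (forall j s, (j <= k)%N -> 0 < s -> `|w j s| <= nrm (G j s) + nrm (G j (- s))) ->
  forall (D : nat) (Q U1 U2 : R), D = (size P).+1 -> Q = 1 + poly_bound P ->
  U1 = t ^- k1 * (k1`!%:R * m r ^+ k1.+1 * (1 + t / m r) ^+ D) ->
  U2 = t ^- k2 * (k2`!%:R * M R0 ^+ k2.+1 * (1 + t / M R0) ^+ D) ->
  `|\int[@lebesgue_measure R]_(s in `[r, R0]) (band P r R0 s * w 0%N s * cos (s * t + th))| <=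
  8 * D%:R * Q * C * r + 4 * D%:R * Q * C * U1 + 2 * C * U1 + 8 * C * (m 1 + M 1) / t +
  2 * C * (R0 * U2) + 4 * D%:R * Q * C / R0 + 2 * D%:R * Q * C * (R0 * U2).
Proof.
move=> hP C0 hl hh r0 r1 R2 t1 rt ky1 ky2 k1k k2k hw wG D Q U1 U2 DE QE U1E U2E.
have pb1 := poly_bound_ge1 2 P hP.
have t0 : 0 < t by lra.
have r11 : r <= 1 by lra.
have R00 : 0 < R0 by lra.
have R1 : 1 <= R0 by lra.
have r20 : 0 < 2 * r by lra.
have rr2 : r <= 2 * r by lra.
have R21 : 1 <= R0 / 2 by lra.
have R2R : R0 / 2 <= R0 by lra.
have m0 : 0 < m r by apply: lt_le_trans (m1 r _) => //; rewrite r0.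
have M0 : 0 < M R0 by apply: lt_le_trans (M1 R0 _).
have D0 : (0 < D)%N by rewrite DE.
have Q0 : 0 <= Q by lra.
have wl j s : (j <= k)%N -> 0 < s -> s <= 1 -> `|w j s| <= 2 * C * s * j`!%:R * m s ^+ j.+1.
  move=> jk s0 s1; apply: le_trans (wG j s jk s0) _.
  have h1 := hl j s; have h2 := hl j (- s).
  rewrite normrN gtr0_norm// in h1 h2.
  have -> : 2 * C * s * j`!%:R * m s ^+ j.+1 = C * j`!%:R * s * m s ^+ j.+1 + C * j`!%:R * s * m s ^+ j.+1 by ring.
  by apply: lerD; [apply: h1|apply: h2]; rewrite s0 s1.
have wh j s : (j <= k)%N -> 1 <= s -> `|w j s| <= 2 * C * j`!%:R * M s ^+ j.+1.
  move=> jk s1; have s0 : 0 < s := lt_le_trans ltr01 s1.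
  apply: le_trans (wG j s jk s0) _.
  have h1 := hh j s; have h2 := hh j (- s).
  rewrite normrN gtr0_norm// in h1 h2.
  have -> : 2 * C * j`!%:R * M s ^+ j.+1 = C * j`!%:R * M s ^+ j.+1 + C * j`!%:R * M s ^+ j.+1 by ring.
  by apply: lerD; [exact: h1|exact: h2].
have mX j s : r <= s -> s <= 1 -> 0 <= m s ^+ j <= m r ^+ j.
  move=> rs s1; have s0 : 0 < s := lt_le_trans r0 rs.
  have ms : 1 <= m s by apply: m1; rewrite s0.
  apply/andP; split; first exact: exprn_ge0 (le_trans ler01 ms).
  by apply: lerXn2r; rewrite ?nnegrE; [exact: le_trans ler01 ms|exact: ltW|exact: m_dec].
have MX j s : 1 <= s -> s <= R0 -> 0 <= M s ^+ j <= M R0 ^+ j.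
  move=> s1 sR; have Ms : 1 <= M s by apply: M1.
  apply/andP; split; first exact: exprn_ge0 (le_trans ler01 Ms).
  by apply: lerXn2r; rewrite ?nnegrE; [exact: le_trans ler01 Ms|exact: ltW|exact: M_inc].
have C2 : 0 <= 2 * C by lra.
have fac j : 0 <= j`!%:R :> R by [].
(* On the transition zone the factor [|s|] of the hypothesis is worth [2 * r]; it makes the jumps
   there [O(r)]. *)
have wlow j s : (j <= k1)%N -> r <= s -> s <= 2 * r -> `|w j s| <= 4 * C * r * j`!%:R * m r ^+ j.+1.
  move=> jk rs s2; have s0 : 0 < s := lt_le_trans r0 rs.
  have s1 : s <= 1 := le_trans s2 r1.
  have /andP[p q] := mX j.+1 s rs s1.
  apply: le_trans (wl j s (leq_trans jk k1k) s0 s1) _; apply: ler_pM => //.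
    exact: mulr_ge0 (mulr_ge0 C2 (ltW s0)) (fac j).
  apply: ler_wpM2r => //.
  have -> : 4 * C * r = 2 * C * (2 * r) by ring.
  exact: ler_wpM2l.
have wmid j s : (j <= k1)%N -> r <= s -> s <= 1 -> `|w j s| <= 2 * C * j`!%:R * m r ^+ j.+1.
  move=> jk rs s1; have s0 : 0 < s := lt_le_trans r0 rs.
  have /andP[p q] := mX j.+1 s rs s1.
  apply: le_trans (wl j s (leq_trans jk k1k) s0 s1) _; apply: ler_pM => //.
    exact: mulr_ge0 (mulr_ge0 C2 (ltW s0)) (fac j).
  apply: ler_wpM2r => //; rewrite ler_piMr//.
have whigh j s : (j <= k2)%N -> 1 <= s -> s <= R0 -> `|w j s| <= 2 * C * j`!%:R * M R0 ^+ j.+1.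
  move=> jk s1 sR; have /andP[p q] := MX j.+1 s s1 sR.
  apply: le_trans (wh j s (leq_trans jk k2k) s1) _; apply: ler_pM => //.
  exact: mulr_ge0 C2 (fac j).
have hqr s i : r <= s -> s <= 2 * r -> `|qrise P (2 * r) i s| <= Q * (2 * r) ^- i.
  by move=> rs s2; rewrite QE; apply: qrise_le => //; rewrite s2 andbT; exact: ltW (lt_le_trans r0 rs).
have hqf s i : R0 / 2 <= s -> s <= R0 -> `|qfall P R0 i s| <= Q * R0 ^- i.
  move=> rs s2; apply: le_trans (qfall_le P R0 R00 i s _) _; first by rewrite s2 andbT; exact: le_trans (le_trans ler01 R21) rs.
  by apply: ler_wpM2r; [rewrite invr_ge0 exprn_ge0// ltW|rewrite QE lerDr].
(* [D] is [size P + 1], so every such [i] is positive and the constant term of [qrise] is gone as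
   well. *)
have hqr0 s i : (D <= i)%N -> qrise P (2 * r) i s = 0.
  by rewrite DE => Di; apply: qrise_eq0; [exact: ltnW|exact: leq_trans Di].
have hqf0 s i : (D <= i)%N -> qfall P R0 i s = 0 by rewrite DE => Di; apply: qfall_eq0; exact: ltnW.
have rt2 : 1 <= 2 * r * t := le_trans rt (ler_wpM2r (ltW t0) rr2).
have Rt : 1 <= R0 * t by apply: mulr_ege1 => //.
have C4 : 0 <= 4 * C * r := mulr_ge0 (mulr_ge0 (ler0n _ 4) (ltW C0)) (ltW r0).
have jl s : r <= s -> s <= 2 * r -> \sum_(j < k1) t ^- j.+1 * jump 2 (qrise P (2 * r)) w j s <= D%:R * (Q * (4 * C * r)) * 1.
  move=> rs s2; apply: (junction_le w s t (m r) (4 * C * r) k1 t0 m0 C4 ky1 (fun j jk => wlow j s jk rs s2) 2 D _ (2 * r) Q) => //.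
  - by move=> i; exact: hqr.
  - by move=> i; exact: hqr0.
  - by move=> i _; rewrite invf_le1 ?exprn_gt0 ?mulr_gt0// exprn_ege1.
have jh s : 1 <= s -> R0 / 2 <= s -> s <= R0 -> \sum_(j < k2) t ^- j.+1 * jump 2 (qfall P R0) w j s <= D%:R * (Q * (2 * C)) * R0^-1.
  move=> s1 rs s2; apply: (junction_le w s t (M R0) (2 * C) k2 t0 M0 C2 ky2 (fun j jk => whigh j s jk s1 s2) 2 D _ R0 Q) => //.
  - by move=> i; exact: hqf.
  - by move=> i; exact: hqf0.
  - by rewrite invr_ge0 ltW.
  - move=> [|i] // _; rewrite lef_pV2 ?posrE ?exprn_gt0 ?mulr_gt0//.
    rewrite exprS; apply: (@le_trans _ _ (R0 * t)); first by rewrite ler_peMr// ltW.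
    by rewrite ler_peMr ?exprn_ege1//; exact: le_trans ler01 Rt.
(* At frequency 1 the levels [m 1] and [M 1] do not depend on [t], and monotonicity keeps
   [k1 <= t / m 1] and [k2 <= t / M 1]; both boundary terms are therefore [O(1 / t)]. *)
have bl := bdry_fact_le w 1 t (m 1) (2 * C) k1 t0.
have bh := bdry_fact_le w 1 t (M 1) (2 * C) k2 t0.
have m10 : 0 < m 1 by apply: lt_le_trans (m1 1 _) => //; rewrite ltr01 lexx.
have M10 : 0 < M 1 by apply: lt_le_trans (M1 1 _).
have {bl}bl : `|bdry k1 w t th 1| <= 4 * (2 * C) * m 1 / t.
  apply: bl => //.
    apply: le_trans ky1 _; apply: ler_wpM2l; first exact: ltW.
    by rewrite lef_pV2 ?posrE//; exact: m_dec.
  by move=> j jk; have := wl j 1 (leq_trans jk k1k) ltr01 (lexx 1); rewrite mulr1.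
have {bh}bh : `|bdry k2 w t th 1| <= 4 * (2 * C) * M 1 / t.
  apply: bh => //.
    apply: le_trans ky2 _; apply: ler_wpM2l; first exact: ltW.
    by rewrite lef_pV2 ?posrE//; exact: M_inc.
  by move=> j jk; exact: wh (leq_trans jk k2k) (lexx 1).
pose V1 := k1`!%:R * m r ^+ k1.+1 * (1 + t / m r) ^+ D.
pose V2 := k2`!%:R * M R0 ^+ k2.+1 * (1 + t / M R0) ^+ D.
have y1 : 1 <= (1 + t / m r) ^+ D by apply: exprn_ege1; rewrite lerDl divr_ge0// ltW.
have y2 : 1 <= (1 + t / M R0) ^+ D by apply: exprn_ege1; rewrite lerDl divr_ge0// ltW.
have V1e : k1`!%:R * m r ^+ k1.+1 <= V1 := ler_peMr (mulr_ge0 (fac k1) (exprn_ge0 _ (ltW m0))) y1.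
have V2e : k2`!%:R * M R0 ^+ k2.+1 <= V2 := ler_peMr (mulr_ge0 (fac k2) (exprn_ge0 _ (ltW M0))) y2.
have := osc_band 2 P r R0 t hP r0 r1 R2 t0 w k k1 k2 th (D%:R * (Q * (4 * C * r)) * V1) (2 * C * V1)
  (2 * C * V2) (D%:R * (Q * (2 * C)) * V2) hw k1k k2k.
move=> H; apply: le_trans (H _ _ _ _) _ => {H}.
- move=> s /andP[s1 s2].
  apply: (leib_fact_le w s t (m r) (4 * C * r) k1 t0 m0 C4 (fun j jk => wlow j s jk s1 s2) D _ (2 * r) Q) => //.
  - by move=> i; exact: hqr.
  - by move=> i; exact: hqr0.
- move=> s /andP[s1 s2]; have rs : r <= s := le_trans rr2 s1.
  apply: le_trans (wmid k1 s (leqnn _) rs s2) _.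
  by rewrite -mulrA; apply: ler_wpM2l.
- move=> s /andP[s1 s2]; have sR : s <= R0 := le_trans s2 R2R.
  apply: le_trans (whigh k2 s (leqnn _) s1 sR) _.
  by rewrite -mulrA; apply: ler_wpM2l.
- move=> s /andP[s1 s2]; have s11 : 1 <= s := le_trans R21 s1.
  apply: (leib_fact_le w s t (M R0) (2 * C) k2 t0 M0 C2 (fun j jk => whigh j s jk s11 s2) D _ R0 Q) => //.
  - by move=> i; exact: hqf.
  - by move=> i; exact: hqf0.
have js q x y : \sum_(j < k1) t ^- j.+1 * (jump 2 q w j x + jump 2 q w j y) =
  \sum_(j < k1) t ^- j.+1 * jump 2 q w j x + \sum_(j < k1) t ^- j.+1 * jump 2 q w j y.
  by rewrite -big_split; apply: eq_bigr => j _; rewrite mulrDr.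
have js2 q x y : \sum_(j < k2) t ^- j.+1 * (jump 2 q w j x + jump 2 q w j y) =
  \sum_(j < k2) t ^- j.+1 * jump 2 q w j x + \sum_(j < k2) t ^- j.+1 * jump 2 q w j y.
  by rewrite -big_split; apply: eq_bigr => j _; rewrite mulrDr.
have two (z : R) : 2 * z = z + z by ring.
rewrite U1E U2E; apply: osc_band_Cinf_arith => //.
- exact: ltW.
- by rewrite invr_ge0 exprn_ge0// ltW.
- by rewrite invr_ge0 exprn_ge0// ltW.
- exact: le_trans (mulr_ge0 (fac k1) (exprn_ge0 _ (ltW m0))) V1e.
- exact: le_trans (mulr_ge0 (fac k2) (exprn_ge0 _ (ltW M0))) V2e.
- by rewrite js [leRHS]two; apply: lerD; apply: jl.
- by rewrite js2 [leRHS]two; apply: lerD; apply: jh.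
- exact: le_trans (ler_normB _ _) (lerD bl bh).
Qed.

End RateCinf.

Lemma decay_Cinf_arith (R : realType) (A r r' x t Th U1 U2 D Q C s N : R) :
  0 <= A -> 0 <= D -> 0 <= Q -> 0 <= C -> 0 <= Th -> 0 <= s -> 0 < r -> 0 < x -> 0 < t ->
  r' <= r + t^-1 -> U1 <= Th * r -> x * U2 <= Th / x ->
  N <= A * (r' + x^-1) + 2 * (8 * D * Q * C * r' + 4 * D * Q * C * U1 + 2 * C * U1 + 8 * C * s / t +
    2 * C * (x * U2) + 4 * D * Q * C / x + 2 * D * Q * C * (x * U2)) ->
  N <= (A + 2 * (8 * D * Q * C + 4 * D * Q * C * Th + 2 * C * Th + 8 * C * s +
    2 * C * Th + 4 * D * Q * C + 2 * D * Q * C * Th)) * (r + x^-1 + t^-1).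
Proof.
move=> A0 D0 Q0 C0 Th0 s0 r0 x0 t0 hr h1 h2 hN; apply: le_trans hN _.
have u : 0 < x^-1 by rewrite invr_gt0.
have v : 0 < t^-1 by rewrite invr_gt0.
set S := r + x^-1 + t^-1.
have S1 : r' + x^-1 <= S by rewrite /S; lra.
have S2 : r' <= S by lra.
have S3 : U1 <= Th * S by apply: le_trans h1 _; apply: ler_wpM2l => //; rewrite /S; lra.
have S4 : x * U2 <= Th * S by apply: le_trans h2 _; apply: ler_wpM2l => //; rewrite /S; lra.
have S5 : x^-1 <= S by rewrite /S; lra.
have S6 : t^-1 <= S by rewrite /S; lra.
rewrite [leRHS]mulrDl; apply: lerD; first exact: ler_wpM2l.
rewrite -[leRHS]mulrA; apply: ler_wpM2l => //; rewrite !mulrDl -!(mulrA _ Th).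
have c2 (a : R) : 0 <= a -> 0 <= a * C by move=> a0; exact: mulr_ge0.
have c4 (a : R) : 0 <= a -> 0 <= a * D * Q * C by move=> a0; rewrite !mulr_ge0.
by do !apply: lerD; apply: ler_wpM2l => //; first [by apply: c4 | by apply: c2 | by apply: mulr_ge0 => //; apply: c2].
Qed.

(** * The logarithmic rate *)

Section RateCinf.
Context {R : realType} {X : completeNormedModType R[i]}.
Variables (f : R -> X) (B L B1 : R).
Hypothesis fB : forall t, 0 <= t -> nrm (f t) <= B.
Hypothesis fL : forall s t, 0 <= s -> 0 <= t -> nrm (f t - f s) <= L * `|t - s|.
Hypothesis fB1 : forall t, 0 <= t -> nrm (bintegral [set s | 0 <= s <= t] f) <= B1.
Variable F : R -> X.
Hypothesis F1 : L1loc_punct F.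
Hypothesis bF : boundary_function f F.
Variables (m M : R -> R).
Hypothesis m1 : forall r, 0 < r <= 1 -> 1 <= m r.
Hypothesis m_dec : forall r r', 0 < r -> r <= r' -> r' <= 1 -> m r' <= m r.
Hypothesis M1 : forall x, 1 <= x -> 1 <= M x.
Hypothesis M_inc : forall x y, 1 <= x -> x <= y -> M x <= M y.

Theorem decay_Cinf C (G : nat -> R -> X) c : Cinf_derivs F G -> 0 < C ->
  (forall j s, 0 < `|s| <= 1 -> nrm (G j s) <= C * j`!%:R * `|s| * m `|s| ^+ j.+1) ->
  (forall j s, 1 <= `|s| -> nrm (G j s) <= C * j`!%:R * M `|s| ^+ j.+1) -> 0 < c < 2^-1 ->
  exists K t0 : R, forall t, t0 <= t ->
    forall r x, 0 < r <= 1 -> m_log m r = c * t -> 1 <= x -> M_log M x = c * t ->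
    nrm (f t) <= K * (r + x^-1 + t^-1).
Proof.
move=> [G0 Gd Gc] C0 hl hh /andP[c0 c2].
have hG k : Ck_derivs k F G.
  split; [exact: G0|by move=> j s _; exact: Gd|by move=> j _; exact: Gc].
have [P hP] := @step_poly_exists R 2.
have [A [A0 hA]] := norm_estimate f B L B1 fB fL fB1 F bF 2 P hP (leqnn 2).
pose D := (size P).+1; pose Q := 1 + poly_bound P.
have Q0 : 0 <= Q by rewrite addr_ge0// poly_bound_ge0.
(* The rate [2 * c] is what [m_log_expR] and [M_log_expR] consume; the hypothesis on [c] keeps it
   below the full rate 1 of the factorial bound. *)
have b01 : 0 < 2 * c < 1 by apply/andP; split; lra.
have [Th [Th0 hTh]] := fact_truncn_expR D (2 * c) b01.
pose s := m 1 + M 1.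
have s0 : 0 <= s.
  have h1 : 1 <= m 1 by apply: m1; rewrite ltr01 lexx.
  have h2 := M1 1 (lexx 1); rewrite /s; lra.
pose T1 := m_log m 4^-1; pose T2 := M_log M 4.
exists (A + 2 * (8 * D%:R * Q * C + 4 * D%:R * Q * C * Th + 2 * C * Th + 8 * C * s +
    2 * C * Th + 4 * D%:R * Q * C + 2 * D%:R * Q * C * Th)), (4 + (`|T1| + `|T2|) / c).
move=> t ht r x /andP[r0 r1] er x1 ex.
have t4 : 4 <= t by apply: le_trans ht; rewrite lerDl divr_ge0 ?addr_ge0// ltW.
have tT : `|T1| + `|T2| < c * t.
  rewrite mulrC -ltr_pdivrMr//; apply: lt_le_trans ht; lra.
have rr : r <= 4^-1.
  rewrite leNgt; apply/negP => r4.
  have mr : 0 < m r by apply: lt_le_trans (m1 r _) => //; rewrite r0.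
  have i4 : 0 < 4^-1 :> R by rewrite invr_gt0.
  have := m_log_ge m r 4^-1 i4 (ltW r4) mr (m_dec _ _ i4 (ltW r4) r1).
  rewrite er -/T1 => h; have := ler_norm T1; have := normr_ge0 T2; lra.
have xx : 4 <= x.
  rewrite leNgt; apply/negP => x4.
  have := M_log_le M x 4 (lt_le_trans ltr01 x1) (ltW x4) (M1 x x1) (M_inc _ _ x1 (ltW x4)).
  rewrite ex -/T2 => h; have := ler_norm T2; have := normr_ge0 T1; lra.
have t0 : 0 < t by lra.
have t1 : 1 <= t by lra.
have x0 : 0 < x by lra.
have x2 : 2 <= x by lra.
have ti : t^-1 <= 4^-1 by rewrite lef_pV2 ?posrE.
have ti0 : 0 < t^-1 by rewrite invr_gt0.
(* [r' * t >= 1] keeps the negative powers at the lower knots bounded. Since [m r' <= m r], the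
   equation solved by [r] still controls the remainder formed with [m r']. *)
pose r' := Num.max r t^-1.
have r'0 : 0 < r' by rewrite lt_max r0.
have r'4 : r' <= 4^-1 by rewrite ge_max rr ti.
have rr' : r <= r' by rewrite le_max lexx.
have r't : 1 <= r' * t by rewrite -ler_pdivrMr// mul1r le_max lexx orbT.
have r'1 : r' <= 1 by lra.
have r'2 : 2 * r' <= 1 by lra.
have rx : 4 * r' <= x by lra.
have hr' : r' <= r + t^-1 by rewrite ge_max lerDl lerDr !ltW.
have mr' : 0 < m r' by apply: lt_le_trans (m1 r' _) => //; rewrite r'0.
have mm : m r' <= m r by exact: m_dec.
have Mx := M1 x x1.
have Mx0 : 0 < M x by exact: lt_le_trans ltr01 Mx.
pose k1 := Num.truncn (t / m r'); pose k2 := Num.truncn (t / M x).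
have y1 : 0 < t / m r' by exact: divr_gt0.
have y2 : 0 < t / M x by exact: divr_gt0.
have ky1 : k1%:R <= t / m r' by have /andP[] := truncn_itv (ltW y1).
have ky2 : k2%:R <= t / M x by have /andP[] := truncn_itv (ltW y2).
pose U1 := t ^- k1 * (k1`!%:R * m r' ^+ k1.+1 * (1 + t / m r') ^+ D).
pose U2 := t ^- k2 * (k2`!%:R * M x ^+ k2.+1 * (1 + t / M x) ^+ D).
(* Absorbing [nu ^+ k] into the power of [t] leaves the quantity of [fact_truncn_expR] at
   [y = t / nu], times a single [nu]. *)
have UE k nu : 0 < nu -> t ^- k * (k`!%:R * nu ^+ k.+1 * (1 + t / nu) ^+ D) =
    nu * (k`!%:R / (t / nu) ^+ k * (1 + t / nu) ^+ D).
  move=> nu0; rewrite expr_div_n exprS; set z := (1 + t / nu) ^+ D; field.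
  by rewrite !gt_eqF// exprn_gt0.
have hU1 : U1 <= Th * r.
  rewrite /U1 UE//; apply: le_trans (ler_wpM2l (ltW mr') (hTh _ y1)) _.
  by rewrite mulrCA; apply: ler_wpM2l => //; exact: (m_log_expR m r c t (m r')).
have hU2 : x * U2 <= Th / x.
  rewrite /U2 UE// mulrA; apply: le_trans (ler_wpM2l (mulr_ge0 (ltW x0) (ltW Mx0)) (hTh _ y2)) _.
  by rewrite mulrCA; apply: ler_wpM2l => //; exact: M_log_expR.
pose b := 8 * D%:R * Q * C * r' + 4 * D%:R * Q * C * U1 + 2 * C * U1 + 8 * C * s / t +
  2 * C * (x * U2) + 4 * D%:R * Q * C / x + 2 * D%:R * Q * C * (x * U2).
have hN : nrm (f t) <= A * (r' + x^-1) + 2 * b.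
  apply: hA => // l hl'.
  (* Smoothness of [w] is needed up to the larger of the two orders, and these vary with [t], [r]
     and [x]; [hG] supplies every order. *)
  pose k := maxn k1 k2.
  apply: (functional_le k F G (hG k) F1 2 P r' x t _ hP r'0 rx) => // w th hw wG.
  exact: (osc_band_Cinf m M m1 m_dec M1 M_inc P C r' x t G w th k1 k2 k hP C0 hl hh r'0 r'2 x2 t1 r't
    ky1 ky2 (leq_maxl _ _) (leq_maxr _ _) hw wG D Q U1 U2 erefl erefl erefl erefl).
apply: (decay_Cinf_arith R A r r' x t Th U1 U2 D%:R Q C s) => //; exact: ltW.
Qed.

End RateCinf.

Theorem theorem2p13 (R : realType) (X : completeNormedModType R[i])
  (f : R -> X) (F : R -> X) :
  (exists B : R, forall t, 0 <= t -> nrm (f t) <= B) ->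
  {within [set t | 0 <= t], continuous f} ->
  (exists L : R, forall s t, 0 <= s -> 0 <= t -> nrm (f t - f s) <= L * `|t - s|) ->
  (exists B : R, forall t, 0 <= t -> nrm (bintegral [set s | 0 <= s <= t] f) <= B) ->
  L1loc_punct F ->
  boundary_function f F ->
  (f t @[t --> +oo] --> (0 : X)) /\
  (forall m M : R -> R,
     (forall r, 0 < r <= 1 -> 1 <= m r) ->
     {within [set r | 0 < r <= 1], continuous m} ->
     (forall r r', 0 < r -> r <= r' -> r' <= 1 -> m r' <= m r) ->
     (forall x, 1 <= x -> 1 <= M x) ->
     {within [set x | 1 <= x], continuous M} ->
     (forall x y, 1 <= x -> x <= y -> M x <= M y) ->
     (* (a) *)
     (forall k : nat, (1 <= k)%N ->
        (exists G : nat -> R -> X, Ck_derivs k F G /\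
           exists C : R, 0 < C /\
             (forall j s, (j <= k)%N -> 0 < `|s| <= 1 ->
                nrm (G j s) <= C * `|s| ^+ (k - j) * m `|s| ^+ k.+1) /\
             (forall j s, (j <= k)%N -> 1 <= `|s| ->
                nrm (G j s) <= C * M `|s| ^+ j.+1)) ->
        forall c : R, 0 < c ->
        exists K t0 : R, forall t, t0 <= t ->
          forall r x, 0 < r <= 1 -> m_k m k r = c * t ->
                      1 <= x -> M_k M k x = c * t ->
          nrm (f t) <= K * (r + x^-1)) /\
     (* (b) *)
     ((exists G : nat -> R -> X, Cinf_derivs F G /\
         exists C : R, 0 < C /\
           (forall j s, 0 < `|s| <= 1 ->
              nrm (G j s) <= C * j`!%:R * `|s| * m `|s| ^+ j.+1) /\
           (forall j s, 1 <= `|s| ->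
              nrm (G j s) <= C * j`!%:R * M `|s| ^+ j.+1)) ->
        forall c : R, 0 < c < 2^-1 ->
        exists K t0 : R, forall t, t0 <= t ->
          forall r x, 0 < r <= 1 -> m_log m r = c * t ->
                      1 <= x -> M_log M x = c * t ->
          nrm (f t) <= K * (r + x^-1 + t^-1))).
Proof.
move=> [B fB] _ [L fL] [B1 fB1] F1 bF.
split; first exact: (decay f B L B1 fB fL fB1 F F1 bF).
move=> m M m1 _ m_dec M1 _ M_inc; split.
  move=> k k0 [G [hG [C [C0 [hl hh]]]]] c c0.
  exact: (decay_Ck f B L B1 fB fL fB1 F F1 bF m M m1 m_dec M1 M_inc k C G c k0 hG C0 hl hh c0).
move=> [G [hG [C [C0 [hl hh]]]]] c c0.
exact: (decay_Cinf f B L B1 fB fL fB1 F F1 bF m M m1 m_dec M1 M_inc C G c hG C0 hl hh c0).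
Qed.
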